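(* For every $\varepsilon > 0$ there is a $(2+\varepsilon)$-approximation algorithm for offline PSP-G, even when jobs have non-uniform release dates.
   Context: PSP-G: jobs $j \in J$ ($|J| = n$) with processing requirements $p_j \ge 0$ and release dates $r_j \ge 0$; groups $\mathcal{S} \subseteq 2^J$ with weights $w_S > 0$; a matrix $B = (b_{d,j}) \in \mathbb{Q}_{\ge 0}^{D\times n}$ defining $\mathcal{P} = \{y \in \mathbb{R}^n_{\ge 0} : By \le \mathbf{1}\}$. A (preemptive) schedule chooses at each time $t \ge 0$ a rate vector $y(t) \in \mathcal{P}$ with $y_j(t) = 0$ for $t < r_j$. Job $j$ completes at $C_j = \min\{t' : \int_0^{t'} y_j(t)\,\mathrm{d}t \ge p_j\}$, group $S$ at $C_S = \max_{j \in S} C_j$, and the objective is to minimize $\sum_S w_S C_S$. In the offline setting all data are known in advance. An $\alpha$-approximation algorithm runs in polynomial time and outputs a feasible schedule of objective at most $\alpha$ times the optimum.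
   Formalization: The ratio is not required when the infimum of the objective is 0 but not attained (possible only if B has a zero column, e.g. one job with p = 1, r = 0, b = 0); there no schedule is within any factor of the optimum. *)

(* Defs.v *)
From mathcomp Require Import all_boot all_order all_algebra.
From mathcomp Require Import all_classical all_reals all_analysis.

Set Implicit Arguments.
Unset Strict Implicit.
Unset Printing Implicit Defensive.

Import Order.TTheory GRing.Theory Num.Theory.
Local Open Scope classical_set_scope.
Local Open Scope ring_scope.

(** * Polynomial time

    Jones's WHILE language over binary trees (N. D. Jones, "Computability and
    Complexity", 1997).  Storing a tree is charged its size, so that the
    variables of a program occupy at most the input size plus the elapsed time,
    up to a constant depending on the program: an execution is
    simulated by a Turing machine with polynomial overhead, and conversely. *)

Inductive tree : Type := Leaf | Node of tree & tree.

Fixpoint tree_size (x : tree) : nat :=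
  if x is Node a b then (tree_size a + tree_size b).+1 else 1%N.

Definition is_node (x : tree) : bool := if x is Node _ _ then true else false.

Definition thd (x : tree) : tree := if x is Node a _ then a else Leaf.
Definition ttl (x : tree) : tree := if x is Node _ b then b else Leaf.

Inductive expr : Type :=
| Var of nat
| Nil
| Pair of expr & expr
| Hd of expr
| Tl of expr.

Inductive cmd : Type :=
| Assign of nat & expr
| Then of cmd & cmd
| IfNode of expr & cmd & cmd
| WhileNode of expr & cmd.

Definition store : Type := nat -> tree.

Definition update (s : store) (x : nat) (v : tree) : store :=
  fun y => if y == x then v else s y.

Fixpoint eval (s : store) (e : expr) : tree :=
  match e with
  | Var x => s x
  | Nil => Leaf
  | Pair e1 e2 => Node (eval s e1) (eval s e2)
  | Hd e1 => thd (eval s e1)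
  | Tl e1 => ttl (eval s e1)
  end.

(** [exec c s s' t]: from the store [s], [c] halts in [s'] after time [t]. *)
Inductive exec : cmd -> store -> store -> nat -> Prop :=
| ExecAssign s x e :
    exec (Assign x e) s (update s x (eval s e)) (tree_size (eval s e)).+1
| ExecThen c1 c2 s s1 s2 t1 t2 :
    exec c1 s s1 t1 -> exec c2 s1 s2 t2 -> exec (Then c1 c2) s s2 (t1 + t2)
| ExecIfTrue e c1 c2 s s' t :
    is_node (eval s e) -> exec c1 s s' t -> exec (IfNode e c1 c2) s s' t.+1
| ExecIfFalse e c1 c2 s s' t :
    ~~ is_node (eval s e) -> exec c2 s s' t -> exec (IfNode e c1 c2) s s' t.+1
| ExecWhileDone e c s :
    ~~ is_node (eval s e) -> exec (WhileNode e c) s s 1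
| ExecWhileStep e c s s1 s2 t1 t2 :
    is_node (eval s e) -> exec c s s1 t1 -> exec (WhileNode e c) s1 s2 t2 ->
    exec (WhileNode e c) s s2 (t1 + t2).+1.

(** Input and output are passed in variable 0; the other variables are
    initially [Leaf]. *)
Definition computes_in (c : cmd) (input output : tree) (t : nat) : Prop :=
  exists s : store,
    exec c (update (fun=> Leaf) 0 input) s t /\ s 0%N = output.

(** * Encodings: numbers are written in binary, least significant bit first *)

Definition enc_seq (T : Type) (enc : T -> tree) (s : seq T) : tree :=
  foldr (fun x acc => Node (enc x) acc) Leaf s.

Definition enc_bool (b : bool) : tree := if b then Node Leaf Leaf else Leaf.

Definition nat_bits (k : nat) : seq bool :=
  [seq odd (k %/ 2 ^ i) | i <- iota 0 (up_log 2 k.+1)].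

Definition enc_nat (k : nat) : tree := enc_seq enc_bool (nat_bits k).

Definition enc_rat (a : rat) : tree :=
  Node (enc_bool (a < 0)) (Node (enc_nat `|numq a|%N) (enc_nat `|denq a|%N)).

Definition enc_row (n : nat) (v : 'rV[rat]_n) : tree :=
  enc_seq (fun j => enc_rat (v 0 j)) (enum 'I_n).

Definition enc_subset (n : nat) (S : {set 'I_n}) : tree :=
  enc_seq (fun j => enc_bool (j \in S)) (enum 'I_n).

(** * The problem PSP-G *)

(** [groups] lists the members of the family together with their weights. *)
Record psp := Psp {
  njobs : nat;
  nrows : nat;
  proc : 'rV[rat]_njobs;
  release : 'rV[rat]_njobs;
  pack : 'M[rat]_(nrows, njobs);
  groups : seq ({set 'I_njobs} * rat) }.

Definition psp_wf (I : psp) : Prop :=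
  [/\ forall j, 0 <= proc I 0 j,
      forall j, 0 <= release I 0 j,
      forall d j, 0 <= pack I d j,
      uniq (unzip1 (groups I))
    & forall g, g \in groups I -> 0 < g.2].

Definition enc_psp (I : psp) : tree :=
  Node (enc_row (proc I))
    (Node (enc_row (release I))
      (Node (enc_seq (fun d => enc_row (row d (pack I))) (enum 'I_(nrows I)))
        (enc_seq (fun g => Node (enc_subset g.1) (enc_rat g.2)) (groups I)))).

Section Schedules.
Variables (R : realType) (I : psp).
Implicit Type y : R -> 'rV[R]_(njobs I).

Definition polyhedron : set 'rV[R]_(njobs I) :=
  [set v | (forall j, 0 <= v 0 j) /\
           (forall d, \sum_j ratr (pack I d j) * v 0 j <= 1)].

Definition finished y (j : 'I_(njobs I)) : set R :=
  [set t' : R | 0 <= t' /\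
    ((ratr (proc I 0 j))%:E <=
       \int[lebesgue_measure]_(t in `[0%R, t']) (y t 0 j)%:E)%E].

Definition completion y (j : 'I_(njobs I)) : R := inf (finished y j).

(** The last clause says that the infimum defining each completion time is a
    minimum; in particular every job is completed. *)
Definition feasible y : Prop :=
  [/\ forall j, measurable_fun (`[0, +oo[ : set R) (fun t : R => y t 0 j),
      forall t : R, 0 <= t -> polyhedron (y t),
      forall (t : R) j, 0 <= t -> t < ratr (release I 0 j) -> y t 0 j = 0
    & forall j, finished y j (completion y j)].

(** The completion time of the empty group is 0. *)
Definition group_completion y (S : {set 'I_(njobs I)}) : R :=
  \big[Num.max/0]_(j in S) completion y j.

Definition objective y : R :=
  \sum_(g <- groups I) ratr g.2 * group_completion y g.1.

Definition optimum : R := inf [set objective y | y in feasible].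

End Schedules.

(** An explicit schedule is a list of pairs (end time, rate vector): the rate
    vector at time [t] is that of the first piece whose end time exceeds [t],
    and 0 after the last piece. *)
Definition explicit_schedule (n : nat) : Type := seq (rat * 'rV[rat]_n).

Fixpoint rates (R : realType) (n : nat) (s : explicit_schedule n) (t : R) :
    'rV[R]_n :=
  if s is (e, v) :: s' then
    if t < ratr e then map_mx ratr v else rates s' t
  else 0.

Definition enc_schedule (n : nat) (s : explicit_schedule n) : tree :=
  enc_seq (fun ev => Node (enc_rat ev.1) (enc_row ev.2)) s.

(** If a column of the packing matrix is zero, rates are unbounded and the
    infimum of the objective need not be attained.  When that infimum is 0 and
    is not attained (one job of size 1 released at 0, and no packing
    constraint), no schedule whatsoever is within a constant factor of it; the
    approximation guarantee is required in all other cases. *)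
Definition approximation_algorithm (R : realType) (alpha : R) (c : cmd) : Prop :=
  exists q : {poly nat}, forall I : psp, psp_wf I ->
    exists (s : explicit_schedule (njobs I)) (t : nat),
      [/\ computes_in c (enc_psp I) (enc_schedule s) t,
          (t <= q.[tree_size (enc_psp I)])%N,
          feasible (rates s : R -> 'rV[R]_(njobs I))
        & (optimum R I = 0 -> exists2 y : R -> 'rV[R]_(njobs I),
             feasible y & objective y = 0) ->
          objective (rates s : R -> 'rV[R]_(njobs I)) <= alpha * optimum R I].

(* Main.v *)
Require Import Defs.
From mathcomp Require Import all_boot all_order all_algebra.
From mathcomp Require Import all_classical all_reals all_analysis.
From mathcomp Require Import measurable_realfun zify ring lra.
Import Order.TTheory GRing.Theory Num.Theory.
Local Open Scope ring_scope.

Set Implicit Arguments.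
Unset Strict Implicit.
Unset Printing Implicit Defensive.

(** Cut time into slots that grow geometrically with ratio about 1 + 1/K.
    Delaying the work of any schedule by one slot yields a solution of a linear
    program in which [x(k,j)] is the fraction of job [j] processed in slot [k],
    [z(k,g)] the fraction of group [g] unfinished after slot [k], and
    [z(k,g) + sum_(k' <= k) x(k',j) >= 1] for all [j] in [g]; its cost exceeds
    that of the schedule by a factor 1 + O(1/K) only, the first slot being
    negligible against an optimum that is either 0 or at least the inverse cube
    of a common denominator.  For a guessed cost [V] this is a mixed packing and
    covering program, which multiplicative weights solve up to a factor
    1 + O(1/K) using natural numbers only.  Speeding the fractional solution up
    by [1 / theta], with [theta = i/K], completes a group once a fraction [theta]
    of it is finished in the program, at a time [C_theta / theta].  The mean of
    [C_theta] over uniform [theta] is the cost of the program, so under the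
    density [2 theta] the mean of [C_theta / theta] is twice that cost, and some
    [theta] does at least as well.

    Polynomial time is obtained compositionally: [pf] is the class of functions
    on encodings computed by a polynomially bounded program, and it is closed
    under the constructions from which the algorithm is assembled. *)

(** * Polynomial-time functions on encodings *)

(** An exact solver for the linear program would have to be written and analysed in the WHILE
    language. Multiplicative weights get by with sums, products and comparisons. Rescaling the
    columns so that all have the same largest entry makes the number of steps depend on [K] and the
    number of rows only, not on the size of the coefficients; the weights, products of polynomially
    many factors, then have polynomially many bits.

    A guessed cost is never checked for feasibility. The packing bound holds for every run, a final
    slot long enough for all jobs turns every outcome into a feasible schedule, and a candidate is
    accepted when its computed cost passes the inequality that averaging provides. Completeness of
    the method is needed for one good guess only.

    The optimum may be an infimum that is not attained, because jobs outside all packing constraints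
    have unbounded rates. The analysis therefore compares with a near-optimal schedule, truncates
    the work of a job in a slot at its requirement, and treats separately the instances in which no
    group member has a positive lower bound on its completion time: exactly there the optimum is
    0. *)

Section Polytime.
Local Open Scope nat_scope.

(** Adding 2 makes the base at least 2, so that sums and constants are absorbed by a larger exponent
    and no coefficients are needed. *)
Definition pbd (A : Type) (e : A -> tree) (g : A -> nat) : Prop :=
  exists k, forall a, g a <= (tree_size (e a) + 2) ^ k.

(** Variable 0 holds the input and then the output; the scratch variables
    below [m] are assumed to be empty and are emptied again, which is what makes
    such programs composable. *)
Definition pf (A B : Type) (eA : A -> tree) (eB : B -> tree) (f : A -> B) : Prop :=
  exists c m g, pbd eA g /\
    forall a s, (forall i, 0 < i < m -> s i = Leaf) -> s 0 = eA a ->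
      exists2 t, exec c s (update s 0 (eB (f a))) t & t <= g a.

Lemma leq_exp2r_weak m n k : m <= n -> m ^ k <= n ^ k.
Proof. by case: k => // k h; rewrite leq_exp2r. Qed.

Section Pbd.
Variables (A : Type) (e : A -> tree).
Implicit Types g : A -> nat.

Lemma pbd_le g g' : (forall a, g a <= g' a) -> pbd e g' -> pbd e g.
Proof. by move=> h [k hk]; exists k => a; exact: leq_trans (h a) (hk a). Qed.

Lemma pbd_add g g' : pbd e g -> pbd e g' -> pbd e (fun a => g a + g' a).
Proof.
move=> [k hk] [k' hk']; exists (k + k').+1 => a.
set n := tree_size (e a) + 2.
have n2 : 1 < n by rewrite /n addn2.
have h1 : g a <= n ^ (k + k').
  by apply: leq_trans (hk a) _; rewrite leq_exp2l // leq_addr.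
have h2 : g' a <= n ^ (k + k').
  by apply: leq_trans (hk' a) _; rewrite leq_exp2l // leq_addl.
rewrite expnS; apply: leq_trans (leq_add h1 h2) _.
by rewrite addnn -mul2n leq_mul2r n2 orbT.
Qed.

Lemma pbd_mul g g' : pbd e g -> pbd e g' -> pbd e (fun a => g a * g' a).
Proof. by move=> [k hk] [k' hk']; exists (k + k') => a; rewrite expnD leq_mul. Qed.

Lemma pbd_const n : pbd e (fun=> n).
Proof.
exists n => a; apply: (@leq_trans (2 ^ n)); first exact: ltnW (ltn_expl _ _).
by case: n => // n; rewrite leq_exp2r // addn2.
Qed.

Lemma pbd_size : pbd e (fun a => tree_size (e a)).
Proof. by exists 1 => a; rewrite expn1 leq_addr. Qed.

Lemma pbd_succ g : pbd e g -> pbd e (fun a => (g a).+1).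
Proof.
move=> h; apply: pbd_le (pbd_add h (pbd_const 1)) => a.
by rewrite addn1.
Qed.

Lemma pbd_exp n g : pbd e g -> pbd e (fun a => g a ^ n).
Proof.
move=> h; elim: n => [|n IH]; first exact: pbd_const 1.
apply: pbd_le (pbd_mul h IH) => a.
by rewrite expnS.
Qed.

End Pbd.

Lemma pbd_comp A B (eA : A -> tree) (eB : B -> tree) (g : B -> nat) (f : A -> B) :
  pbd eB g -> pbd eA (fun a => tree_size (eB (f a))) -> pbd eA (fun a => g (f a)).
Proof.
move=> [k hk] h; apply: (pbd_le (fun a => hk (f a))).
exact: pbd_exp (pbd_add h (pbd_const _ _)).
Qed.

(** Storing a tree costs its size, so no variable grows faster than time passes. A polynomial
    running time thus forces a polynomial output, which is what composition needs. *)
Lemma exec_size c s s' t : exec c s s' t ->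
  forall x, tree_size (s' x) <= tree_size (s x) + t.
Proof.
elim=> {c s s' t}.
- move=> s x e y; rewrite /update; case: eqP => _; last exact: leq_addr.
  by rewrite addnS -addSn leq_addl.
- move=> c1 c2 s s1 s2 t1 t2 _ h1 _ h2 x.
  by apply: leq_trans (h2 x) _; rewrite addnA leq_add2r.
- by move=> e c1 c2 s s' t _ _ h x; rewrite addnS; apply: leqW.
- by move=> e c1 c2 s s' t _ _ h x; rewrite addnS; apply: leqW.
- by move=> e c s _ x; rewrite leq_addr.
move=> e c s s1 s2 t1 t2 _ _ h1 _ h2 x.
rewrite addnS addnA; apply: leqW; apply: leq_trans (h2 x) _.
by rewrite leq_add2r.
Qed.

Lemma update_same s x v w : update (update s x v) x w = update s x w.
Proof. by apply/funext => y; rewrite /update; case: eqP. Qed.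

Lemma updateE s x v : update s x v x = v.
Proof. by rewrite /update eqxx. Qed.

Lemma updateN s x v y : y != x -> update s x v y = s y.
Proof. by rewrite /update; case: eqP. Qed.

Lemma update_swap s x y v w : (y == x) = false ->
  update (update s x v) y w = update (update s y w) x v.
Proof.
move=> yx; apply/funext => z; rewrite /update.
by case: (z =P x) => [->|//]; rewrite eq_sym yx.
Qed.

Lemma exec_assign s s' x e v :
  Defs.eval s e = v -> s' = update s x v -> exec (Assign x e) s s' (tree_size v).+1.
Proof. by move=> <- ->; exact: ExecAssign. Qed.

Lemma pf_size A B (eA : A -> tree) (eB : B -> tree) (f : A -> B) :
  pf eA eB f -> pbd eA (fun a => tree_size (eB (f a))).
Proof.
move=> [c [m [g [hg h]]]]; apply: pbd_le (pbd_add (pbd_size eA) hg) => a.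
have [||t ht le_t] := h a (fun i => if i == 0 then eA a else Leaf).
- by case.
- by [].
apply: leq_trans (exec_size ht 0) _.
by rewrite leq_add2l.
Qed.

Lemma pf_comp A B C (eA : A -> tree) (eB : B -> tree) (eC : C -> tree)
    (F : B -> C) (f : A -> B) :
  pf eB eC F -> pf eA eB f -> pf eA eC (fun a => F (f a)).
Proof.
move=> [c2 [m2 [g2 [hg2 h2]]]] hf; have szf := pf_size hf.
move: hf => [c1 [m1 [g1 [hg1 h1]]]].
exists (Then c1 c2), (maxn m1 m2), (fun a => g1 a + g2 (f a)); split.
  by apply: pbd_add hg1 _; apply: pbd_comp szf.
move=> a s sL s0.
have [||t1 e1 l1] := h1 a s; rewrite ?s0 //.
  by move=> i /andP[i0 im]; apply: sL; rewrite i0 leq_max im.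
have [||t2 e2 l2] := h2 (f a) (update s 0 (eB (f a))); rewrite ?updateE //.
  move=> i /andP[i0 im]; rewrite updateN -?lt0n //.
  by apply: sL; rewrite i0 leq_max im orbT.
exists (t1 + t2); last exact: leq_add.
by apply: ExecThen e1 _; rewrite update_same in e2.
Qed.

Definition eprod A B (eA : A -> tree) (eB : B -> tree) (p : A * B) : tree :=
  Node (eA p.1) (eB p.2).

Lemma pf_assign A B (eA : A -> tree) (eB : B -> tree) (f : A -> B) (x : expr) :
  (forall (s : store) a, s 0 = eA a -> Defs.eval s x = eB (f a)) ->
  pbd eA (fun a => tree_size (eB (f a))) -> pf eA eB f.
Proof.
move=> hx hs; exists (Assign 0 x), 0, (fun a => (tree_size (eB (f a))).+1).
split; first exact: pbd_succ.
move=> a s _ s0; have := ExecAssign s 0 x; rewrite (hx s a s0) => h.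
by eexists; first exact: h.
Qed.

Lemma pf_id A (e : A -> tree) : pf e e id.
Proof. by apply: (@pf_assign _ _ _ _ _ (Var 0)); last exact: pbd_size. Qed.

Lemma pf_fst0 A B (eA : A -> tree) (eB : B -> tree) : pf (eprod eA eB) eA fst.
Proof.
apply: (@pf_assign _ _ _ _ _ (Hd (Var 0))) => [s a /= -> //|].
by apply: pbd_le (pbd_size _) => a; rewrite /=; lia.
Qed.

Lemma pf_snd0 A B (eA : A -> tree) (eB : B -> tree) : pf (eprod eA eB) eB snd.
Proof.
apply: (@pf_assign _ _ _ _ _ (Tl (Var 0))) => [s a /= -> //|].
by apply: pbd_le (pbd_size _) => a; rewrite /=; lia.
Qed.

Fixpoint expr_of_tree (x : tree) : expr :=
  if x is Node a b then Pair (expr_of_tree a) (expr_of_tree b) else Defs.Nil.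

Lemma pf_const A B (eA : A -> tree) (eB : B -> tree) (b : B) : pf eA eB (fun=> b).
Proof.
apply: (@pf_assign _ _ _ _ _ (expr_of_tree (eB b))); last exact: pbd_const.
by move=> s _ _; elim: (eB b) => //= x -> y ->.
Qed.

Lemma pf_cast A B C (e : A -> tree) (eB : B -> tree) (eC : C -> tree)
    (f : A -> B) (g : A -> C) :
  (forall a, eC (g a) = eB (f a)) -> pf e eB f -> pf e eC g.
Proof.
move=> h [c [m [k [hk hc]]]]; exists c, m, k; split=> // a s sL s0.
by have [t] := hc a s sL s0; exists t; rewrite ?h.
Qed.

Lemma pf_ext A B (eA : A -> tree) (eB : B -> tree) (f g : A -> B) :
  (forall a, g a = f a) -> pf eA eB f -> pf eA eB g.
Proof. by move=> h; apply: pf_cast => a; rewrite h. Qed.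

(** The variables [m] and [m.+1] lie above the scratch space of both programs; they keep the input
    and the first result while the second program runs on the restored input. *)
Lemma pf_pair A B C (eA : A -> tree) (eB : B -> tree) (eC : C -> tree)
    (f : A -> B) (g : A -> C) :
  pf eA eB f -> pf eA eC g -> pf eA (eprod eB eC) (fun a => (f a, g a)).
Proof.
move=> hf hg; have szf := pf_size hf; have szg := pf_size hg.
move: hf hg => [c1 [m1 [g1 [hg1 h1]]]] [c2 [m2 [g2 [hg2 h2]]]].
pose m := (maxn m1 m2).+1.
have m0 : (m == 0) = false by [].
have m10 : (m.+1 == 0) = false by [].
have mm : (m.+1 == m) = false by apply/eqP; lia.
have mm' : (m == m.+1) = false by apply/eqP; lia.
exists (Then (Assign m (Var 0)) (Then c1 (Then (Assign m.+1 (Var 0))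
        (Then (Assign 0 (Var m)) (Then c2 (Then
        (Assign 0 (Pair (Var m.+1) (Var 0)))
        (Then (Assign m Defs.Nil) (Assign m.+1 Defs.Nil)))))))), m.+2,
  (fun a => 10 + (g1 a + g2 a + 2 * tree_size (eA a)
     + 2 * tree_size (eB (f a)) + tree_size (eC (g a)))); split.
  by do !apply: pbd_add => //; rewrite ?mul2n; try exact: pbd_const;
    try apply: pbd_mul; try exact: pbd_size; try exact: pbd_const.
move=> a s sL s0.
have [||t1 e1 l1] := h1 a (update s m (eA a)).
- move=> i ?; rewrite updateN; last by lia.
  by apply: sL; lia.
- by rewrite updateN.
have [||t2 e2 l2] := h2 a (update (update (update s m (eA a)) m.+1 (eB (f a))) 0 (eA a)).
- move=> i ?; rewrite !updateN; try by lia.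
  by apply: sL; lia.
- by rewrite updateE.
have s1L : s m = Leaf by apply: sL; lia.
have s2L : s m.+1 = Leaf by apply: sL; lia.
pose y := eB (f a); pose z := eC (g a).
pose S1 := update s m (eA a); pose S3 := update S1 m.+1 y.
exists ((tree_size (eA a)).+1 + (t1 + ((tree_size y).+1 + ((tree_size (eA a)).+1
   + (t2 + ((tree_size (Node y z)).+1 + (2 + 2))))))); last by rewrite /= /y /z; lia.
apply: (@ExecThen _ _ _ S1); first exact: exec_assign.
apply: (ExecThen e1); apply: (@ExecThen _ _ _ (update S3 0 y)).
  by apply: exec_assign; [|rewrite /S3 update_swap].
apply: (@ExecThen _ _ _ (update S3 0 (eA a))).
  apply: exec_assign; last by rewrite update_same.
  by rewrite /= /S3 /S1 /update /= ?eqxx ?mm ?mm' ?eqxx.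
apply: (ExecThen e2); apply: (@ExecThen _ _ _ (update S3 0 (Node y z))).
  apply: exec_assign; last by rewrite !update_same.
  by rewrite /= /S3 /S1 /update /= ?eqxx ?mm ?mm'.
apply: (@ExecThen _ _ _ (update (update s m.+1 y) 0 (Node y z))).
  apply: (exec_assign (v := Leaf)) => //.
  apply/funext => i; rewrite /S3 /S1 /update.
  by case: (i =P m) => [->|_]; rewrite ?m0 ?mm'.
apply: (exec_assign (v := Leaf)) => //.
apply/funext => i; rewrite /update.
by case: (i =P m.+1) => [->|_]; rewrite ?m10.
Qed.

Definition ebool := enc_bool.

Lemma pf_if A B (e : A -> tree) (eB : B -> tree) (b : A -> bool) (f g : A -> B) :
  pf e ebool b -> pf e eB f -> pf e eB g -> pf e eB (fun a => if b a then f a else g a).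
Proof.
move=> hb [c1 [m1 [g1 [hg1 h1]]]] [c2 [m2 [g2 [hg2 h2]]]].
suff h : pf (eprod ebool e) eB (fun x => if x.1 then f x.2 else g x.2).
  exact: (pf_comp h (pf_pair hb (pf_id e))).
exists (IfNode (Hd (Var 0)) (Then (Assign 0 (Tl (Var 0))) c1)
   (Then (Assign 0 (Tl (Var 0))) c2)), (maxn m1 m2),
  (fun x => 2 + (tree_size (e x.2) + (g1 x.2 + g2 x.2))); split.
  have h := pf_snd0 ebool e; have sz := pf_size h.
  do !apply: pbd_add => //; try exact: pbd_const; exact: pbd_comp sz.
move=> [x a] s sL s0 /=.
have s1L m' : m' <= maxn m1 m2 -> forall i, 0 < i < m' -> update s 0 (e a) i = Leaf.
  by move=> ? i ?; rewrite updateN; [apply: sL|]; lia.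
have ev : Defs.eval s (Tl (Var 0)) = e a by rewrite /= s0.
have ev1 : Defs.eval s (Hd (Var 0)) = ebool x by rewrite /= s0.
case: x s0 ev1 => s0 ev1.
  have [||t e1 l1] := h1 a (update s 0 (e a)); rewrite ?updateE //.
    by apply: s1L; rewrite leq_maxl.
  eexists.
    apply: ExecIfTrue; first by rewrite ev1.
    by apply: ExecThen; first exact: ExecAssign; rewrite ev; move: e1; rewrite update_same; exact.
  by rewrite ev; lia.
have [||t e1 l1] := h2 a (update s 0 (e a)); rewrite ?updateE //.
  by apply: s1L; rewrite leq_maxr.
eexists.
  apply: ExecIfFalse; first by rewrite ev1.
  by apply: ExecThen; first exact: ExecAssign; rewrite ev; move: e1; rewrite update_same; exact.
by rewrite ev; lia.
Qed.

Definition eseq A (e : A -> tree) : seq A -> tree := enc_seq e.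

(** Once the input is paired with the list, a nonempty list has literally the encoding of the triple
    of input, head and tail, so the branch runs on variable 0 unchanged. *)
Lemma pf_case A X B (e : A -> tree) (eX : X -> tree) (eB : B -> tree)
    (l : A -> seq X) (F : A -> X -> seq X -> B) (G : A -> B) :
  pf e (eseq eX) l -> pf (eprod e (eprod eX (eseq eX))) eB (fun z => F z.1 z.2.1 z.2.2) ->
  pf e eB G -> pf e eB (fun a => if l a is x :: l' then F a x l' else G a).
Proof.
move=> hl [c1 [m1 [g1 [hg1 h1]]]] hG.
pose F' (z : A * seq X) := if z.2 is x :: l' then F z.1 x l' else G z.1.
suff h : pf (eprod e (eseq eX)) eB F' by exact: (pf_comp h (pf_pair (pf_id e) hl)).
have [c2 [m2 [g2 [hg2 h2]]]] := pf_comp hG (pf_fst0 e (eseq eX)).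
exists (IfNode (Tl (Var 0)) c1 c2), (maxn m1 m2),
  (fun z : A * seq X => 1 + ((if z.2 is x :: l' then g1 (z.1, (x, l')) else 0) + g2 z)); split.
  do !apply: pbd_add => //; try exact: pbd_const.
  by move: hg1 => [k hk]; exists k => -[a [|x l']] //=; exact: hk (a, (x, l')).
move=> [a [|x l']] s sL s0.
  have [||t e1 l1] := h2 (a, [::]) s; rewrite ?s0 //.
    by move=> i ?; apply: sL; lia.
  exists t.+1; last by rewrite /= add0n.
  by apply: ExecIfFalse => //=; rewrite s0.
have [||t e1 l1] := h1 (a, (x, l')) s; rewrite ?s0 //.
  by move=> i ?; apply: sL; lia.
exists t.+1; last by rewrite /=; lia.
by apply: ExecIfTrue => //=; rewrite s0.
Qed.

Lemma size_eseq A (e : A -> tree) l :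
  tree_size (eseq e l) = (\sum_(x <- l) (tree_size (e x)).+1).+1.
Proof. by elim: l => [|x l IH]; rewrite ?big_nil // big_cons /= -/(eseq e l) IH; lia. Qed.

(** Iterating a polynomial-time step may square the size in every round. The last hypothesis
    excludes this by bounding all intermediate accumulators in terms of the original input. Every
    loop below is derived from this one. *)
Lemma pf_foldl A X B (e : A -> tree) (eX : X -> tree) (eB : B -> tree)
    (l : A -> seq X) (b : A -> B) (F : A -> B -> X -> B) (g : A -> nat) :
  pf (eprod e (eprod eB eX)) eB (fun z => F z.1 z.2.1 z.2.2) ->
  pf e (eseq eX) l -> pf e eB b -> pbd e g ->
  (forall a l1 l2, l a = l1 ++ l2 -> tree_size (eB (foldl (F a) (b a) l1)) <= g a) ->
  pf e eB (fun a => foldl (F a) (b a) (l a)).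
Proof.
move=> [c [m0 [g1 [[k hk] h]]]] hl hb hg hsz.
have szl := pf_size hl; have szb := pf_size hb.
pose F' (z : A * (seq X * B)) := foldl (F z.1) z.2.2 z.2.1.
have [c0 [m1 [g2 [hg2 h0]]]] := pf_pair (pf_id e) (pf_pair hl hb).
pose m := (maxn m0 m1).+1.
have m10 : (m.+1 == 0) = false by [].
have mm : (m.+1 == m) = false by apply/eqP; lia.
have mm' : (m == m.+1) = false by apply/eqP; lia.
have m00 : (m == 0) = false by [].
pose body := Then (Assign 0 (Pair (Var m) (Pair (Var 0) (Hd (Var m.+1)))))
             (Then c (Assign m.+1 (Tl (Var m.+1)))).
(* [S] bounds the size of the argument of the step program, hence [S a ^ k] its time; [W] adds the
   cost of moving data in one round. *)
pose S a := tree_size (e a) + (g a + tree_size (eseq eX (l a))) + 4.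
pose W a := (S a) ^ k + 2 * S a + 4.
exists (Then c0 (Then (Assign m (Hd (Var 0))) (Then (Assign m.+1 (Hd (Tl (Var 0))))
  (Then (Assign 0 (Tl (Tl (Var 0)))) (Then (WhileNode (Var m.+1) body) (Assign m Defs.Nil)))))), m.+2,
  (fun a => g2 a + (10 + (tree_size (e a) + tree_size (eseq eX (l a)) + tree_size (eB (b a)))
      + tree_size (eseq eX (l a)) * W a)).
have pS : pbd e S by rewrite /S; do !apply: pbd_add => //; [exact: pbd_size|exact: pbd_const].
split.
  do !apply: pbd_add => //; try exact: pbd_const; try exact: pbd_size.
  apply: pbd_mul => //.
  exact: (pbd_add (pbd_add (pbd_exp k pS) (pbd_mul (pbd_const _ 2) pS)) (pbd_const _ 4)).
move=> a s sL s0.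
have [||t0 e0 l0] := h0 a s; rewrite ?s0 //.
  by move=> i ?; apply: sL; lia.
pose st l2 y := update (update (update s m (e a)) m.+1 (eseq eX l2)) 0 y.
have loop l1 l2 : l a = l1 ++ l2 ->
  exists2 t, exec (WhileNode (Var m.+1) body) (st l2 (eB (foldl (F a) (b a) l1)))
      (st [::] (eB (foldl (F a) (b a) (l a)))) t & t <= 1 + size l2 * W a.
  elim: l2 l1 => [|x l2 IH] l1 El.
    exists 1 => //; rewrite El cats0; apply: ExecWhileDone.
    by rewrite /= /st /update /= eqxx.
  have El' : l a = rcons l1 x ++ l2 by rewrite cat_rcons.
  have [t' et lt] := IH _ El'.
  set y := foldl (F a) (b a) l1.
  have [||t1 e1 l1t] := h (a, (y, x)) (st (x :: l2) (Node (e a) (Node (eB y) (eX x)))).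
  - by move=> i ?; rewrite /st !updateN; try lia; apply: sL; lia.
  - by rewrite /st updateE.
  pose v := Node (e a) (Node (eB y) (eX x)).
  pose y' := eB (foldl (F a) (b a) (rcons l1 x)).
  exists (((tree_size v).+1 + (t1 + (tree_size (eseq eX l2)).+1) + t').+1).
    apply: ExecWhileStep et; first by rewrite /= /st updateN ?updateE.
    apply: (@ExecThen _ _ _ (st (x :: l2) v)).
      apply: exec_assign; last by rewrite /st update_same.
      by rewrite /= /st /update /= ?eqxx ?mm ?mm' ?eqxx.
    apply: (ExecThen e1).
    rewrite foldl_rcons -/y; apply: exec_assign.
      by rewrite /= /st /update /= ?eqxx ?mm ?mm' ?eqxx.
    apply/funext => i; rewrite /st /update.
    by case: (i =P m.+1) => [->|_] //; case: (i =P 0).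
  have sy := hsz a l1 (x :: l2) El; rewrite -/y in sy.
  have sx : tree_size (eX x) + tree_size (eseq eX l2) < tree_size (eseq eX (l a)).
    rewrite El !size_eseq big_cat big_cons /=; lia.
  have t1W : t1 <= S a ^ k.
    apply: leq_trans l1t _; apply: leq_trans (hk _) _.
    by apply: leq_exp2r_weak; rewrite /S /=; lia.
  have key : tree_size v + 3 + t1 + tree_size (eseq eX l2) <= W a.
    rewrite /W; apply: (@leq_trans (t1 + S a + 4)).
      by rewrite /v /= /S; clear -sy sx; lia.
    by clear -t1W; move: (S a ^ k) t1W => ?; lia.
  rewrite -[size (x :: l2)]/((size l2).+1) mulSn; move: lt key; move: (size l2 * W a) (W a); clear; lia.
have [t1 e1 l1] := loop [::] (l a) erefl.
have s1L : s m = Leaf by apply: sL; lia.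
have s2L : s m.+1 = Leaf by apply: sL; lia.
pose r := eB (foldl (F a) (b a) (l a)).
pose s3 := update s 0 (eprod e (eprod (eseq eX) eB) (a, (l a, b a))).
exists (t0 + ((tree_size (e a)).+1 + ((tree_size (eseq eX (l a))).+1
    + ((tree_size (eB (b a))).+1 + (t1 + 2))))).
  apply: (ExecThen e0).
  apply: (@ExecThen _ _ _ (update s3 m (e a))).
    by apply: exec_assign; rewrite // /s3 /update.
  apply: (@ExecThen _ _ _ (update (update s3 m (e a)) m.+1 (eseq eX (l a)))).
    by apply: exec_assign; rewrite // /s3 /update.
  apply: (@ExecThen _ _ _ (st (l a) (eB (b a)))).
    apply: exec_assign; first by rewrite /s3 /update.
    by apply/funext => i; rewrite /s3 /st /update; case: (i =P 0).
  apply: (ExecThen e1); apply: (exec_assign (v := Leaf)) => //.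
  apply/funext => i; rewrite /st /update.
  by case: (i =P m) => [->|_]; rewrite ?m00 //; case: (i =P m.+1) => [->|_].
have szl' : size (l a) <= tree_size (eseq eX (l a)).
  by elim: (l a) => //= x l' IH; rewrite -/(eseq eX l'); lia.
have : size (l a) * W a <= tree_size (eseq eX (l a)) * W a by rewrite leq_mul2r szl' orbT.
lia.
Qed.

End Polytime.

Section Lift.
Local Open Scope nat_scope.

Variables (T A B C D : Type) (e : T -> tree) (eA : A -> tree) (eB : B -> tree).
Variables (eC : C -> tree) (eD : D -> tree).

Lemma pf_fst f : pf e (eprod eA eB) f -> pf e eA (fun a => (f a).1).
Proof. exact: (pf_comp (pf_fst0 eA eB)). Qed.

Lemma pf_snd f : pf e (eprod eA eB) f -> pf e eB (fun a => (f a).2).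
Proof. exact: (pf_comp (pf_snd0 eA eB)). Qed.

Lemma pf2 (F : A -> B -> C) f g : pf (eprod eA eB) eC (fun x => F x.1 x.2) ->
  pf e eA f -> pf e eB g -> pf e eC (fun a => F (f a) (g a)).
Proof. by move=> hF hf hg; exact: (pf_comp hF (pf_pair hf hg)). Qed.

Lemma pf3 (F : A -> B -> C -> D) f g h :
  pf (eprod eA (eprod eB eC)) eD (fun x => F x.1 x.2.1 x.2.2) ->
  pf e eA f -> pf e eB g -> pf e eC h -> pf e eD (fun a => F (f a) (g a) (h a)).
Proof. by move=> hF hf hg hh; exact: (pf_comp hF (pf_pair hf (pf_pair hg hh))). Qed.

End Lift.

Ltac pf_hook := fail.
Ltac pf1 := first
  [ eassumption | exact: pf_id | apply: pf_const
  | pf_hook | apply: pf_fst | apply: pf_snd | apply: pf_pair | apply: pf_if ].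
Ltac pf := do 40? pf1.


(** * Polynomial-time operations on lists and booleans *)

Section Seqs.
Local Open Scope nat_scope.

Lemma pf_cons T (e : T -> tree) X (eX : X -> tree) f g : pf e eX f -> pf e (eseq eX) g ->
  pf e (eseq eX) (fun a => f a :: g a).
Proof. by move=> hf hg; apply: pf_cast (pf_pair hf hg). Qed.

Lemma pf_catrev T (e : T -> tree) X (eX : X -> tree) f g : pf e (eseq eX) f -> pf e (eseq eX) g ->
  pf e (eseq eX) (fun a => catrev (f a) (g a)).
Proof.
move=> hf hg; have sf := pf_size hf; have sg := pf_size hg.
apply: (@pf_ext _ _ _ _ (fun a => foldl (fun l x => x :: l) (g a) (f a))).
  by move=> a; elim: (f a) (g a) => //= x l IH l'; rewrite IH.
apply: (@pf_foldl _ _ _ _ eX _ f g (fun=> fun l x => x :: l) _ _ hf hg (pbd_add sf sg)).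
  by rewrite /=; apply: pf_cons; pf.
move=> a l1 l2 ->; rewrite size_eseq.
have -> : foldl (fun l x => x :: l) (g a) l1 = catrev l1 (g a).
  by elim: l1 (g a) => //= x l IH l'; rewrite IH.
by rewrite catrevE big_cat big_rev /= !size_eseq big_cat /=; lia.
Qed.

Lemma pf_rev T (e : T -> tree) X (eX : X -> tree) f : pf e (eseq eX) f -> pf e (eseq eX) (fun a => rev (f a)).
Proof. by move=> hf; apply: pf_catrev hf (pf_const _ _ [::]). Qed.

Lemma pf_cat T (e : T -> tree) X (eX : X -> tree) f g : pf e (eseq eX) f -> pf e (eseq eX) g ->
  pf e (eseq eX) (fun a => f a ++ g a).
Proof.
move=> hf hg; apply: pf_ext (pf_catrev (pf_rev hf) hg) => a.
by rewrite catrevE revK.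
Qed.

Lemma mem_size_eseq (A : Type) (eA : A -> tree) l1 x l2 :
  tree_size (eA x) < tree_size (eseq eA (l1 ++ x :: l2)).
Proof. by rewrite size_eseq big_cat big_cons /=; lia. Qed.

Lemma size_le_eseq (A : Type) (eA : A -> tree) l : size l <= tree_size (eseq eA l).
Proof. by elim: l => //= x l'; rewrite -/(eseq eA l'); lia. Qed.

Lemma pbd_pair T (e : T -> tree) X (eX : X -> tree) (F : T -> X -> nat) f : pbd (eprod e eX) (fun z => F z.1 z.2) ->
  pf e (eseq eX) f -> exists2 g, pbd e g &
    forall a l1 x l2, f a = l1 ++ x :: l2 -> F a x <= g a.
Proof.
move=> [k hk] hf; have sf := pf_size hf.
exists (fun a => (tree_size (e a) + tree_size (eseq eX (f a)) + 3) ^ k).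
  by apply: pbd_exp; do !apply: pbd_add => //; [exact: pbd_size|exact: pbd_const].
move=> a l1 x l2 E; apply: leq_trans (hk (a, x)) _.
by apply: leq_exp2r_weak; rewrite /= E; have := mem_size_eseq eX l1 x l2; lia.
Qed.

Lemma sum_bound (A : Type) (F : A -> nat) (c : nat) l :
  (forall l1 x l2, l = l1 ++ x :: l2 -> F x <= c) -> \sum_(x <- l) F x <= size l * c.
Proof.
elim: l => [|x l IH] h; first by rewrite big_nil.
rewrite big_cons /= mulSn leq_add //; first exact: (h [::] x l).
by apply: IH => l1 y l2 E; apply: (h (x :: l1) y l2); rewrite E.
Qed.

Lemma pf_map T (e : T -> tree) X (eX : X -> tree) Y (eY : Y -> tree) (F : T -> X -> Y) f : pf (eprod e eX) eY (fun z => F z.1 z.2) ->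
  pf e (eseq eX) f -> pf e (eseq eY) (fun a => [seq F a x | x <- f a]).
Proof.
move=> hF hf; have sf := pf_size hf.
have [g hg gle] := pbd_pair (F := fun a x => tree_size (eY (F a x))) (pf_size hF) hf.
have E a l : foldl (fun acc x => F a x :: acc) [::] l = rev (map (F a) l).
  rewrite /rev; elim: l [::] => //= x l IH acc; exact: IH.
apply: (@pf_ext _ _ _ _ (fun a => rev (foldl (fun acc x => F a x :: acc) [::] (f a)))).
  by move=> a; rewrite E revK.
apply: pf_rev; apply: (@pf_foldl _ _ _ _ eX _ f (fun=> [::])
   (fun a acc x => F a x :: acc) (fun a => (tree_size (eseq eX (f a)) * (g a).+1).+1)) => //.
- apply: pf_cons; last by pf.
  by apply: (pf2 (F := F) hF); pf.
- by pf.
- by apply: pbd_succ; apply: pbd_mul => //; apply: pbd_succ.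
move=> a l1 l2 El; rewrite E size_eseq big_rev big_map ltnS.
apply: leq_trans (sum_bound (c := (g a).+1) _) _ => [l3 x l4 E1|].
  by rewrite ltnS; apply: (gle a l3 x (l4 ++ l2)); rewrite El E1 -catA.
by rewrite leq_mul2r El size_eseq big_cat /=; have := size_le_eseq eX l1; rewrite size_eseq; lia.
Qed.

Lemma pf_flatten T (e : T -> tree) X (eX : X -> tree) f : pf e (eseq (eseq eX)) f -> pf e (eseq eX) (fun a => flatten (f a)).
Proof.
move=> hf; have sf := pf_size hf.
have E l : foldl (fun acc s => catrev s acc) [::] l = rev (flatten l).
  suff h acc : foldl (fun acc s => catrev s acc) acc l = catrev (flatten l) acc.
    by rewrite h.
  by elim: l acc => //= s l IH acc; rewrite IH !catrevE rev_cat catA.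
apply: (@pf_ext _ _ _ _ (fun a => rev (foldl (fun acc s => catrev s acc) [::] (f a)))).
  by move=> a; rewrite E revK.
apply: pf_rev; apply: (@pf_foldl _ _ _ _ (eseq eX) _ f (fun=> [::])
   (fun a acc x => catrev x acc) _ _ _ _ sf) => //.
- by apply: pf_catrev; pf.
- by pf.
move=> a l1 l2 ->; rewrite E !size_eseq big_rev big_cat /= ltnS.
apply: leq_trans (leq_addr _ _); elim: l1 => [|s l IH]; first by rewrite !big_nil.
by rewrite /= big_cat big_cons /= size_eseq; lia.
Qed.

Lemma pf_filter T (e : T -> tree) X (eX : X -> tree) (p : T -> X -> bool) f : pf (eprod e eX) ebool (fun z => p z.1 z.2) ->
  pf e (eseq eX) f -> pf e (eseq eX) (fun a => [seq x <- f a | p a x]).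
Proof.
move=> hp hf.
apply: (@pf_ext _ _ _ _ (fun a => flatten [seq if p a x then [:: x] else [::] | x <- f a])).
  by move=> a; elim: (f a) => //= x l ->; case: (p a x).
apply: pf_flatten; apply: pf_map hf.
by apply: pf_if; [exact: hp|apply: pf_cons; pf|pf].
Qed.

Lemma size_ebool b : tree_size (ebool b) <= 3.
Proof. by case: b. Qed.

Lemma pf_and T (e : T -> tree) f g : pf e ebool f -> pf e ebool g -> pf e ebool (fun a => f a && g a).
Proof. by move=> hf hg; apply: pf_if => //; pf. Qed.

Lemma pf_or T (e : T -> tree) f g : pf e ebool f -> pf e ebool g -> pf e ebool (fun a => f a || g a).
Proof. by move=> hf hg; apply: pf_if => //; pf. Qed.

Lemma pf_neg T (e : T -> tree) f : pf e ebool f -> pf e ebool (fun a => ~~ f a).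
Proof. by move=> hf; apply: pf_if => //; pf. Qed.

Lemma pf_eqb T (e : T -> tree) f g : pf e ebool f -> pf e ebool g -> pf e ebool (fun a => f a == g a).
Proof.
move=> hf hg; apply: (@pf_ext _ _ _ _ (fun a => if f a then g a else ~~ g a)).
  by move=> a; case: (f a); case: (g a).
by apply: pf_if => //; apply: pf_neg.
Qed.

Lemma pf_all T (e : T -> tree) X (eX : X -> tree) (p : T -> X -> bool) f : pf (eprod e eX) ebool (fun z => p z.1 z.2) ->
  pf e (eseq eX) f -> pf e ebool (fun a => all (p a) (f a)).
Proof.
move=> hp hf.
apply: (@pf_ext _ _ _ _ (fun a => foldl (fun b x => b && p a x) true (f a))).
  move=> a; rewrite -[LHS]andTb; elim: (f a) true => [|x l IH] b /=.
    by rewrite andbT.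
  by rewrite -IH andbA.
apply: (@pf_foldl _ _ _ _ eX _ f (fun=> true) (fun a b x => b && p a x) _ _ _ _ (pbd_const _ 3)) => //.
- by apply: pf_and; [pf|apply: (pf2 (F := p) hp); pf].
- by pf.
- by move=> *; exact: size_ebool.
Qed.

End Seqs.

(** * Unary numbers *)

Section Unary.
Local Open Scope nat_scope.

(** Loop counts, slots and indices are unary, because a loop whose length is given in binary may
    take exponential time. *)
Definition eun (n : nat) : tree := eseq (fun=> Leaf) (nseq n tt).

Lemma size_eun n : tree_size (eun n) = (n.*2).+1.
Proof. by elim: n => //= n; rewrite -/(eun n); lia. Qed.

Lemma pf_unS T (e : T -> tree) f : pf e eun f -> pf e eun (fun a => (f a).+1).
Proof.
have h : pf e (fun=> Leaf) (fun=> tt) by apply: pf_const.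
move=> hf; apply: pf_cast (pf_pair h hf).
by [].
Qed.

Lemma pf_iter T (e : T -> tree) B (eB : B -> tree) (F : T -> B -> B) n b (g : T -> nat) :
  pf (eprod e eB) eB (fun z => F z.1 z.2) -> pf e eun n -> pf e eB b -> pbd e g ->
  (forall a i, i <= n a -> tree_size (eB (iter i (F a) (b a))) <= g a) ->
  pf e eB (fun a => iter (n a) (F a) (b a)).
Proof.
move=> hF hn hb hg hs.
have E a l : foldl (fun y (_ : unit) => F a y) (b a) l = iter (size l) (F a) (b a).
  by elim/last_ind: l => //= l x IH; rewrite foldl_rcons IH size_rcons.
apply: (@pf_ext _ _ _ _ (fun a => foldl (fun y (_ : unit) => F a y) (b a) (nseq (n a) tt))).
  by move=> a; rewrite E size_nseq.
have hl : pf e (eseq (fun _ : unit => Leaf)) (fun a => nseq (n a) tt) by apply: pf_cast hn.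
apply: (@pf_foldl _ _ _ _ _ _ _ _ (fun a y (_ : unit) => F a y) _ _ hl hb hg).
  by apply: (pf2 (F := F) hF); pf.
move=> a l1 l2 El; rewrite E; apply: hs.
by rewrite -(size_nseq (n a) tt) El size_cat leq_addr.
Qed.

Lemma pf_size_un T (e : T -> tree) X (eX : X -> tree) f : pf e (eseq eX) f -> pf e eun (fun a => size (f a)).
Proof.
move=> hf; have sf := pf_size hf.
have hl : pf e (eseq (fun _ : unit => Leaf)) (fun a => [seq tt | x <- f a]).
  by apply: (@pf_map _ _ _ eX _ _ (fun _ _ => tt)) => //; pf.
apply: pf_cast hl => a; rewrite /eun; congr eseq.
by elim: (f a) => //= x l ->.
Qed.

Lemma pf_unD T (e : T -> tree) f g : pf e eun f -> pf e eun g -> pf e eun (fun a => f a + g a).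
Proof.
move=> hf hg; have sf := pf_size hf; have sg := pf_size hg.
have E (n m : nat) : iter n S m = n + m by elim: n => //= n ->.
apply: (@pf_ext _ _ _ _ (fun a => iter (f a) S (g a))) => [a|]; first by rewrite E.
apply: (@pf_iter _ _ _ _ (fun=> S) f g _ _ hf hg (pbd_add sf sg)).
  by apply: pf_unS; pf.
by move=> a i hi; rewrite E !size_eun; lia.
Qed.

End Unary.

Section UnaryMul.
Local Open Scope nat_scope.

Lemma pf_unM T (e : T -> tree) f g : pf e eun f -> pf e eun g -> pf e eun (fun a => f a * g a).
Proof.
move=> hf hg; have sf := pf_size hf; have sg := pf_size hg.
have E (n m : nat) : iter n (addn m) 0 = n * m by elim: n => //= n ->.
apply: (@pf_ext _ _ _ _ (fun a => iter (f a) (addn (g a)) 0)) => [a|]; first by rewrite E.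
apply: (@pf_iter _ _ _ _ (fun a => addn (g a)) f (fun=> 0) _ _ hf _ (pbd_mul sf sg)); last first.
- move=> a i hi; rewrite E !size_eun; apply: (@leq_trans ((f a * g a).*2).+1).
    by rewrite ltnS leq_double leq_mul2r hi orbT.
  by rewrite mulnS addSn mulSn; lia.
- by pf.
by apply: pf_unD; [apply: (pf_comp hg)|]; pf.
Qed.

End UnaryMul.

(** * Binary numbers: addition, comparison, multiplication, iterated operations *)

Section Binary.
Local Open Scope nat_scope.

Definition ebin : nat -> tree := enc_nat.

Definition bl (n : nat) : nat := size (nat_bits n).

Lemma blE n : bl n = up_log 2 n.+1.
Proof. by rewrite /bl size_map size_iota. Qed.

Lemma bl_lt n : n < 2 ^ bl n.
Proof. by rewrite blE; apply: up_logP. Qed.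

Lemma bl_le n k : n < 2 ^ k -> bl n <= k.
Proof. by rewrite blE => h; apply: up_log_min. Qed.

Lemma leq_bl m n : m <= n -> bl m <= bl n.
Proof. by move=> h; apply: bl_le; apply: leq_ltn_trans h (bl_lt n). Qed.

Lemma nat_bits0 : nat_bits 0 = [::].
Proof. by rewrite /nat_bits up_log1. Qed.

Lemma nat_bitsS n : 0 < n -> nat_bits n = odd n :: nat_bits n./2.
Proof.
move=> n0; have e : up_log 2 n.+1 = (up_log 2 n./2.+1).+1.
  apply/eqP; rewrite eqn_leq -!blE; apply/andP; split.
    apply: bl_le; rewrite expnS mul2n -ltn_half_double; exact: bl_lt.
  have : 0 < bl n by case: (bl n) (bl_lt n) => //; rewrite expn0; lia.
  case E : (bl n) => [//|k] _; rewrite ltnS; apply: bl_le.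
  by rewrite ltn_half_double -mul2n -expnS -E bl_lt.
rewrite /nat_bits e /= expn0 divn1; congr cons.
rewrite -[1]/(1 + 0) iotaDl -map_comp; apply: eq_map => i /=.
by rewrite expnS divnMA divn2.
Qed.

Lemma size_ebin n : tree_size (ebin n) <= 4 * bl n + 1.
Proof.
rewrite /ebin /enc_nat /bl; elim: (nat_bits n) => //= b l IH.
by rewrite -/(eseq enc_bool l) in IH *; have := size_ebool b; rewrite /ebool; move: IH; rewrite /eseq; lia.
Qed.

Lemma bl_size n : bl n <= tree_size (ebin n).
Proof. exact: size_le_eseq. Qed.

Section Gen.
Variables (T : Type) (e : T -> tree).

Lemma pbd_bl f : pf e ebin f -> pbd e (fun a => bl (f a)).
Proof. by move/pf_size; apply: pbd_le => a; exact: bl_size. Qed.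

Lemma pf_bits f : pf e ebin f -> pf e (eseq ebool) (fun a => nat_bits (f a)).
Proof. exact: pf_cast. Qed.

Lemma pf_bl f : pf e ebin f -> pf e eun (fun a => bl (f a)).
Proof. by move/pf_bits; exact: pf_size_un. Qed.

Lemma pf_odd f : pf e ebin f -> pf e ebool (fun a => odd (f a)).
Proof.
move=> /pf_bits hf.
apply: (@pf_ext _ _ _ _ (fun a => if nat_bits (f a) is b :: _ then b else false)).
  by move=> a; case: (posnP (f a)) => [->|h]; rewrite ?nat_bits0 // nat_bitsS.
by apply: (pf_case (F := fun _ b _ => b) hf); pf.
Qed.

Lemma pf_half f : pf e ebin f -> pf e ebin (fun a => (f a)./2).
Proof.
move=> /pf_bits hf.
suff h : pf e (eseq ebool) (fun a => if nat_bits (f a) is _ :: l then l else [::]).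
  apply: pf_cast h => a; rewrite /ebin /enc_nat /eseq; congr enc_seq.
  by case: (posnP (f a)) => [->|h]; rewrite ?nat_bits0 // (nat_bitsS h).
by apply: (pf_case (F := fun _ _ l => l) hf); pf.
Qed.

Lemma pf_dbl b f : pf e ebool b -> pf e ebin f -> pf e ebin (fun a => b a + (f a).*2).
Proof.
move=> hb /pf_bits hf.
suff h : pf e (eseq ebool) (fun a => if b a then true :: nat_bits (f a) else
    if nat_bits (f a) is x :: l then false :: x :: l else [::]).
  apply: pf_cast h => a; rewrite /ebin /enc_nat /eseq; congr enc_seq.
  case: (b a) => /=; first by rewrite nat_bitsS // oddD odd_double /= uphalf_double.
  rewrite add0n; case: (posnP (f a)) => [->|h]; first by rewrite nat_bits0.
  by rewrite (nat_bitsS h) nat_bitsS ?double_gt0 // odd_double doubleK (nat_bitsS h).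
apply: pf_if => //; first by apply: pf_cons; pf.
apply: (pf_case (F := fun _ x l => [:: false, x & l]) hf); last by pf.
by do !apply: pf_cons; pf.
Qed.

Lemma pf_double f : pf e ebin f -> pf e ebin (fun a => (f a).*2).
Proof. exact: (pf_dbl (b := fun=> false)) (pf_const _ _ _). Qed.

End Gen.

Definition horner n (l : seq bool) := foldl (fun acc (b : bool) => b + acc.*2) n l.

Lemma hornerD n l : horner n l = n * 2 ^ size l + horner 0 l.
Proof.
rewrite /horner; elim: l n => [|b l IH] n /=; first by rewrite muln1 addn0.
by rewrite IH [in RHS]IH expnS; lia.
Qed.

Lemma horner_lt l : horner 0 l < 2 ^ size l.
Proof.
elim/last_ind: l => // l b IH; rewrite /horner foldl_rcons -/(horner 0 l) size_rcons expnS.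
by case: b; lia.
Qed.

Lemma horner_bits n : horner 0 (rev (nat_bits n)) = n.
Proof.
elim/ltn_ind: n => n IH; case: (posnP n) => [->|h]; first by rewrite nat_bits0.
rewrite nat_bitsS // rev_cons /horner foldl_rcons -/(horner _ _) IH.
  exact: odd_double_half.
by lia.
Qed.

Lemma pf_horner T (e : T -> tree) f b : pf e ebin b -> pf e (eseq ebool) f ->
  pf e ebin (fun a => horner (b a) (f a)).
Proof.
move=> hb hf; have sf := pf_size hf; have sb := pbd_bl hb.
apply: (@pf_foldl _ _ _ _ ebool _ f b (fun=> fun acc (b : bool) => b + acc.*2)
  (fun a => 4 * (bl (b a) + tree_size (eseq ebool (f a))) + 1)) => //.
- by rewrite /=; apply: pf_dbl; pf.
- by do !(apply: pbd_add || apply: pbd_mul) => //; exact: pbd_const.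
move=> a l1 l2 E; rewrite -/(horner _ _); apply: leq_trans (size_ebin _) _.
rewrite leq_add2r leq_mul2l /=; apply: (@leq_trans (bl (b a) + size l1)).
  apply: bl_le; rewrite hornerD expnD; have := horner_lt l1; have := bl_lt (b a).
  have : 0 < 2 ^ size l1 by rewrite expn_gt0.
  by move: (2 ^ _) (2 ^ _) => x y; nia.
rewrite leq_add2l; apply: leq_trans (size_le_eseq ebool _).
by rewrite E size_cat leq_addr.
Qed.

(** School addition. The state holds the unread parts of both numbers, the carry and the bits of the
    sum produced so far, the latest first; the new bit is the exclusive or of the two low bits and
    the carry. *)
Definition add_step (z : (nat * nat) * (bool * seq bool)) : (nat * nat) * (bool * seq bool) :=
  ((z.1.1./2, z.1.2./2),
   ((odd z.1.1 && odd z.1.2) || (z.2.1 && (odd z.1.1 || odd z.1.2)),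
    (if odd z.1.1 then odd z.1.2 == z.2.1 else odd z.1.2 != z.2.1) :: z.2.2)).

Lemma add_stepE x y c out n z : iter n add_step ((x, y), (c, out)) = z ->
  horner (z.2.1 + z.1.1 + z.1.2) z.2.2 = horner (c + x + y) out /\
  [/\ z.1.1 = x %/ 2 ^ n, z.1.2 = y %/ 2 ^ n & size z.2.2 = n + size out].
Proof.
elim: n z => [|n IH] z; first by move=> <- /=; rewrite !divn1.
rewrite iterS => <-; have [] := IH _ erefl; move: (iter n _ _) => {}z <- [E1 E2 E3].
split; last by split; rewrite /= ?E3 // ?E1 ?E2 -divn2 -divnMA -expnSr.
rewrite /horner /=; congr foldl.
move: (odd_double_half z.1.1) (odd_double_half z.1.2).
by case: (odd z.1.1); case: (odd z.1.2); case: (z.2.1) => /=; lia.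
Qed.

Lemma pf_add T (e : T -> tree) f g : pf e ebin f -> pf e ebin g ->
  pf e ebin (fun a => f a + g a).
Proof.
move=> hf hg; have sf := pbd_bl hf; have sg := pbd_bl hg.
pose n a := bl (f a) + bl (g a).
pose r a := iter (n a) add_step ((f a, g a), (false, [::])).
apply: (@pf_ext _ _ _ _ (fun a => horner ((r a).2.1 + 0.*2) (r a).2.2)) => [a|].
  have [h [E1 E2 _]] := add_stepE (erefl (r a)); move: h; rewrite E1 E2.
  have -> : f a %/ 2 ^ n a = 0.
    by rewrite divn_small // /n expnD (leq_trans (bl_lt _)) // leq_pmulr ?expn_gt0.
  have -> : g a %/ 2 ^ n a = 0.
    by rewrite divn_small // /n expnD (leq_trans (bl_lt _)) // leq_pmull ?expn_gt0.
  by rewrite !addn0 => ->.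
suff hr : pf e (eprod (eprod ebin ebin) (eprod ebool (eseq ebool))) r.
  move: r hr => r hr.
  by apply: pf_horner; [apply: pf_dbl|]; pf.
apply: (@pf_iter _ _ _ _ (fun=> add_step) n _
  (fun a => 4 * bl (f a) + 4 * bl (g a) + 4 * n a + 20)).
- rewrite /= /add_step; do 2!apply: pf_pair.
  + by apply: pf_half; pf.
  + by apply: pf_half; pf.
  + by do !(apply: pf_or || apply: pf_and); try apply: pf_odd; pf.
  apply: pf_cons; last by pf.
  by apply: pf_if; try (apply: pf_neg); try (apply: pf_eqb); try apply: pf_odd; pf.
- by apply: pf_unD; exact: pf_bl.
- by pf.
- by do !(apply: pbd_add || apply: pbd_mul) => //; exact: pbd_const.
move=> a i hi; have [_ [E1 E2 E3]] := add_stepE (erefl (iter i add_step (f a, g a, (false, [::])))).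
rewrite /eprod /= E1 E2.
have h1 x : tree_size (ebin (x %/ 2 ^ i)) <= 4 * bl x + 1.
  by apply: leq_trans (size_ebin _) _; rewrite leq_add2r leq_mul2l leq_bl // leq_div.
have := h1 (f a); have := h1 (g a).
set z := iter _ _ _ in E3 *.
have : tree_size (eseq ebool z.2.2) <= 4 * size z.2.2 + 1.
  by elim: (z.2.2) => //= b l; have := size_ebool b; rewrite -/(eseq ebool l); lia.
by rewrite E3 /=; have := size_ebool z.2.1; clear -hi; lia.
Qed.

(** Bits are scanned from the least significant one, so the last differing pair overrides all
    earlier ones. *)
Definition leq_step (z : (nat * nat) * bool) : (nat * nat) * bool :=
  ((z.1.1./2, z.1.2./2), if odd z.1.1 == odd z.1.2 then z.2 else odd z.1.2).

Lemma leq_stepE x y n z : iter n leq_step ((x, y), true) = z ->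
  (x <= y) = (if z.1.1 == z.1.2 then z.2 else z.1.1 < z.1.2) /\
  (z.1.1 = x %/ 2 ^ n /\ z.1.2 = y %/ 2 ^ n).
Proof.
elim: n z => [|n IH] z; first by move=> <- /=; rewrite !divn1 leq_eqVlt; case: eqP.
rewrite iterS => <-; have [] := IH _ erefl; move: (iter n _ _) => {}z -> [E1 E2].
split; last by split; rewrite /= ?E1 ?E2 -divn2 -divnMA -expnSr.
rewrite /=; move: (odd_double_half z.1.1) (odd_double_half z.1.2).
by case: (odd z.1.1); case: (odd z.1.2); case: (z.2) => /=; do 2!case: eqP; lia.
Qed.

Lemma pf_leq T (e : T -> tree) f g : pf e ebin f -> pf e ebin g ->
  pf e ebool (fun a => f a <= g a).
Proof.
move=> hf hg; have sf := pbd_bl hf; have sg := pbd_bl hg.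
pose n a := bl (f a) + bl (g a).
pose r a := iter (n a) leq_step ((f a, g a), true).
apply: (@pf_ext _ _ _ _ (fun a => (r a).2)) => [a|].
  have [-> [-> ->]] := leq_stepE (erefl (r a)).
  have -> : f a %/ 2 ^ n a = 0.
    by rewrite divn_small // /n expnD (leq_trans (bl_lt _)) // leq_pmulr ?expn_gt0.
  have -> : g a %/ 2 ^ n a = 0.
    by rewrite divn_small // /n expnD (leq_trans (bl_lt _)) // leq_pmull ?expn_gt0.
  by [].
apply: (@pf_snd _ _ _ _ (eprod ebin ebin)).
apply: (@pf_iter _ _ _ _ (fun=> leq_step) n _
  (fun a => 4 * bl (f a) + 4 * bl (g a) + 20)).
- rewrite /= /leq_step; do 2?apply: pf_pair.
  + by apply: pf_half; pf.
  + by apply: pf_half; pf.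
  by apply: pf_if; try (apply: pf_eqb); try apply: pf_odd; pf.
- by apply: pf_unD; exact: pf_bl.
- by pf.
- by do !(apply: pbd_add || apply: pbd_mul) => //; exact: pbd_const.
move=> a i hi; have [_ [E1 E2]] := leq_stepE (erefl (iter i leq_step (f a, g a, true))).
rewrite /eprod /= E1 E2.
have h1 x : tree_size (ebin (x %/ 2 ^ i)) <= 4 * bl x + 1.
  by apply: leq_trans (size_ebin _) _; rewrite leq_add2r leq_mul2l leq_bl // leq_div.
have := h1 (f a); have := h1 (g a).
set z := iter _ _ _.
by have := size_ebool z.2; clear -hi; lia.
Qed.

Lemma pf_eqn T (e : T -> tree) f g : pf e ebin f -> pf e ebin g ->
  pf e ebool (fun a => f a == g a).
Proof.
move=> hf hg; apply: (@pf_ext _ _ _ _ (fun a => (f a <= g a) && (g a <= f a))).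
  by move=> a; rewrite eqn_leq.
by apply: pf_and; apply: pf_leq.
Qed.

Lemma pf_mul T (e : T -> tree) f g : pf e ebin f -> pf e ebin g ->
  pf e ebin (fun a => f a * g a).
Proof.
move=> hf hg; have sf := pbd_bl hf; have sg := pbd_bl hg.
pose F (a : T) acc (b : bool) := (if b then f a else 0) + acc.*2.
have E a l : foldl (F a) 0 l = f a * horner 0 l.
  elim/last_ind: l => [|l b IH]; first by rewrite muln0.
  by rewrite /horner !foldl_rcons -/(horner 0 l) IH /F; case: b; lia.
apply: (@pf_ext _ _ _ _ (fun a => foldl (F a) 0 (rev (nat_bits (g a))))) => [a|].
  by rewrite E horner_bits.
apply: (@pf_foldl _ _ _ _ ebool _ _ (fun=> 0) F
  (fun a => 4 * (bl (f a) + bl (g a)) + 1)).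
- rewrite /F /=; apply: pf_add; last by apply: pf_double; pf.
  by apply: pf_if; pf; apply: (pf_comp hf); pf.
- by apply: pf_rev; exact: pf_bits.
- by pf.
- by do !(apply: pbd_add || apply: pbd_mul) => //; exact: pbd_const.
move=> a l1 l2 El; rewrite E; apply: leq_trans (size_ebin _) _.
rewrite leq_add2r leq_mul2l /=; apply: bl_le; rewrite expnD.
have h2 : horner 0 l1 < 2 ^ bl (g a).
  apply: leq_trans (horner_lt l1) _; rewrite leq_exp2l //.
  by rewrite /bl -(size_rev (nat_bits _)) El size_cat leq_addr.
have h1 := bl_lt (f a).
by apply: (@leq_ltn_trans (f a * 2 ^ bl (g a))); rewrite ?ltn_mul2r ?leq_mul2l ?(ltnW h2) ?orbT // h1 expn_gt0.
Qed.

Section Big.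
Variables (T X : Type) (e : T -> tree) (eX : X -> tree).

(** The product of successors dominates sums, products and maxima alike and has polynomially many
    bits; this single size bound lets [pf_bigop] serve all three. *)
Lemma prod_lt (A : Type) (F : A -> nat) l :
  \prod_(x <- l) (F x).+1 <= 2 ^ tree_size (eseq ebin (map F l)).
Proof.
elim: l => [|x l IH]; first by rewrite big_nil.
rewrite big_cons /= -/(eseq ebin (map F l)) -addSn expnD leq_mul //.
apply: leq_trans (bl_lt _) _; rewrite leq_exp2l //.
by apply: leq_trans (bl_size _) _.
Qed.

Lemma sum_le_prod (A : Type) (F : A -> nat) l :
  \sum_(x <- l) F x < \prod_(x <- l) (F x).+1.
Proof.
elim: l => [|x l IH]; first by rewrite !big_nil.
rewrite !big_cons; move: IH; set s := \sum_(_ <- _) _; set p := \prod_(_ <- _) _.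
by nia.
Qed.

Lemma pf_bigop (op : nat -> nat -> nat) idx f :
  associative op -> left_id idx op -> right_id idx op ->
  (forall U (eU : U -> tree) f g, pf eU ebin f -> pf eU ebin g -> pf eU ebin (fun a => op (f a) (g a))) ->
  (forall l : seq nat, \big[op/idx]_(x <- l) x <= \prod_(x <- l) x.+1) ->
  pf e (eseq ebin) f -> pf e ebin (fun a => \big[op/idx]_(x <- f a) x).
Proof.
move=> opA op0x opx0 hop hb hf; have sf := pf_size hf.
have E' l i : foldl op i l = op i (\big[op/idx]_(x <- l) x).
  by elim: l i => [|x l IH] i /=; rewrite ?big_nil ?opx0 // IH big_cons opA.
have E l : foldl op idx l = \big[op/idx]_(x <- l) x by rewrite E' op0x.
apply: (@pf_ext _ _ _ _ (fun a => foldl op idx (f a))) => [a|]; first by rewrite E.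
apply: (@pf_foldl _ _ _ _ ebin _ f (fun=> idx) (fun=> op)
   (fun a => 4 * (tree_size (eseq ebin (f a))).+1 + 1)) => //.
- by apply: hop; pf.
- by pf.
- by do !(apply: pbd_add || apply: pbd_mul || apply: pbd_succ) => //; exact: pbd_const.
move=> a l1 l2 El; rewrite E; apply: leq_trans (size_ebin _) _.
rewrite leq_add2r leq_mul2l /=; apply: bl_le; apply: leq_ltn_trans (hb l1) _.
have := prod_lt id l1; rewrite map_id => h; apply: leq_ltn_trans h _.
by rewrite ltn_exp2l // El !size_eseq big_cat /=; lia.
Qed.

End Big.

Lemma pf_sum T (e : T -> tree) X (eX : X -> tree) (F : T -> X -> nat) f :
  pf (eprod e eX) ebin (fun z => F z.1 z.2) -> pf e (eseq eX) f ->
  pf e ebin (fun a => \sum_(x <- f a) F a x).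
Proof.
move=> hF hf.
apply: (@pf_ext _ _ _ _ (fun a => \big[addn/0]_(x <- [seq F a x | x <- f a]) x)) => [a|].
  by rewrite big_map.
apply: pf_bigop (pf_map hF hf) => //; [exact: addnA|exact: addn0|exact: pf_add|].
by move=> l; apply: ltnW; exact: sum_le_prod.
Qed.

Lemma pf_prod T (e : T -> tree) X (eX : X -> tree) (F : T -> X -> nat) f :
  pf (eprod e eX) ebin (fun z => F z.1 z.2) -> pf e (eseq eX) f ->
  pf e ebin (fun a => \prod_(x <- f a) F a x).
Proof.
move=> hF hf.
apply: (@pf_ext _ _ _ _ (fun a => \big[muln/1]_(x <- [seq F a x | x <- f a]) x)) => [a|].
  by rewrite big_map.
apply: pf_bigop (pf_map hF hf); [exact: mulnA|exact: mul1n|exact: muln1|exact: pf_mul|].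
move=> l; elim: l => [|x l IH]; first by rewrite !big_nil.
by rewrite !big_cons leq_mul.
Qed.

Lemma pf_maxn T (e : T -> tree) f g : pf e ebin f -> pf e ebin g ->
  pf e ebin (fun a => maxn (f a) (g a)).
Proof.
move=> hf hg; apply: (@pf_ext _ _ _ _ (fun a => if f a <= g a then g a else f a)).
  by move=> a; case: leqP; lia.
by apply: pf_if => //; exact: pf_leq.
Qed.

Lemma pf_bigmax T (e : T -> tree) X (eX : X -> tree) (F : T -> X -> nat) f :
  pf (eprod e eX) ebin (fun z => F z.1 z.2) -> pf e (eseq eX) f ->
  pf e ebin (fun a => \max_(x <- f a) F a x).
Proof.
move=> hF hf.
apply: (@pf_ext _ _ _ _ (fun a => \big[maxn/0]_(x <- [seq F a x | x <- f a]) x)) => [a|].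
  by rewrite big_map.
apply: pf_bigop (pf_map hF hf); [exact: maxnA|exact: max0n|exact: maxn0|exact: pf_maxn|].
move=> l; elim: l => [|x l IH]; first by rewrite !big_nil.
rewrite !big_cons geq_max; move: IH; set p := \prod_(_ <- _) _; set q := \big[maxn/0]_(_ <- _) _ => IH.
have : 0 < p by rewrite prodn_gt0.
by nia.
Qed.

End Binary.

(** * Powers of two, subtraction, division and greatest common divisors *)

Section Arith.
Local Open Scope nat_scope.

Lemma pf_exp2 T (e : T -> tree) f : pf e eun f -> pf e ebin (fun a => 2 ^ f a).
Proof.
move=> hf; have sf := pf_size hf.
have E n : iter n double 1 = 2 ^ n by elim: n => //= n ->; rewrite expnS mul2n.
apply: (@pf_ext _ _ _ _ (fun a => iter (f a) double 1)) => [a|].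
  by rewrite E.
apply: (@pf_iter _ _ _ _ (fun=> double) f (fun=> 1)
  (fun a => 4 * (tree_size (eun (f a))).+1 + 1)) => //.
- by apply: pf_double; pf.
- by pf.
- by do !(apply: pbd_add || apply: pbd_mul || apply: pbd_succ) => //; exact: pbd_const.
move=> a i hi; rewrite E; apply: leq_trans (size_ebin _) _.
rewrite leq_add2r leq_mul2l /=; apply: bl_le; rewrite ltn_exp2l // size_eun.
by lia.
Qed.

Lemma pf_un T (e : T -> tree) f : pf e eun f -> pf e ebin f.
Proof.
move=> hf; have sf := pf_size hf.
have E n : iter n (addn 1) 0 = n by elim: n => //= n ->.
apply: (@pf_ext _ _ _ _ (fun a => iter (f a) (addn 1) 0)) => [a|]; first by rewrite E.
apply: (@pf_iter _ _ _ _ (fun=> addn 1) f (fun=> 0)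
  (fun a => 4 * tree_size (eun (f a)) + 1)) => //.
- by apply: pf_add; pf.
- by pf.
- by do !(apply: pbd_add || apply: pbd_mul || apply: pbd_succ) => //; exact: pbd_const.
move=> a i hi; rewrite E; apply: leq_trans (size_ebin _) _.
rewrite leq_add2r leq_mul2l /=; apply: bl_le; rewrite size_eun.
by apply: leq_ltn_trans (ltn_expl _ (isT : 1 < 2)); lia.
Qed.

Lemma pf_iota T (e : T -> tree) f : pf e eun f -> pf e (eseq eun) (fun a => iota 0 (f a)).
Proof.
move=> hf; have sf := pf_size hf.
have E n : iter n (fun l : seq nat => size l :: l) [::] = rev (iota 0 n).
  elim: n => [//|n IH]; rewrite iterS IH size_rev size_iota -addn1 iotaD rev_cat /=.
  by rewrite add0n.
apply: (@pf_ext _ _ _ _ (fun a => rev (iter (f a) (fun l : seq nat => size l :: l) [::]))) => [a|].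
  by rewrite E revK.
apply: pf_rev.
apply: (@pf_iter _ _ _ _ (fun=> fun l : seq nat => size l :: l) f (fun=> [::])
  (fun a => (tree_size (eun (f a)) * (tree_size (eun (f a))).+1).+1)) => //.
- by rewrite /=; apply: pf_cons; [apply: pf_size_un|]; pf.
- by pf.
- by do !(apply: pbd_add || apply: pbd_mul || apply: pbd_succ) => //; exact: pbd_const.
move=> a i hi; rewrite E size_eseq ltnS big_rev.
apply: leq_trans (sum_bound (c := (tree_size (eun (f a))).+1) _) _.
  move=> l1 x l2 E1; have : x \in iota 0 i by rewrite E1 mem_cat mem_head orbT.
  by rewrite mem_iota !size_eun; lia.
by rewrite size_iota leq_mul2r size_eun; lia.
Qed.

Lemma pf_nth T (e : T -> tree) X (eX : X -> tree) (d : X) l f :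
  pf e (eseq eX) l -> pf e eun f -> pf e eX (fun a => nth d (l a) (f a)).
Proof.
move=> hl hf; have sl := pf_size hl.
have E n (s : seq X) : iter n behead s = drop n s.
  by elim: n s => [|n IH] s /=; [rewrite drop0|rewrite IH -drop1 drop_drop].
apply: (@pf_ext _ _ _ _ (fun a => if iter (f a) behead (l a) is x :: _ then x else d)).
  move=> a; rewrite E -[f a in LHS]addn0 -nth_drop.
  by case: (drop _ _).
apply: (@pf_case _ _ _ _ eX _ _ (fun _ x _ => x) (fun=> d)); [|by pf..].
apply: (@pf_iter _ _ _ (eseq eX) (fun=> behead) f l (fun a => tree_size (eseq eX (l a)))) => //=.
  apply: (@pf_ext _ _ _ _ (fun z => if z.2 is _ :: s then s else [::])).
    by case=> ? [].
  by apply: (@pf_case _ _ _ _ eX _ snd (fun _ _ l => l)); pf.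
move=> a i _; rewrite E -{2}[l a](cat_take_drop i) !size_eseq big_cat /=; lia.
Qed.

Definition pows n := [seq 2 ^ i | i <- rev (iota 0 n)].

Lemma powsS n : pows n.+1 = 2 ^ n :: pows n.
Proof. by rewrite /pows -(addn1 n) iotaD rev_cat. Qed.

(** Binary search, one bit at a time: with decreasing powers of two and a downward closed test, the
    result is the largest number in range that passes. *)
Definition greedy (t : nat -> bool) := foldl (fun q w => if t (q + w) then q + w else q).

Lemma greedyP (t : nat -> bool) q0 n : (forall m k, m <= k -> t k -> t m) -> t q0 ->
  let q := greedy t q0 (pows n) in
  [/\ t q, q0 <= q < q0 + 2 ^ n & forall r, t r -> r < q0 + 2 ^ n -> r <= q].
Proof.
move=> tm; elim: n q0 => [|n IH] q0 t0.
  by rewrite /greedy /= expn0 addn1 leqnn ltnSn; split.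
rewrite powsS /greedy /= -/(greedy t _ _) expnS.
case E : (t (q0 + 2 ^ n)).
  have [h1 h2 h3] := IH _ E; split=> //; first by lia.
  by move=> r tr hr; apply: h3 => //; lia.
have [h1 h2 h3] := IH _ t0; split=> //; first by lia.
move=> r tr hr; apply: h3 => //; rewrite ltnNge; apply/negP => h.
by move: E; rewrite (tm _ _ h tr).
Qed.

Lemma pf_greedy T (e : T -> tree) (t : T -> nat -> bool) n :
  pf (eprod e ebin) ebool (fun z => t z.1 z.2) -> pf e eun n ->
  pf e ebin (fun a => greedy (t a) 0 (pows (n a))).
Proof.
move=> ht hn; have sn := pf_size hn.
apply: (@pf_foldl _ _ _ _ ebin _ _ (fun=> 0)
   (fun a q w => if t a (q + w) then q + w else q)
   (fun a => 4 * tree_size (eun (n a)) + 1)) => //.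
- have hq : pf (eprod e (eprod ebin ebin)) ebin (fun z => z.2.1 + z.2.2) by apply: pf_add; pf.
  by apply: pf_if; [apply: (pf2 (F := t) ht)|..]; pf.
- apply: pf_map; first by apply: pf_exp2; pf.
  by apply: pf_rev; apply: pf_iota.
- by pf.
- by do !(apply: pbd_add || apply: pbd_mul) => //; exact: pbd_const.
move=> a l1 l2 E; rewrite -/(greedy _ _ _); apply: leq_trans (size_ebin _) _.
rewrite leq_add2r leq_mul2l /=; apply: bl_le.
have h q l : greedy (t a) q l <= q + \sum_(w <- l) w.
  elim: l q => [|w l IH] q; first by rewrite big_nil addn0.
  rewrite /greedy /= -/(greedy (t a) _ _) big_cons.
  by case: ifP => _; have := IH q; have := IH (q + w); lia.
apply: leq_ltn_trans (h _ _) _.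
have : \sum_(w <- pows (n a)) w < 2 ^ n a.
  elim: (n a) => [|m IH]; first by rewrite big_nil.
  by rewrite powsS big_cons expnS; lia.
rewrite E big_cat /= => h1; apply: (@leq_trans (2 ^ n a)); first by lia.
by rewrite leq_exp2l // size_eun; lia.
Qed.

Lemma pf_sub T (e : T -> tree) f g : pf e ebin f -> pf e ebin g -> pf e ebin (fun a => f a - g a).
Proof.
move=> hf hg.
apply: (@pf_ext _ _ _ _ (fun a => if g a <= f a then
    greedy (fun q => g a + q <= f a) 0 (pows (bl (f a))) else 0)) => [a|].
  case: leqP => h; last by apply/eqP; rewrite subn_eq0 ltnW.
  have [||h1 h2 h3] := @greedyP (fun q => g a + q <= f a) 0 (bl (f a)).
  - by move=> m k; lia.
  - by rewrite addn0.
  by have := h3 (f a - g a); have := bl_lt (f a); move: h1 h2 h3; cbv zeta; lia.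
apply: pf_if; [exact: pf_leq| |by pf].
apply: (@pf_greedy _ _ (fun a q => g a + q <= f a)); last exact: pf_bl.
by apply: pf_leq; [apply: pf_add; [apply: (pf_comp hg)|]|apply: (pf_comp hf)]; pf.
Qed.

Lemma pf_div T (e : T -> tree) f g : pf e ebin f -> pf e ebin g -> pf e ebin (fun a => f a %/ g a).
Proof.
move=> hf hg.
apply: (@pf_ext _ _ _ _ (fun a => if 1 <= g a then
    greedy (fun q => q * g a <= f a) 0 (pows (bl (f a))) else 0)) => [a|].
  case: (posnP (g a)) => [->|h] /=; first by rewrite divn0.
  have [||h1 h2 h3] := @greedyP (fun q => q * g a <= f a) 0 (bl (f a)).
  - by move=> m k mk; apply: leq_trans; rewrite leq_mul2r mk orbT.
  - by rewrite mul0n.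
  apply/eqP; rewrite eqn_leq; apply/andP; split; last by rewrite leq_divRL.
  by apply: h3; [exact: leq_divM|apply: leq_ltn_trans (leq_div _ _) (bl_lt _)].
apply: pf_if; [by apply: pf_leq; pf| |by pf].
apply: (@pf_greedy _ _ (fun a q => q * g a <= f a)); last exact: pf_bl.
by apply: pf_leq; [apply: pf_mul; [|apply: (pf_comp hg)]|apply: (pf_comp hf)]; pf.
Qed.

Lemma pf_mod T (e : T -> tree) f g : pf e ebin f -> pf e ebin g ->
  pf e ebin (fun a => f a %% g a).
Proof.
move=> hf hg; apply: (@pf_ext _ _ _ _ (fun a => f a - f a %/ g a * g a)) => [a|].
  by rewrite {2}(divn_eq (f a) (g a)) addKn.
by apply: pf_sub => //; apply: pf_mul => //; exact: pf_div.
Qed.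

Definition euclid_step (z : nat * nat) := if 1 <= z.2 then (z.2, z.1 %% z.2) else z.

Lemma iter_euclid n z : let z' := iter n euclid_step z in
  gcdn z'.1 z'.2 = gcdn z.1 z.2 /\ (z'.1 <= maxn z.1 z.2 /\ z'.2 <= maxn z.1 z.2).
Proof.
elim: n => [|n]; first by rewrite /=; lia.
rewrite iterS; move: (iter n _ _) => [x y] /= [E1 [E2 E3]].
rewrite /euclid_step /=; case: posnP => [y0|y0] //=.
rewrite gcdn_modr gcdnC E1; split=> //; split=> //.
by apply: leq_trans (ltnW (ltn_pmod _ y0)) E3.
Qed.

(** Two rounds replace [y] by [y %% (x %% y)], which is less than half of [y]. *)
Lemma iter_euclid0 n x y : y < 2 ^ n -> (iter (n.*2) euclid_step (x, y)).2 = 0.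
Proof.
elim: n x y => [|n IH] x y; first by rewrite expn0; case: y.
rewrite doubleS !iterSr.
have h0 m u : iter m euclid_step (u, 0) = (u, 0) by elim: m => //= m ->.
case: (posnP y) => [->|y0]; first by rewrite /euclid_step /= h0.
have -> : euclid_step (x, y) = (y, x %% y) by rewrite /euclid_step /= y0.
case: (posnP (x %% y)) => [->|r0]; first by rewrite /euclid_step /= h0.
have -> : euclid_step (y, x %% y) = (x %% y, y %% (x %% y)) by rewrite /euclid_step /= r0.
move=> hy; apply: IH.
have := ltn_pmod x y0; set r := x %% y in r0 *.
have := divn_eq y r; have := ltn_pmod y r0; rewrite expnS in hy.
by case: (y %/ r) => [|q]; nia.
Qed.

Lemma pf_gcd T (e : T -> tree) f g : pf e ebin f -> pf e ebin g ->
  pf e ebin (fun a => gcdn (f a) (g a)).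
Proof.
move=> hf hg; have sf := pbd_bl hf; have sg := pbd_bl hg.
pose r a := iter ((bl (g a)).*2) euclid_step (f a, g a).
apply: (@pf_ext _ _ _ _ (fun a => (r a).1)) => [a|].
  have [<- _] := iter_euclid ((bl (g a)).*2) (f a, g a).
  by rewrite -/(r a) [(r a).2]iter_euclid0 ?gcdn0 ?bl_lt.
apply: (@pf_fst _ _ _ _ _ ebin).
apply: (@pf_iter _ _ _ _ (fun=> euclid_step) (fun a => (bl (g a)).*2) (fun a => (f a, g a))
  (fun a => 8 * (bl (f a) + bl (g a)) + 3)) => //.
- by rewrite /=; apply: pf_if; [apply: pf_leq|apply: pf_pair; last apply: pf_mod|]; pf.
- apply: (@pf_ext _ _ _ _ (fun a => bl (g a) + bl (g a))); first by move=> a; rewrite addnn.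
  by apply: pf_unD; apply: pf_bl.
- by pf.
- by do !(apply: pbd_add || apply: pbd_mul) => //; exact: pbd_const.
move=> a i _; have [_ [h1 h2]] := iter_euclid i (f a, g a); move: h1 h2.
move: (iter _ _ _) => [x y] /=; rewrite /eprod /= => h1 h2.
have h u : u <= maxn (f a) (g a) -> tree_size (ebin u) <= 4 * (bl (f a) + bl (g a)) + 1.
  move=> hu; apply: leq_trans (size_ebin _) _; rewrite leq_add2r leq_mul2l /=.
  apply: leq_trans (leq_bl hu) _.
  by rewrite /maxn; case: ifP => _; lia.
by have := h x h1; have := h y h2; lia.
Qed.

End Arith.

(** * Multiplicative weights for mixed packing and covering *)

(** The weights are products of the factors [1 + P/(K D)] and [1 - C/(K D)] with
    denominators cleared; covering rows that have enough load are dropped. *)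
Module MW.

Section MWDef.
Local Open Scope nat_scope.
Variables (TI TJ : Type) (TV : eqType) (rI : seq TI) (rJ : seq TJ) (cols : seq TV).
Variables (P : TI -> TV -> nat) (C : TJ -> TV -> nat) (K D U : nat).

Definition load (A : Type) (F : A -> TV -> nat) (h : seq TV) (i : A) := \sum_(v <- h) F i v.
Definition wP h i := \prod_(v <- h) (K * D + P i v).
Definition wC h i := \prod_(v <- h) (K * D - C i v).
Definition act h := [seq i <- rJ | load C h i < U * D].
Definition sP h := \sum_(i <- rI) wP h i.
Definition sC h := \sum_(i <- act h) wC h i.
Definition gP h v := \sum_(i <- rI) wP h i * P i v.
Definition gC h v := \sum_(i <- act h) wC h i * C i v.
(** The ratio of weighted packing to weighted covering gain of the column is at most the ratio of
    the total weights, with denominators cleared. *)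
Definition good h v := (0 < gC h v) && (gP h v * sC h <= gC h v * sP h).
Definition mw_step h := if [seq v <- cols | good h v] is v :: _ then v :: h else h.
Definition mw n := iter n mw_step [::].

Lemma mw_stepP h :
  (mw_step h = h /\ {in cols, forall v, ~~ good h v}) \/
  (exists v, [/\ v \in cols, good h v & mw_step h = v :: h]).
Proof.
rewrite /mw_step; case E : [seq v <- cols | good h v] => [|v l].
  left; split=> // v hv; apply/negP => gv.
  by have : v \in [seq v <- cols | good h v]; [rewrite mem_filter gv|rewrite E].
right; exists v; have : v \in [seq v <- cols | good h v] by rewrite E mem_head.
by rewrite mem_filter => /andP[].
Qed.

Lemma mw_sub n : {subset mw n <= cols}.
Proof.
elim: n => // n IH v; rewrite /mw iterS -/(mw n).
case: (mw_stepP (mw n)) => [[-> _]|[w [hw _ ->]]]; first exact: IH.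
by rewrite inE => /orP[/eqP->|/IH].
Qed.

Lemma mw_size n : size (mw n) <= n.
Proof.
elim: n => // n IH; rewrite /mw iterS -/(mw n).
by case: (mw_stepP (mw n)) => [[-> _]|[w [hw _ ->]]] /=; lia.
Qed.

End MWDef.

Section MWPoly.
Local Open Scope nat_scope.
Variables (T : Type) (e : T -> tree) (TI TJ : Type) (TV : eqType).
Variables (eI : TI -> tree) (eJ : TJ -> tree) (eV : TV -> tree).
Variables (rI : T -> seq TI) (rJ : T -> seq TJ) (cols : T -> seq TV).
Variables (P : T -> TI -> TV -> nat) (C : T -> TJ -> TV -> nat) (K : nat) (D U n : T -> nat).
Hypotheses (hI : pf e (eseq eI) rI) (hJ : pf e (eseq eJ) rJ) (hV : pf e (eseq eV) cols).
Hypothesis hP : pf (eprod e (eprod eI eV)) ebin (fun z => P z.1 z.2.1 z.2.2).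
Hypothesis hC : pf (eprod e (eprod eJ eV)) ebin (fun z => C z.1 z.2.1 z.2.2).
Hypotheses (hD : pf e ebin D) (hU : pf e ebin U) (hn : pf e eun n).

Lemma pf_load A (eA : A -> tree) (F : T -> A -> TV -> nat) U' (eU : U' -> tree) a h i :
  pf (eprod e (eprod eA eV)) ebin (fun z => F z.1 z.2.1 z.2.2) ->
  pf eU e a -> pf eU (eseq eV) h -> pf eU eA i ->
  pf eU ebin (fun u => load (F (a u)) (h u) (i u)).
Proof.
move=> hF ha hh hi; apply: pf_sum (hh); apply: (pf3 (F := F) hF); pf.
- exact: (pf_comp ha (pf_fst0 _ _)).
- exact: (pf_comp hi (pf_fst0 _ _)).
Qed.

Section Local.
Variables (U' : Type) (eU : U' -> tree) (a : U' -> T) (h : U' -> seq TV).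
Hypotheses (ha : pf eU e a) (hh : pf eU (eseq eV) h).

Lemma pf_lift A (eA : A -> tree) B (eB : B -> tree) (f : T -> B) :
  pf e eB f -> pf (eprod eU eA) eB (fun z => f (a z.1)).
Proof. by move=> hf; exact: (pf_comp hf (pf_comp ha (pf_fst0 _ _))). Qed.

Lemma pf_wP i : pf eU eI i -> pf eU ebin (fun u => wP (P (a u)) K (D (a u)) (h u) (i u)).
Proof.
move=> hi; apply: pf_prod (hh); apply: pf_add.
  by apply: pf_mul; [pf|exact: pf_lift].
apply: (pf3 (F := P) hP); pf.
- exact: (pf_comp ha (pf_fst0 _ _)).
- exact: (pf_comp hi (pf_fst0 _ _)).
Qed.

Lemma pf_wC i : pf eU eJ i -> pf eU ebin (fun u => wC (C (a u)) K (D (a u)) (h u) (i u)).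
Proof.
move=> hi; apply: pf_prod (hh); apply: pf_sub.
  by apply: pf_mul; [pf|exact: pf_lift].
apply: (pf3 (F := C) hC); pf.
- exact: (pf_comp ha (pf_fst0 _ _)).
- exact: (pf_comp hi (pf_fst0 _ _)).
Qed.

Lemma pf_act : pf eU (eseq eJ) (fun u => act (rJ (a u)) (C (a u)) (D (a u)) (U (a u)) (h u)).
Proof.
apply: pf_filter; last exact: (pf_comp hJ ha).
apply: pf_leq; last by apply: pf_mul; exact: pf_lift.
apply: (@pf_add _ _ (fun=> 1)); first by pf.
apply: pf_load hC _ _ _; pf.
- exact: (pf_comp ha (pf_fst0 _ _)).
- exact: (pf_comp hh (pf_fst0 _ _)).
Qed.

End Local.

Section Local2.
Variables (U' : Type) (eU : U' -> tree) (a : U' -> T) (h : U' -> seq TV) (v : U' -> TV).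
Hypotheses (ha : pf eU e a) (hh : pf eU (eseq eV) h) (hv : pf eU eV v).

Lemma pf_good : pf eU ebool (fun u =>
  good (rI (a u)) (rJ (a u)) (P (a u)) (C (a u)) K (D (a u)) (U (a u)) (h u) (v u)).
Proof.
have ha' X (eX : X -> tree) : pf (eprod eU eX) e (fun u => a u.1) := pf_comp ha (pf_fst0 _ _).
have hh' X (eX : X -> tree) : pf (eprod eU eX) (eseq eV) (fun u => h u.1) := pf_comp hh (pf_fst0 _ _).
have hv' X (eX : X -> tree) : pf (eprod eU eX) eV (fun u => v u.1) := pf_comp hv (pf_fst0 _ _).
have hI' := pf_comp hI ha.
have hgC : pf eU ebin (fun u => gC (rJ (a u)) (C (a u)) K (D (a u)) (U (a u)) (h u) (v u)).
  apply: (pf_sum _ (pf_act ha hh)); apply: pf_mul; first by apply: pf_wC; pf.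
  by apply: (pf3 (F := C) hC); pf.
apply: pf_and; first by apply: pf_leq; pf.
apply: pf_leq; apply: pf_mul => //.
- apply: (pf_sum _ hI'); apply: pf_mul; first by apply: pf_wP; pf.
  by apply: (pf3 (F := P) hP); pf.
- by apply: (pf_sum _ (pf_act ha hh)); apply: pf_wC; pf.
- by apply: (pf_sum _ hI'); apply: pf_wP; pf.
Qed.

End Local2.

(** The state of the loop is only the list of chosen columns. The weights, whose bit length grows
    with that list, are recomputed from it in every step. *)
Lemma pf_mw : pf e (eseq eV) (fun t =>
  mw (rI t) (rJ t) (cols t) (P t) (C t) K (D t) (U t) (n t)).
Proof.
have sn := pf_size hn; have sV := pf_size hV.
apply: (@pf_iter _ _ _ _ (fun t => mw_step (rI t) (rJ t) (cols t) (P t) (C t) K (D t) (U t))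
  n (fun=> [::]) (fun t => (tree_size (eun (n t)) * tree_size (eseq eV (cols t))).+1)) => //.
- apply: (@pf_case _ _ _ _ eV _ _ (fun z v _ => v :: z.2) (fun z => z.2)); last by pf.
    apply: pf_filter; last exact: (pf_comp hV (pf_fst0 _ _)).
    by apply: (@pf_good _ _ (fun z => z.1.1) (fun z => z.1.2) (fun z => z.2)); pf.
  by apply: pf_cons; pf.
- by pf.
- by apply: pbd_succ; apply: pbd_mul.
move=> t i hi; rewrite -/(mw _ _ _ _ _ _ _ _ i) size_eseq ltnS.
set h := mw _ _ _ _ _ _ _ _ _.
apply: leq_trans (sum_bound (c := tree_size (eseq eV (cols t))) _) _.
  move=> l1 x l2 E; have : x \in cols t by apply: (@mw_sub _ _ _ (rI t) (rJ t) _ (P t) (C t) K (D t) (U t) i); rewrite -/h E mem_cat mem_head orbT.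
  by case/splitPr => p1 p2; exact: mem_size_eseq.
rewrite leq_mul2r size_eun; have := mw_size (rI t) (rJ t) (cols t) (P t) (C t) K (D t) (U t) i.
by rewrite -/h; lia.
Qed.

End MWPoly.
End MW.
Import MW.

(** * Correctness of the multiplicative weights method *)

Section MWCorrect.
Local Open Scope nat_scope.
Variables (R : realType) (TI TJ TV : eqType) (rI : seq TI) (rJ : seq TJ) (cols : seq TV).
Variables (P : TI -> TV -> nat) (C : TJ -> TV -> nat) (K D : nat).
Let U := K * K * (size rI + size rJ).
Hypothesis hK : 4 <= K.
Hypothesis hD : 0 < D.
Hypothesis hP : forall i v, i \in rI -> v \in cols -> P i v <= D.
Hypothesis hC : forall i v, i \in rJ -> v \in cols -> C i v <= D.

Notation load := (@load TV _).
Notation wP := (wP P K D).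
Notation wC := (wC C K D).
Notation act := (act rJ C D U).
Notation sP := (sP rI P K D).
Notation sC := (sC rJ C K D U).
Notation gP := (gP rI P K D).
Notation gC := (gC rJ C K D U).
Notation good := (good rI rJ P C K D U).
Notation mw := (mw rI rJ cols P C K D U).

Let S := K * D.

Lemma leq_sum_seq_in (A : eqType) (l : seq A) (F G : A -> nat) :
  (forall x, x \in l -> F x <= G x) -> \sum_(x <- l) F x <= \sum_(x <- l) G x.
Proof. by move=> h; rewrite big_seq [leqRHS]big_seq; apply: leq_sum. Qed.

Lemma act_sub h i : i \in act h -> i \in rJ.
Proof. by rewrite mem_filter => /andP[]. Qed.

(** Only an inequality, because rows that reach their target leave the sum. *)
Lemma sC_cons h v : v \in cols -> sC (v :: h) <= S * sC h - gC h v.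
Proof.
move=> hv; rewrite /MW.sC /MW.gC.
apply: (@leq_trans (\sum_(i <- act h) wC (v :: h) i)).
  rewrite [leqRHS]big_filter [leqLHS]big_filter [leqRHS]big_mkcond [leqLHS]big_mkcond /=.
  apply: leq_sum => i _; case: ifP => // h1; case: ifP => // /negP[]; apply: leq_ltn_trans h1.
  by rewrite /MW.load big_cons leq_addl.
have -> : S * (\sum_(i <- act h) wC h i) - \sum_(i <- act h) wC h i * C i v =
    \sum_(i <- act h) wC (v :: h) i; last by [].
apply/eqP; rewrite eq_sym -(eqn_add2r (\sum_(i <- act h) wC h i * C i v)) subnK; last first.
  rewrite big_distrr /=; apply: leq_sum_seq_in => i /act_sub hi.
  rewrite mulnC leq_mul2r; apply/orP; right; apply: leq_trans (hC hi hv) _.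
  by rewrite leq_pmull; lia.
rewrite -big_split big_distrr /=; apply/eqP; apply: eq_big_seq => i /act_sub hi.
rewrite /MW.wC big_cons -/S mulnC -mulnDr subnK 1?mulnC //.
by apply: leq_trans (hC hi hv) _; rewrite leq_pmull; lia.
Qed.

Lemma sP_cons h v : sP (v :: h) = S * sP h + gP h v.
Proof.
rewrite /MW.sP /MW.gP big_distrr -big_split /=; apply: eq_bigr => i _.
by rewrite /MW.wP big_cons mulnDl [P i v * _]mulnC.
Qed.

(** Adding a good column does not increase [sP h * sC h / S ^ (2 * size h)]. *)
Definition inv h := sP h * sC h <= size rI * size rJ * S ^ (2 * size h).

Lemma inv_nil : inv [::].
Proof.
rewrite /inv /MW.sP /MW.sC muln0 expn0 muln1.
rewrite (eq_bigr (fun=> 1)) => [|i _]; last by rewrite /MW.wP big_nil.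
rewrite [X in _ * X](eq_bigr (fun=> 1)) => [|i _]; last by rewrite /MW.wC big_nil.
by rewrite !sum1_size leq_mul // size_filter count_size.
Qed.

Lemma inv_cons h v : v \in cols -> good h v -> inv h -> inv (v :: h).
Proof.
move=> hv /andP[_ hg]; rewrite /inv sP_cons => hi.
apply: (@leq_trans ((S * sP h + gP h v) * (S * sC h - gC h v))).
  by rewrite leq_mul2l sC_cons ?orbT.
have -> : 2 * size (v :: h) = 2 * size h + 2 by rewrite /=; lia.
rewrite expnD mulnA; apply: (@leq_trans (sP h * sC h * S ^ 2)); last by rewrite leq_mul2r hi orbT.
case: (leqP (gC h v) (S * sC h)) => hb; last first.
  by rewrite (eqP (ltnW hb : _ - _ == 0)) muln0.
(* In (S A + a)(S B - b) the term a S B is at most S A b because the column is good, and the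
   remaining term - a b only helps. *)
move: hb hg; move: (gC h v) (gP h v) (sP h) (sC h) => b a A B hb hg.
have -> : A * B * S ^ 2 = S * A * (S * B) by rewrite expnS expn1; lia.
move: (subnK hb); set X := S * B - b => E.
rewrite mulnDl -E mulnDr leq_add2l.
apply: (@leq_trans (a * (S * B))); first by rewrite leq_mul2l -E leq_addr orbT.
have -> : a * (S * B) = S * (a * B) by lia.
have -> : S * A * b = S * (b * A) by lia.
by rewrite leq_mul2l hg orbT.
Qed.

Section Exp.
Local Open Scope ring_scope.

(** The inequality 1 + u <= exp u at u = - x / (1 + x), inverted. This direction is needed because
    the weights have to be bounded from below by exponentials of the loads. *)
Lemma expR_frac_le (x : R) : 0 <= x -> expR (x / (1 + x)) <= 1 + x.
Proof.
move=> x0; have h := expR_ge1Dx (- (x / (1 + x))).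
have x1 : 0 < 1 + x by lra.
have e : 1 + - (x / (1 + x)) = (1 + x)^-1 by field; lra.
rewrite e in h; rewrite -[leRHS]invrK -[leLHS]invrK lef_pV2 ?posrE ?invr_gt0 ?expR_gt0 //.
by rewrite -expRN.
Qed.

Lemma expR_frac_le' (x : R) : 0 <= x < 1 -> expR (- (x / (1 - x))) <= 1 - x.
Proof.
move=> /andP[x0 x1]; have h := expR_ge1Dx (x / (1 - x)).
have x2 : 0 < 1 - x by lra.
have e : 1 + (x / (1 - x)) = (1 - x)^-1 by field; lra.
rewrite e in h; rewrite expRN -[leRHS]invrK lef_pV2 ?posrE ?invr_gt0 ?expR_gt0 //.
Qed.

Lemma K_ge4 : @Order.le _ R 4 K%:R. Proof. by rewrite (ler_nat R 4). Qed.
Lemma D_gt0 : @Order.lt _ R 0 D%:R. Proof. by rewrite ltr0n. Qed.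
Lemma S_gt0 : @Order.lt _ R 0 S%:R. Proof. rewrite ltr0n; lia. Qed.

(** Each factor is S (1 + u) with u <= 1 / K, hence at least S exp (u / (1 + 1 / K)), and u / (1 + 1
    / K) is the entry divided by D (K + 1). *)
Lemma wP_lower h i : i \in rI -> {subset h <= cols} ->
  S%:R ^+ size h * expR ((load P h i)%:R / (D%:R * (K%:R + 1))) <= (wP h i)%:R :> R.
Proof.
have [K0 D0 S0] := And3 K_ge4 D_gt0 S_gt0.
move=> hi; elim: h => [|v h IH] hs.
  by rewrite /MW.load /MW.wP !big_nil mul0r expR0 mulr1.
have hv : v \in cols by apply: hs; rewrite mem_head.
have {}IH := IH (fun x hx => hs x (mem_behead (s := v :: h) hx)).
rewrite /MW.load /MW.wP !big_cons natrD mulrDl expRD natrM /= exprS -/S.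
rewrite mulrACA; apply: ler_pM => //; rewrite ?mulr_ge0 ?expR_ge0 ?exprn_ge0 ?ler0n //.
have Pv0 : 0 <= (P i v)%:R :> R by rewrite ler0n.
have PvD : (P i v)%:R <= D%:R :> R by rewrite ler_nat hP.
have SE : S%:R = K%:R * D%:R :> R by rewrite -natrM.
set x : R := (P i v)%:R / S%:R.
have x0 : 0 <= x by rewrite divr_ge0 // ltW.
have xK : x <= K%:R^-1.
  by rewrite /x ler_pdivrMr // SE mulKf // gt_eqF //; lra.
rewrite natrD; apply: (@le_trans _ _ (S%:R * (1 + x))); last first.
  by rewrite mulrDr mulr1 /x mulrCA divff ?mulr1 // gt_eqF.
rewrite ler_pM2l //; apply: le_trans (expR_frac_le x0); rewrite ler_expR.
have -> : (P i v)%:R / (D%:R * (K%:R + 1)) = x / (1 + K%:R^-1).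
  by rewrite /x SE; field; rewrite !gt_eqF //; lra.
apply: ler_wpM2l => //; rewrite lef_pV2 ?posrE; last 2 first.
- by rewrite ltr_wpDr // invr_ge0; lra.
- by rewrite ltr_wpDr.
by rewrite lerD2l.
Qed.

Lemma wC_lower h i : i \in rJ -> {subset h <= cols} ->
  S%:R ^+ size h * expR (- ((load C h i)%:R / (D%:R * (K%:R - 1)))) <= (wC h i)%:R :> R.
Proof.
have [K0 D0 S0] := And3 K_ge4 D_gt0 S_gt0.
move=> hi; elim: h => [|v h IH] hs.
  by rewrite /MW.load /MW.wC !big_nil mul0r oppr0 expR0 mulr1.
have hv : v \in cols by apply: hs; rewrite mem_head.
have {}IH := IH (fun x hx => hs x (mem_behead (s := v :: h) hx)).
rewrite /MW.load /MW.wC !big_cons natrD mulrDl opprD expRD natrM /= exprS -/S.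
rewrite mulrACA; apply: ler_pM => //; rewrite ?mulr_ge0 ?expR_ge0 ?exprn_ge0 ?ler0n //.
have Cv0 : 0 <= (C i v)%:R :> R by rewrite ler0n.
have CvD : (C i v)%:R <= D%:R :> R by rewrite ler_nat hC.
have CvS : (C i v <= S)%N by apply: leq_trans (hC hi hv) _; rewrite leq_pmull; lia.
have SE : S%:R = K%:R * D%:R :> R by rewrite -natrM.
set x : R := (C i v)%:R / S%:R.
have x0 : 0 <= x by rewrite divr_ge0 // ltW.
have xK : x <= K%:R^-1.
  by rewrite /x ler_pdivrMr // SE mulKf // gt_eqF //; lra.
have K1 : K%:R^-1 < 1 :> R by rewrite invf_lt1; lra.
rewrite natrB //; apply: (@le_trans _ _ (S%:R * (1 - x))); last first.
  by rewrite mulrBr mulr1 /x mulrCA divff ?mulr1 // gt_eqF.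
rewrite ler_pM2l //; apply: le_trans (expR_frac_le' (_ : 0 <= x < 1)); last first.
  by rewrite x0 (le_lt_trans xK).
rewrite ler_expR lerN2.
have -> : (C i v)%:R / (D%:R * (K%:R - 1)) = x / (1 - K%:R^-1).
  by rewrite /x SE; field; rewrite !gt_eqF //; lra.
apply: ler_wpM2l => //; rewrite lef_pV2 ?posrE; last 2 first.
- by rewrite subr_gt0 (le_lt_trans xK).
- by rewrite subr_gt0.
by rewrite lerD2l lerN2.
Qed.

(** An active covering row has load below U D, so its weight is at least S ^ size h exp (- U / (K -
    1)). The invariant bounds its product with the packing weight, hence the packing load, up to the
    logarithm of |rI| |rJ|. That logarithm is at most |rI| + |rJ| = U / K ^ 2, which explains the
    choice of [U]. The summand [D] on the left leaves room for one more column. *)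
Lemma load_bound h i : inv h -> {subset h <= cols} -> act h <> [::] -> i \in rI ->
  (K * (load P h i + D) <= (K + 5) * (U * D))%N.
Proof.
have [K0 D0 S0] := And3 K_ge4 D_gt0 S_gt0.
move=> hinv hs; case Ea : (act h) => [//|i0 l] _ hi.
have hi0 : i0 \in act h by rewrite Ea mem_head.
have hJ := act_sub hi0.
have hl : (load C h i0 < U * D)%N by move: hi0; rewrite mem_filter => /andP[].
have hA : (wP h i <= sP h)%N by rewrite /MW.sP (big_rem i) //= leq_addr.
have hB : (wC h i0 <= sC h)%N by rewrite /MW.sC (big_rem i0) //= leq_addr.
have h1 : (wP h i * wC h i0 <= size rI * size rJ * S ^ (2 * size h))%N.
  by apply: leq_trans hinv; exact: leq_mul.
have {}h1 : (wP h i)%:R * (wC h i0)%:R <= (size rI)%:R * (size rJ)%:R * (S%:R ^+ size h) ^+ 2 :> R.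
  by rewrite -exprM -natrX -!natrM ler_nat [(size h * 2)%N]mulnC.
have Sh : 0 < S%:R ^+ size h :> R by rewrite exprn_gt0.
set X : R := (load P h i)%:R / (D%:R * (K%:R + 1)).
set Y : R := (load C h i0)%:R / (D%:R * (K%:R - 1)).
have h2 : expR (X - Y) <= (size rI)%:R * (size rJ)%:R.
  have hh : (S%:R ^+ size h * expR X) * (S%:R ^+ size h * expR (- Y)) <= (wP h i)%:R * (wC h i0)%:R.
    apply: ler_pM; rewrite ?mulr_ge0 ?expR_ge0 ?(ltW Sh) //; [exact: wP_lower|exact: wC_lower].
  by have := le_trans hh h1; rewrite mulrACA -expr2 -expRD mulrC ler_pM2r ?exprn_gt0.
have h3 : X - Y <= (size rI)%:R + (size rJ)%:R.
  rewrite -ler_expR; apply: le_trans h2 _; rewrite expRD ler_pM ?ler0n //.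
  - by apply: le_trans (expR_ge1Dx _); rewrite lerDr.
  - by apply: le_trans (expR_ge1Dx _); rewrite lerDr.
have UE : U%:R = K%:R * K%:R * ((size rI)%:R + (size rJ)%:R) :> R.
  by rewrite /U !natrM natrD.
have Y1 : Y <= U%:R / (K%:R - 1).
  rewrite /Y invfM mulrA ler_pM2r ?invr_gt0; last lra.
  by rewrite ler_pdivrMr // -natrM ler_nat ltnW.
have U1 : 1 <= (size rI)%:R + (size rJ)%:R :> R.
  by rewrite -natrD ler1n; move: hi; case: (rI).
have LX : (load P h i)%:R = X * (D%:R * (K%:R + 1)) by rewrite /X divfK // gt_eqF // mulr_gt0 //; lra.
rewrite -(ler_nat R) [in leLHS]natrM [in leLHS]natrD LX.
rewrite [in leRHS]natrM [in leRHS]natrD [in leRHS]natrM.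
have hX : X <= U%:R / (K%:R - 1) + U%:R / (K%:R * K%:R).
  rewrite [X in _ + X](_ : _ = (size rI)%:R + (size rJ)%:R); first lra.
  by rewrite UE; field; rewrite gt_eqF //; lra.
have U0 : 0 < U%:R :> R by rewrite UE !mulr_gt0 //; lra.
have KU : K%:R * K%:R <= U%:R :> R by rewrite UE ler_peMr // mulr_ge0; lra.
suff hm : K%:R * (X * (K%:R + 1) + 1) <= (K%:R + 5) * U%:R.
  by have := ler_wpM2r (ltW D0) hm; congr (_ <= _); ring.
(* This intermediate bound equals U (K + 3 + 2 / (K - 1) + 2 / K), the origin of [K + 5]; the
   summand 1 is absorbed because K ^ 2 <= U. *)
apply: (@le_trans _ _ (K%:R * ((U%:R / (K%:R - 1) + U%:R / (K%:R * K%:R)) * (K%:R + 1) + U%:R / (K%:R * K%:R)))).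
  rewrite ler_pM2l; last lra; apply: lerD; first by apply: ler_wpM2r => //; lra.
  by rewrite ler_pdivlMr ?mul1r // mulr_gt0 //; lra.
rewrite -subr_ge0.
have -> : (K%:R + 5) * U%:R - K%:R * ((U%:R / (K%:R - 1) + U%:R / (K%:R * K%:R)) * (K%:R + 1) + U%:R / (K%:R * K%:R))
  = U%:R * (2 * K%:R * K%:R - 6 * K%:R + 2) / ((K%:R - 1) * K%:R) :> R.
  by field; rewrite !gt_eqF //; lra.
by rewrite divr_ge0 ?mulr_ge0 //; try lra; nra.
Qed.

End Exp.

Lemma mwS n : mw n.+1 = mw_step rI rJ cols P C K D U (mw n).
Proof. by []. Qed.

Lemma inv_mw n : inv (mw n).
Proof.
elim: n => [|n IH]; first exact: inv_nil.
rewrite mwS; case: (mw_stepP rI rJ cols P C K D U (mw n)) => [[-> _]//|[v [hv hg ->]]].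
exact: inv_cons.
Qed.

Lemma good_act h v : good h v -> act h <> [::].
Proof. by move=> /andP[+ _] E; rewrite /MW.gC E big_nil. Qed.

(** No feasibility is assumed: a column is added only while some covering row is active, and then
    [load_bound] has room for it. *)
Lemma mw_load_le n i : i \in rI -> K * load P (mw n) i <= (K + 5) * (U * D).
Proof.
move=> hi; elim: n => [|n IH]; first by rewrite /MW.load big_nil muln0.
rewrite mwS; case: (mw_stepP rI rJ cols P C K D U (mw n)) => [[-> _]//|[v [hv hg ->]]].
have := load_bound (inv_mw n) (@mw_sub _ _ _ _ _ _ _ _ _ _ _ n) (good_act hg) hi.
apply: leq_trans; rewrite leq_mul2l; apply/orP; right.
by rewrite /MW.load big_cons addnC leq_add2l hP.
Qed.

(** Every step then raises the potential [pot] below by at least [D]. *)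
Hypothesis hw : forall v, v \in cols ->
  (exists2 i, i \in rI & P i v = D) \/ (forall i, i \in rJ -> C i v = 0 \/ C i v = D).

(** Covering loads are cut off at [U.+1] rather than [U]: an active row is below U D, so its
    increase by [D] counts in full. *)
Definition pot h := \sum_(i <- rI) load P h i + \sum_(i <- rJ) minn (load C h i) (U.+1 * D).

Lemma sum_strict (A : eqType) (l : seq A) (F G : A -> nat) i c : i \in l ->
  (forall j, j \in l -> F j <= G j) -> F i + c <= G i ->
  \sum_(j <- l) F j + c <= \sum_(j <- l) G j.
Proof.
move=> hi hle hlt; rewrite (big_rem i) // [leqRHS](big_rem i) //= addnAC leq_add //.
by apply: leq_sum_seq_in => x /mem_rem; exact: hle.
Qed.

Lemma pot_cons h v : v \in cols -> good h v -> pot h + D <= pot (v :: h).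
Proof.
move=> hv hg.
have lP i : load P (v :: h) i = P i v + load P h i by rewrite /MW.load big_cons.
have lC i : load C (v :: h) i = C i v + load C h i by rewrite /MW.load big_cons.
have hP' i : i \in rI -> load P h i <= load P (v :: h) i by rewrite lP leq_addl.
have hC' i : i \in rJ -> minn (load C h i) (U.+1 * D) <= minn (load C (v :: h) i) (U.+1 * D).
  by rewrite lC; lia.
case: (hw hv) => [[i hi E]|hc].
  rewrite /pot addnAC leq_add //; last exact: leq_sum_seq_in.
  by apply: (sum_strict hi hP'); rewrite lP E addnC.
rewrite /pot -addnA leq_add //; first exact: leq_sum_seq_in.
have [i hi Ei] : exists2 i, i \in act h & C i v = D.
  move/andP: hg => [+ _]; rewrite lt0n /MW.gC => h0.
  have : has (fun i => C i v != 0) (act h).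
    apply: contraR h0 => /hasPn h0; rewrite big_seq big1 // => i /h0.
    by rewrite negbK => /eqP->; rewrite muln0.
  case/hasP => i hi h1; exists i => //.
  by case: (hc i (act_sub hi)) => // E; rewrite E in h1.
apply: (sum_strict (act_sub hi) hC'); rewrite lC Ei.
by move: hi; rewrite mem_filter => /andP[hl _]; rewrite mulSn; lia.
Qed.

Lemma pot_le n : pot (mw n) <= (size rI * (3 * U) + size rJ * U.+1) * D.
Proof.
rewrite /pot mulnDl leq_add // -mulnA -sum1_size big_distrl /=; apply: leq_sum_seq_in => i hi.
  rewrite mul1n -(leq_pmul2l (m := K)); last by lia.
  apply: leq_trans (mw_load_le n hi) _; rewrite -[3 * U * D]mulnA.
  by move: (U * D) => u; nia.
by rewrite mul1n geq_minr.
Qed.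

Lemma pot_progress n : act (mw n) = [::] \/ n * D <= pot (mw n) \/
  exists2 m, act (mw m) <> [::] & {in cols, forall v, ~~ good (mw m) v}.
Proof.
elim: n => [|n [IH|[IH|IH]]]; first by right; left.
- rewrite mwS; case: (mw_stepP rI rJ cols P C K D U (mw n)) => [[-> _]|[v [hv hg ->]]]; first by left.
  by case: (good_act hg).
- rewrite mwS; case: (mw_stepP rI rJ cols P C K D U (mw n)) => [[-> hn]|[v [hv hg ->]]].
    case E : (act (mw n)) => [|x l]; first by left.
    by right; right; exists n => //; rewrite E.
  by right; left; apply: leq_trans (pot_cons hv hg); rewrite mulSn addnC leq_add2r.
by right; right.
Qed.

Section Complete.
Local Open Scope ring_scope.
Variables (x : TV -> R) (r : R).
Hypothesis x0 : forall v, v \in cols -> 0 <= x v.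
Hypothesis r0 : 0 < r.
Hypothesis hPx : forall i, i \in rI -> \sum_(v <- cols) (P i v)%:R * x v <= r.
Hypothesis hCx : forall i, i \in rJ -> r <= \sum_(v <- cols) (C i v)%:R * x v.

(** Weak duality. Combining the rows of the program with the current weights shows that the sum of
    [G] is at most 0. Without a good column every [G v] would be nonnegative, and positive on some
    column used by [x] with positive covering gain. *)
Lemma good_exists h : {subset h <= cols} -> act h <> [::] -> ~ {in cols, forall v, ~~ good h v}.
Proof.
move=> hs hact hn.
have wC0 i : i \in rJ -> 0 < (wC h i)%:R :> R.
  move=> hi; rewrite ltr0n /MW.wC big_seq prodn_cond_gt0 // => v hv.
  rewrite subn_gt0; apply: leq_ltn_trans (hC hi (hs v hv)) _.
  by rewrite ltn_Pmull //; lia.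
have B0 : 0 < (sC h)%:R :> R.
  case E : (act h) hact => [//|i l] _.
  have hi : i \in act h by rewrite E mem_head.
  rewrite /MW.sC (big_rem i) //= natrD ltr_wpDr ?ler0n //; exact/wC0/(act_sub hi).
have SB : (sC h)%:R * r <= \sum_(v <- cols) (gC h v)%:R * x v.
  rewrite (eq_bigr (fun v => \sum_(i <- act h) (wC h i)%:R * ((C i v)%:R * x v))); last first.
    by move=> v _; rewrite /MW.gC natr_sum mulr_suml; apply: eq_bigr => i _; rewrite natrM mulrA.
  rewrite exchange_big /= /MW.sC natr_sum mulr_suml [leLHS]big_seq [leRHS]big_seq.
  apply: ler_sum => i hi; rewrite -mulr_sumr; apply: ler_wpM2l; first exact: ler0n.
  exact/hCx/(act_sub hi).
have SA : \sum_(v <- cols) (gP h v)%:R * x v <= (sP h)%:R * r.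
  rewrite (eq_bigr (fun v => \sum_(i <- rI) (wP h i)%:R * ((P i v)%:R * x v))); last first.
    by move=> v _; rewrite /MW.gP natr_sum mulr_suml; apply: eq_bigr => i _; rewrite natrM mulrA.
  rewrite exchange_big /= /MW.sP natr_sum mulr_suml [leLHS]big_seq [leRHS]big_seq.
  apply: ler_sum => i hi; rewrite -mulr_sumr; apply: ler_wpM2l; first exact: ler0n.
  exact: hPx.
pose G v := ((gP h v)%:R * (sC h)%:R - (gC h v)%:R * (sP h)%:R) * x v.
have hG v : v \in cols -> 0 < (gC h v)%:R * x v -> 0 < G v.
  move=> hv h0; have x1 : 0 < x v.
    by rewrite lt_neqAle x0 // andbT; apply: contraTneq h0 => <-; rewrite mulr0 ltxx.
  rewrite pmulr_lgt0 // in h0; rewrite /G mulr_gt0 // subr_gt0 -!natrM ltr_nat.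
  have := hn v hv; rewrite /MW.good negb_and -leqNgt leqn0 => /orP[/eqP E|].
    by rewrite E ltxx in h0.
  by rewrite -ltnNge.
have hG0 v : v \in cols -> 0 <= G v.
  move=> hv; have := mulr_ge0 (ler0n R (gC h v)) (x0 hv); rewrite le_eqVlt => /orP[/eqP E|].
    rewrite /G mulrBl mulrAC [X in _ - X]mulrAC -E mul0r subr0.
    by rewrite !mulr_ge0 ?ler0n ?x0.
  by move/(hG v hv)/ltW.
have [v hv hgv] : exists2 v, v \in cols & 0 < (gC h v)%:R * x v.
  have : has (fun v => 0 < (gC h v)%:R * x v) cols.
    apply/negPn/negP => /hasPn h0.
    have : \sum_(v <- cols) (gC h v)%:R * x v <= 0.
      by rewrite big_seq; apply: sumr_le0 => v /h0; rewrite -leNgt.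
    by move/(le_trans SB); rewrite leNgt mulr_gt0.
  by case/hasP => v; exists v.
have : 0 < \sum_(v <- cols) G v.
  rewrite (big_rem v) //= ltr_wpDr ?hG // big_seq sumr_ge0 // => w /mem_rem; exact: hG0.
have -> : \sum_(v <- cols) G v = (sC h)%:R * (\sum_(v <- cols) (gP h v)%:R * x v)
     - (sP h)%:R * (\sum_(v <- cols) (gC h v)%:R * x v).
  by rewrite !mulr_sumr -sumrB; apply: eq_bigr => w _; rewrite /G; ring.
rewrite subr_gt0 ltNge => /negP; apply.
apply: le_trans (ler_wpM2l (ler0n _ _) SA) _.
by apply: le_trans (ler_wpM2l (ler0n _ _) SB); rewrite mulrCA.
Qed.

Lemma mw_complete n : (size rI * (3 * U) + size rJ * U.+1 < n)%N ->
  forall i, i \in rJ -> (U * D <= load C (mw n) i)%N.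
Proof.
move=> hn i hi; case: (pot_progress n) => [E|[h|[m h1 h2]]].
- rewrite leqNgt; apply/negP => h.
  by have : i \in act (mw n); [rewrite mem_filter h|rewrite E].
- have := leq_trans h (pot_le n); rewrite leq_pmul2r // leqNgt hn //.
by case: (good_exists (@mw_sub _ _ _ _ _ _ _ _ _ _ _ m) h1 h2).
Qed.

End Complete.
End MWCorrect.

(** * The algorithm *)

Definition qcode : Type := bool * (nat * nat).
Definition raw : Type :=
  seq qcode * (seq qcode * (seq (seq qcode) * seq (seq bool * qcode))).
Definition inst : Type :=
  nat * (seq nat * (seq nat * (seq (seq nat) * seq (seq bool * nat)))).

Definition eqcode : qcode -> tree := eprod ebool (eprod ebin ebin).
Definition eraw : raw -> tree :=
  eprod (eseq eqcode) (eprod (eseq eqcode)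
    (eprod (eseq (eseq eqcode)) (eseq (eprod (eseq ebool) eqcode)))).
Definition einst : inst -> tree :=
  eprod ebin (eprod (eseq ebin) (eprod (eseq ebin)
    (eprod (eseq (eseq ebin)) (eseq (eprod (eseq ebool) ebin))))).

Section Algorithm.
Local Open Scope nat_scope.

Definition dens (l : seq qcode) := \prod_(q <- l) q.2.2.
Definition common_den (x : raw) :=
  dens x.1 * (dens x.2.1 * ((\prod_(r <- x.2.2.1) dens r) * \prod_(g <- x.2.2.2) g.2.2.2)).
Definition scale (D : nat) (q : qcode) := q.2.1 * (D %/ q.2.2).
Definition to_inst (x : raw) : inst :=
  (common_den x, ([seq scale (common_den x) q | q <- x.1],
    ([seq scale (common_den x) q | q <- x.2.1],
    ([seq [seq scale (common_den x) q | q <- r] | r <- x.2.2.1],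
     [seq (g.1, scale (common_den x) g.2) | g <- x.2.2.2])))).

Definition Den (x : inst) := x.1.
Definition Pj (x : inst) j := nth 0 x.2.1 j.
Definition Rj (x : inst) j := nth 0 x.2.2.1 j.
Definition Bdj (x : inst) d j := nth 0 (nth [::] x.2.2.2.1 d) j.
Definition Sg (x : inst) g j := nth false (nth ([::], 0) x.2.2.2.2 g).1 j.
Definition Wg (x : inst) g := (nth ([::], 0) x.2.2.2.2 g).2.
Definition nJ (x : inst) := size x.2.1.
Definition nD (x : inst) := size x.2.2.2.1.
Definition nG (x : inst) := size x.2.2.2.2.

Variable K : nat.

(** An integral geometric grid: slots have length 1 as long as they start before [K], and about a
    [K]-th of their starting point afterwards. *)
Definition tg k := iter k (fun t => t + (t %/ K).+1) 0.
Definition lg k := (tg k %/ K).+1.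

Definition sumW x := \sum_(g <- iota 0 (nG x)) Wg x g.
(** The time unit of the grid is [1 / Zt]; the factor [K * Den ^ 3 * (sumW + 1)]
    makes the first slot negligible. *)
Definition Zt x := K * (Den x * (Den x * Den x)) * (sumW x + 1).
(** An upper bound on every release date and on the total load of every packing row. A slot that
    starts at [Xb] or later has real length at least [Tot], enough to run all jobs completely, and
    slot [Hor] is one because the grid doubles every [K] slots. *)
Definition Tot x := \sum_(j <- iota 0 (nJ x)) Rj x j
  + \sum_(d <- iota 0 (nD x)) \sum_(j <- iota 0 (nJ x)) Bdj x d j * Pj x j.
Definition Xb x := K * Zt x * Tot x.
Definition Hor x := K * bl (Xb x).
Definition Lp x := \prod_(k <- iota 0 (Hor x)) lg k.

(** The column [(true, (k, j))] is the fraction of job [j] processed in slot [k];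
    [(false, (k, g))] is the fraction of group [g] unfinished after slot [k]. *)
Definition label : Type := bool * (nat * nat).
Definition elabel : label -> tree := eprod ebool (eprod eun eun).

Definition cols x : seq label :=
  flatten [seq [seq (true, (k, j)) | j <- [seq j <- iota 0 (nJ x) | Rj x j * Zt x <= tg k * Den x]]
          | k <- iota 0 (Hor x)] ++
  flatten [seq [seq (false, (k, g)) | g <- iota 0 (nG x)] | k <- iota 0 (Hor x)].
(** [(false, (0, 0))] is the budget row, which limits the cost of the program to [V];
    [(true, (k, d))] is packing row [d] in slot [k]. *)
Definition rowsP x : seq label :=
  (false, (0, 0)) :: flatten [seq [seq (true, (k, d)) | d <- iota 0 (nD x)] | k <- iota 0 (Hor x)].
Definition rowsC x : seq (nat * (nat * nat)) :=
  flatten [seq flatten [seq [seq (k, (g, j)) |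
             j <- [seq j <- iota 0 (nJ x) | Sg x g j && (0 < Pj x j)]]
          | g <- iota 0 (nG x)] | k <- iota 0 (Hor x)].

(** The common right-hand side of all rows: packing rows, with bound [lg k], are scaled by V Lp / lg
    k, the budget row, with bound [V], by Den ^ 2 Lp, and covering rows by the whole product. *)
Definition Rr x V := Den x * Den x * V * Lp x.
Definition Pe x V (i v : label) :=
  if i.1 then
    (if v.1 && (i.2.1 == v.2.1) then
       Zt x * Bdj x i.2.2 v.2.2 * Pj x v.2.2 * V * (Lp x %/ lg i.2.1) else 0)
  else (if v.1 then 0 else Wg x v.2.2 * lg v.2.1.+1 * (Den x * Den x) * Lp x).
Definition Cb (i : nat * (nat * nat)) (v : label) :=
  if v.1 then (v.2.1 <= i.1) && (v.2.2 == i.2.2) else (v.2.1 == i.1) && (v.2.2 == i.2.1).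
(** The largest entry of the column, covering entries being 0 or [Rr]. The factor [sc] turns it into
    [Dc] for all columns at once. *)
Definition Mc x V v := maxn (Rr x V) (\max_(i <- rowsP x) Pe x V i v).
Definition Dc x V := \prod_(v <- cols x) Mc x V v.
Definition sc x V v := Dc x V %/ Mc x V v.
Definition Pm x V i v := Pe x V i v * sc x V v.
Definition Cm x V i v := (if Cb i v then Rr x V else 0) * sc x V v.
Definition Uc x := K * K * (size (rowsP x) + size (rowsC x)).
Definition Tc x := (size (rowsP x) * (3 * Uc x) + size (rowsC x) * (Uc x).+1).+1.
Definition sol x V : seq label :=
  mw (rowsP x) (rowsC x) (cols x) (Pm x V) (Cm x V) K (Dc x V) (Uc x) (Tc x).

Definition xld x V (h : seq label) k j :=
  \sum_(v <- h) (if v.1 && ((v.2.1 <= k) && (v.2.2 == j)) then Rr x V * sc x V v else 0).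
(** The threshold in use is theta = i / (K + 1) with i <= K. It stays below 1 by at least 1 / (K +
    1), so that the thresholds a group misses can be counted without rounding loss. *)
Definition cov x V h i g k :=
  all (fun j => ~~ (Sg x g j && (0 < Pj x j)) ||
    (i * (Uc x * Dc x V) <= (K + 1) * xld x V h k j)) (iota 0 (nJ x)).
(** If [m] is the first slot at which the group is covered, 1 plus the lengths of slots 1 to [m]
    telescopes to [tg m.+1], the end of that slot. *)
Definition Ob x V h i := \sum_(g <- iota 0 (nG x))
  Wg x g * (1 + \sum_(k <- iota 0 (Hor x)) (if cov x V h i g k then 0 else lg k.+1)).
Definition cand : Type := nat * (seq label * nat).
Definition ecand : cand -> tree := eprod ebin (eprod (eseq elabel) ebin).
(** The inequality that averaging guarantees for some [i] when the program is feasible for [V]. It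
    is tested on the computed cost, so passing it certifies the candidate by itself. *)
Definition okc x (c : cand) :=
  K * K * (K + 1) * Ob x c.1 c.2.1 c.2.2 <=
    2 * c.2.2 * (K * K * sumW x + (K + 1) * (K + 5) * c.1).
Definition Hv x := (K * bl (sumW x * tg (Hor x).+1)).+1.
Definition cands x : seq cand :=
  flatten [seq [seq (V, (sol x V, i)) | i <- iota 1 K] | V <- [seq tg k.+1 | k <- iota 0 (Hv x)]].
(** Guesses are tried in increasing order, so the accepted one is at most any guess known to
    succeed. The default, without chosen columns, processes every job in the last slot. *)
Definition best x : cand :=
  if [seq c <- cands x | okc x c] is c :: _ then c else (1, ([::], 1)).

Definition cnt (h : seq label) k j :=
  \sum_(w <- h) (if w.1 && ((w.2.1 == k) && (w.2.2 == j)) then 1 else 0).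
Definition rate_num x (c : cand) k j :=
  if k == Hor x then Pj x j * Zt x * K
  else Pj x j * cnt c.2.1 k j * Rr x c.1 * Zt x * K.
Definition rate_den x (c : cand) k j :=
  if k == Hor x then Den x * (K + 5) * lg k
  else Den x * Uc x * Mc x c.1 (true, (k, j)) * (K + 5) * lg k.
Definition end_num k := (K + 5) * (K + 1) * tg k.+1.
Definition end_den x (c : cand) := K * c.2.2 * Zt x.
(** Rationals are encoded through [numq] and [denq], so fractions have to be output in lowest
    terms. *)
Definition reduce a b : qcode := (false, (a %/ gcdn a b, b %/ gcdn a b)).
Definition output x (c : cand) : seq (qcode * seq qcode) :=
  [seq (reduce (end_num k) (end_den x c),
        [seq reduce (rate_num x c k j) (rate_den x c k j) | j <- iota 0 (nJ x)])
  | k <- iota 0 (Hor x).+1].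
Definition algo (x : raw) := output (to_inst x) (best (to_inst x)).
End Algorithm.

(** * Polynomial running time of the algorithm *)

Ltac leaf := repeat first [eassumption | exact: pf_id | apply: pf_fst | apply: pf_snd].
Ltac pf_hook ::= fail.
Ltac eta := lazymatch goal with
 | |- pf _ _ (fun _ => _) => idtac
 | |- pf ?e ?e' ?f => change (pf e e' (fun a => f a))
 end.
(** Search directed by the head symbol. [pf_hook] is redefined to include each group of functions
    once their lemmas are available; a binary goal not matched otherwise may fall back on a unary
    one. *)
Ltac go := eta; first [ solve [leaf] | exact: pf_const | lazymatch goal with
 | |- pf _ _ (fun a => bigop _ _ (fun x => BigBody x addn true _)) => apply: pf_sum; last go; go
 | |- pf _ _ (fun a => bigop _ _ (fun x => BigBody x muln true _)) => apply: pf_prod; last go; go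
 | |- pf _ _ (fun a => bigop _ _ (fun x => BigBody x maxn true _)) => apply: pf_bigmax; last go; go
 | |- pf _ _ (fun a => map _ _) => apply: pf_map; last go; go
 | |- pf _ _ (fun a => seq.filter _ _) => apply: pf_filter; last go; go
 | |- pf _ _ (fun a => all _ _) => apply: pf_all; last go; go
 | |- pf _ _ (fun a => flatten _) => apply: pf_flatten; go
 | |- pf _ _ (fun a => _ ++ _) => apply: pf_cat; go
 | |- pf _ _ (fun a => _ :: _) => apply: pf_cons; go
 | |- pf _ _ (fun a => (_, _)) => apply: pf_pair; go
 | |- pf _ _ (fun a => if _ then _ else _) => apply: pf_if; go
 | |- pf _ _ (fun a => _ && _) => apply: pf_and; go
 | |- pf _ _ (fun a => _ || _) => apply: pf_or; go
 | |- pf _ _ (fun a => ~~ _) => apply: pf_neg; go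
 | |- pf _ _ (fun a => leq _ _) => apply: pf_leq; go
 | |- pf _ _ (fun a => _ == _) => apply: pf_eqn; go
 | |- pf _ eun (fun a => addn _ _) => apply: pf_unD; go
 | |- pf _ eun (fun a => muln _ _) => apply: pf_unM; go
 | |- pf _ eun (fun a => S _) => apply: pf_unS; go
 | |- pf _ eun (fun a => size _) => apply: pf_size_un; go
 | |- pf _ eun (fun a => bl _) => apply: pf_bl; go
 | |- pf _ ebin (fun a => addn _ _) => apply: pf_add; go
 | |- pf _ ebin (fun a => muln _ _) => apply: pf_mul; go
 | |- pf _ ebin (fun a => divn _ _) => apply: pf_div; go
 | |- pf _ ebin (fun a => gcdn _ _) => apply: pf_gcd; go
 | |- pf _ ebin (fun a => maxn _ _) => apply: pf_maxn; go
 | |- pf _ ebin (fun a => S _) => apply: (@pf_add _ _ (fun=> 1%N)); go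
 | |- pf _ _ (fun a => nth _ _ _) => apply: pf_nth; go
 | |- pf _ _ (fun a => iota 0 _) => apply: pf_iota; go
 | |- pf _ _ (fun a => fst _) => first [apply: pf_un; solve [leaf] | apply: pf_fst; go]
 | |- pf _ _ (fun a => snd _) => first [apply: pf_un; solve [leaf] | apply: pf_snd; go]
 | |- pf _ ebin _ => first [pf_hook; go | apply: pf_un; go]
 | |- _ => pf_hook; go
 end ].

Section AlgorithmPoly.
Local Open Scope nat_scope.

Lemma pf_dens T (e : T -> tree) f : pf e (eseq eqcode) f -> pf e ebin (fun a => dens (f a)).
Proof. by apply: (pf_comp (F := dens)); rewrite /dens; go. Qed.

Lemma pf_common_den T (e : T -> tree) f : pf e eraw f -> pf e ebin (fun a => common_den (f a)).
Proof.
apply: (pf_comp (F := common_den)); rewrite /common_den; do !apply: pf_mul.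
- by apply: pf_dens; go.
- by apply: pf_dens; go.
- by apply: (pf_prod (F := fun _ r => dens r)); last go; apply: pf_dens; go.
- by go.
Qed.

Lemma pf_scale T (e : T -> tree) f g : pf e ebin f -> pf e eqcode g ->
  pf e ebin (fun a => scale (f a) (g a)).
Proof. by apply: (pf2 (F := scale)); rewrite /scale; go. Qed.

Lemma pf_to_inst T (e : T -> tree) f : pf e eraw f -> pf e einst (fun a => to_inst (f a)).
Proof.
apply: (pf_comp (F := to_inst)); rewrite /to_inst.
have h := pf_common_den (pf_id eraw).
have hc X (eX : X -> tree) : pf (eprod eraw eX) ebin (fun z => common_den z.1).
  by apply: pf_common_den; go.
do !apply: pf_pair => //.
- by apply: pf_map; last go; apply: pf_scale; [apply: hc|go].
- by apply: pf_map; last go; apply: pf_scale; [apply: hc|go].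
- apply: pf_map; last go; apply: (pf_map (F := fun z q => scale (common_den z.1) q)); last go.
  by apply: pf_scale; [apply: pf_common_den; go|go].
- apply: pf_map; last go; apply: pf_pair; first by go.
  by apply: pf_scale; [apply: hc|go].
Qed.

Section Inst.
Variables (T : Type) (e : T -> tree) (f : T -> inst) (g h : T -> nat).
Hypotheses (hf : pf e einst f) (hg : pf e eun g) (hh : pf e eun h).

Lemma pf_Den : pf e ebin (fun a => Den (f a)).
Proof. by apply: (pf_comp (F := Den)) hf; rewrite /Den; go. Qed.
Lemma pf_Pj : pf e ebin (fun a => Pj (f a) (g a)).
Proof. by apply: (pf2 (F := Pj)) hf hg; rewrite /Pj; go. Qed.
Lemma pf_Rj : pf e ebin (fun a => Rj (f a) (g a)).
Proof. by apply: (pf2 (F := Rj)) hf hg; rewrite /Rj; go. Qed.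
Lemma pf_Bdj : pf e ebin (fun a => Bdj (f a) (g a) (h a)).
Proof. by apply: (pf3 (F := Bdj)) hf hg hh; rewrite /Bdj; go. Qed.
Lemma pf_Sg : pf e ebool (fun a => Sg (f a) (g a) (h a)).
Proof. by apply: (pf3 (F := Sg)) hf hg hh; rewrite /Sg; go. Qed.
Lemma pf_Wg : pf e ebin (fun a => Wg (f a) (g a)).
Proof. by apply: (pf2 (F := Wg)) hf hg; rewrite /Wg; go. Qed.
Lemma pf_nJ : pf e eun (fun a => nJ (f a)).
Proof. by apply: (pf_comp (F := nJ)) hf; rewrite /nJ; go. Qed.
Lemma pf_nD : pf e eun (fun a => nD (f a)).
Proof. by apply: (pf_comp (F := nD)) hf; rewrite /nD; go. Qed.
Lemma pf_nG : pf e eun (fun a => nG (f a)).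
Proof. by apply: (pf_comp (F := nG)) hf; rewrite /nG; go. Qed.
End Inst.

End AlgorithmPoly.

Ltac pf_inst := lazymatch goal with
 | |- pf _ _ (fun a => Den _) => apply: pf_Den
 | |- pf _ _ (fun a => Pj _ _) => apply: pf_Pj
 | |- pf _ _ (fun a => Rj _ _) => apply: pf_Rj
 | |- pf _ _ (fun a => Bdj _ _ _) => apply: pf_Bdj
 | |- pf _ _ (fun a => Sg _ _ _) => apply: pf_Sg
 | |- pf _ _ (fun a => Wg _ _) => apply: pf_Wg
 | |- pf _ _ (fun a => nJ _) => apply: pf_nJ
 | |- pf _ _ (fun a => nD _) => apply: pf_nD
 | |- pf _ _ (fun a => nG _) => apply: pf_nG
 end.
Ltac pf_hook ::= pf_inst.

Section AlgorithmPoly.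
Local Open Scope nat_scope.

Lemma tg_lt K k : tg K k < 2 ^ k.
Proof.
rewrite /tg; elim: k => // k IH; rewrite iterS expnS; move: IH; set t := iter _ _ _ => IH.
by have := leq_div t K; lia.
Qed.

Lemma pf_tg T (e : T -> tree) K f : pf e eun f -> pf e ebin (fun a => tg K (f a)).
Proof.
move=> hf; have sf := pf_size hf.
apply: (@pf_iter _ _ _ _ (fun=> fun t => t + (t %/ K).+1) f (fun=> 0)
  (fun a => 4 * tree_size (eun (f a)) + 1)) => //.
- by go.
- by go.
- by do !(apply: pbd_add || apply: pbd_mul) => //; exact: pbd_const.
move=> a i hi; apply: leq_trans (size_ebin _) _; rewrite leq_add2r leq_mul2l /=.
apply: bl_le; apply: leq_trans (tg_lt K i) _; rewrite leq_exp2l // size_eun; lia.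
Qed.

Lemma pf_lg T (e : T -> tree) K f : pf e eun f -> pf e ebin (fun a => lg K (f a)).
Proof.
move=> hf; apply: (pf_add (f := fun=> 1)); first by go.
by apply: pf_div; [apply: pf_tg|go].
Qed.

End AlgorithmPoly.

Ltac pf_grid := lazymatch goal with
 | |- pf _ _ (fun a => tg _ _) => apply: pf_tg
 | |- pf _ _ (fun a => lg _ _) => apply: pf_lg
 | |- _ => pf_inst
 end.
Ltac pf_hook ::= pf_grid.

Section AlgorithmPoly.
Local Open Scope nat_scope.
Variables (T : Type) (e : T -> tree) (K : nat).

Lemma pf_sumW f : pf e einst f -> pf e ebin (fun a => sumW (f a)).
Proof. by apply: (pf_comp (F := sumW)); rewrite /sumW; go. Qed.

End AlgorithmPoly.

Section AlgorithmPoly.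
Local Open Scope nat_scope.
Variables (T : Type) (e : T -> tree) (K : nat).

Lemma pf_Zt f : pf e einst f -> pf e ebin (fun a => Zt K (f a)).
Proof.
move=> hf; apply: (pf_comp (F := Zt K)) hf; rewrite /Zt; apply: pf_mul; first by go.
by apply: pf_add; [apply: pf_sumW; go|go].
Qed.

End AlgorithmPoly.

Ltac pf_unit := lazymatch goal with
 | |- pf _ _ (fun a => sumW _) => apply: pf_sumW
 | |- pf _ _ (fun a => Zt _ _) => apply: pf_Zt
 | |- _ => pf_grid
 end.
Ltac pf_hook ::= pf_unit.

Section AlgorithmPoly.
Local Open Scope nat_scope.
Variables (T : Type) (e : T -> tree) (K : nat).

Lemma pf_Hor f : pf e einst f -> pf e eun (fun a => Hor K (f a)).
Proof. by apply: (pf_comp (F := Hor K)); rewrite /Hor /Xb /Tot; go. Qed.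

End AlgorithmPoly.

Ltac pf_horizon := lazymatch goal with
 | |- pf _ _ (fun a => Hor _ _) => apply: pf_Hor
 | |- _ => pf_unit
 end.
Ltac pf_hook ::= pf_horizon.

Section AlgorithmPoly.
Local Open Scope nat_scope.
Variables (T : Type) (e : T -> tree) (K : nat).

Lemma pf_Lp f : pf e einst f -> pf e ebin (fun a => Lp K (f a)).
Proof. by apply: (pf_comp (F := Lp K)); rewrite /Lp; go. Qed.

Lemma pf_cols f : pf e einst f -> pf e (eseq elabel) (fun a => cols K (f a)).
Proof. by apply: (pf_comp (F := cols K)); rewrite /cols; go. Qed.

Lemma pf_rowsP f : pf e einst f -> pf e (eseq elabel) (fun a => rowsP K (f a)).
Proof. by apply: (pf_comp (F := rowsP K)); rewrite /rowsP; go. Qed.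

Lemma pf_rowsC f : pf e einst f -> pf e (eseq (eprod eun (eprod eun eun))) (fun a => rowsC K (f a)).
Proof. by apply: (pf_comp (F := rowsC K)); rewrite /rowsC; go. Qed.

End AlgorithmPoly.

Ltac pf_lp := lazymatch goal with
 | |- pf _ _ (fun a => Lp _ _) => apply: pf_Lp
 | |- pf _ _ (fun a => cols _ _) => apply: pf_cols
 | |- pf _ _ (fun a => rowsP _ _) => apply: pf_rowsP
 | |- pf _ _ (fun a => rowsC _ _) => apply: pf_rowsC
 | |- _ => pf_horizon
 end.
Ltac pf_hook ::= pf_lp.

Section LPPoly.
Local Open Scope nat_scope.
Variables (T : Type) (e : T -> tree) (K : nat) (f : T -> inst) (V : T -> nat) (i v : T -> label).
Variable r : T -> nat * (nat * nat).
Hypotheses (hf : pf e einst f) (hV : pf e ebin V) (hi : pf e elabel i) (hv : pf e elabel v).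
Hypothesis hr : pf e (eprod eun (eprod eun eun)) r.

Lemma pf_Rr : pf e ebin (fun a => Rr K (f a) (V a)).
Proof. by rewrite /Rr; go. Qed.

Lemma pf_Pe : pf e ebin (fun a => Pe K (f a) (V a) (i a) (v a)).
Proof. by rewrite /Pe; go. Qed.

Lemma pf_Cb : pf e ebool (fun a => Cb (r a) (v a)).
Proof. by rewrite /Cb; go. Qed.

Lemma pf_Uc : pf e eun (fun a => Uc K (f a)).
Proof. by rewrite /Uc; go. Qed.

Lemma pf_Tc : pf e eun (fun a => Tc K (f a)).
Proof. by have hU := pf_Uc; rewrite /Tc; go. Qed.

Lemma pf_Hv : pf e eun (fun a => Hv K (f a)).
Proof. by rewrite /Hv; go. Qed.

End LPPoly.

Section LPPoly2.
Local Open Scope nat_scope.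
Variables (T : Type) (e : T -> tree) (K : nat) (f : T -> inst) (V : T -> nat) (v : T -> label).
Hypotheses (hf : pf e einst f) (hV : pf e ebin V) (hv : pf e elabel v).

Lemma pf_Mc : pf e ebin (fun a => Mc K (f a) (V a) (v a)).
Proof.
apply: (pf3 (F := Mc K)) hf hV hv; rewrite /Mc; apply: pf_maxn.
  by apply: pf_Rr; go.
by apply: pf_bigmax; last go; apply: pf_Pe; go.
Qed.

End LPPoly2.

Section LPPoly3.
Local Open Scope nat_scope.
Variables (T : Type) (e : T -> tree) (K : nat) (f : T -> inst) (V : T -> nat).
Hypotheses (hf : pf e einst f) (hV : pf e ebin V).

Lemma pf_Dc : pf e ebin (fun a => Dc K (f a) (V a)).
Proof.
apply: (pf2 (F := Dc K)) hf hV; rewrite /Dc.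
by apply: pf_prod; last go; apply: pf_Mc; go.
Qed.

Variables (i v : T -> label) (r : T -> nat * (nat * nat)).
Hypotheses (hi : pf e elabel i) (hv : pf e elabel v).
Hypothesis hr : pf e (eprod eun (eprod eun eun)) r.

Lemma pf_sc : pf e ebin (fun a => sc K (f a) (V a) (v a)).
Proof. by apply: pf_div; [exact: pf_Dc|exact: pf_Mc]. Qed.

Lemma pf_Pm : pf e ebin (fun a => Pm K (f a) (V a) (i a) (v a)).
Proof. by apply: pf_mul; [exact: pf_Pe|exact: pf_sc]. Qed.

Lemma pf_Cm : pf e ebin (fun a => Cm K (f a) (V a) (r a) (v a)).
Proof.
apply: pf_mul; last exact: pf_sc.
by apply: pf_if; [exact: pf_Cb|exact: pf_Rr|go].
Qed.

End LPPoly3.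

Section SolPoly.
Local Open Scope nat_scope.
Variables (T : Type) (e : T -> tree) (K : nat) (f : T -> inst) (V : T -> nat).
Hypotheses (hf : pf e einst f) (hV : pf e ebin V).

Lemma pf_sol : pf e (eseq elabel) (fun a => sol K (f a) (V a)).
Proof.
apply: (pf2 (F := sol K)) hf hV; rewrite /sol.
apply: (@pf_mw _ _ _ _ _ elabel (eprod eun (eprod eun eun)) elabel
  (fun z => rowsP K z.1) (fun z => rowsC K z.1) (fun z => cols K z.1)
  (fun z => Pm K z.1 z.2) (fun z => Cm K z.1 z.2) K (fun z => Dc K z.1 z.2)
  (fun z => Uc K z.1) (fun z => Tc K z.1)).
- by go.
- by go.
- by go.
- by apply: pf_Pm; go.
- by apply: pf_Cm; go.
- by apply: pf_Dc; go.
- by apply: pf_un; apply: pf_Uc; go.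
- by apply: pf_Tc; go.
Qed.

Variables (h : T -> seq label) (k j : T -> nat).
Hypotheses (hh : pf e (eseq elabel) h) (hk : pf e eun k) (hj : pf e eun j).

Lemma pf_xld : pf e ebin (fun a => xld K (f a) (V a) (h a) (k a) (j a)).
Proof.
have hl X (eX : X -> tree) Y (eY : Y -> tree) (F : T -> X) : pf e eX F -> pf (eprod e eY) eX (fun z => F z.1).
  by move=> hF; exact: (pf_comp hF (pf_fst0 _ _)).
apply: (pf_sum _ hh).
have := hl _ _ _ elabel _ hf; have := hl _ _ _ elabel _ hV.
have := hl _ _ _ elabel _ hk; have := hl _ _ _ elabel _ hj => h1 h2 h3 h4.
by apply: pf_if; [|apply: pf_mul; [apply: pf_Rr|apply: pf_sc]|]; go.
Qed.

Lemma pf_cnt : pf e ebin (fun a => cnt (h a) (k a) (j a)).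
Proof. by apply: (pf3 (F := cnt)) hh hk hj; rewrite /cnt; go. Qed.

End SolPoly.

Section SolPoly2.
Local Open Scope nat_scope.
Variables (T : Type) (e : T -> tree) (K : nat) (f : T -> inst) (c : T -> cand).
Hypotheses (hf : pf e einst f) (hc : pf e ecand c).

Lemma pf_Ob : pf e ebin (fun a => Ob K (f a) (c a).1 (c a).2.1 (c a).2.2).
Proof.
apply: (pf2 (F := fun x c => Ob K x c.1 c.2.1 c.2.2)) hf hc; rewrite /Ob.
apply: pf_sum; last go; apply: pf_mul; first by go.
apply: pf_add; first by go.
apply: pf_sum; last go; apply: pf_if; [|by go|by go].
apply: pf_all; last go; apply: pf_or; first by go.
apply: pf_leq; apply: pf_mul; try go.
- by apply: pf_mul; [apply: pf_un; apply: pf_Uc|apply: pf_Dc]; go.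
- by apply: pf_xld; go.
Qed.

Lemma pf_okc : pf e ebool (fun a => okc K (f a) (c a)).
Proof.
rewrite /okc; apply: pf_leq.
  by apply: pf_mul; [go|exact: pf_Ob].
by go.
Qed.

Lemma pf_output : pf e (eseq (eprod eqcode (eseq eqcode))) (fun a => output K (f a) (c a)).
Proof.
have hr U (eU : U -> tree) a b : pf eU ebin a -> pf eU ebin b ->
    pf eU eqcode (fun u => reduce (a u) (b u)) by move=> ha hb; rewrite /reduce; go.
apply: (pf2 (F := output K)) hf hc; rewrite /output.
apply: pf_map; last go; apply: pf_pair.
  by rewrite /end_num /end_den; apply: hr; go.
apply: pf_map; last go; apply: hr.
  rewrite /rate_num; apply: pf_if; [by go|by go|].
  do 2!(apply: pf_mul; last go); apply: pf_mul; last by apply: pf_Rr; go.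
  by apply: pf_mul; [go|apply: pf_cnt; go].
rewrite /rate_den; apply: pf_if; [by go|by go|].
do 2!(apply: pf_mul; last go); apply: pf_mul; last by apply: pf_Mc; go.
by apply: pf_mul; [go|apply: pf_un; apply: pf_Uc; go].
Qed.

End SolPoly2.

Section AlgoPoly.
Local Open Scope nat_scope.
Variables (T : Type) (e : T -> tree) (K : nat) (f : T -> inst).
Hypotheses (hf : pf e einst f).

Lemma pf_cands : pf e (eseq ecand) (fun a => cands K (f a)).
Proof.
apply: (pf_comp (F := cands K)) hf; rewrite /cands.
apply: pf_flatten; apply: (@pf_map _ _ _ ebin); last first.
  by apply: (@pf_map _ _ _ eun); [go|apply: pf_iota; apply: pf_Hv; go].
apply: (@pf_map _ _ _ ebin); last by go.
by do 2?apply: pf_pair; [go|apply: pf_sol; go|go].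
Qed.

End AlgoPoly.

Lemma pf_best T (e : T -> tree) K f : pf e einst f -> pf e ecand (fun a => best K (f a)).
Proof.
move=> hf; apply: (pf_comp (F := best K)) hf; rewrite /best.
apply: (pf_case (F := fun _ c _ => c) (eX := ecand)); [|by go|by go].
by apply: pf_filter; [apply: pf_okc; go|apply: pf_cands; go].
Qed.

Lemma pf_algo K : pf eraw (eseq (eprod eqcode (eseq eqcode))) (algo K).
Proof.
rewrite /algo; have h := pf_to_inst (pf_id eraw).
by apply: pf_output; [exact: h|apply: pf_best; exact: h].
Qed.

(** * Schedules given by finitely many slots *)

Section Work.
Local Open Scope classical_set_scope.
Variables (R : realType) (f : R -> R).
Hypothesis mf : measurable_fun (`[0, +oo[ : set R) f.
Hypothesis f0 : forall t : R, 0 <= t -> 0 <= f t.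

(** Extended real, because a job outside all packing constraints may receive infinite work in finite
    time; half-open, so that consecutive slots are disjoint. *)
Definition work (a b : R) : \bar R := (\int[lebesgue_measure]_(t in `[a, b[) (f t)%:E)%E.

Lemma work_meas (a : R) b : 0 <= a -> measurable_fun ([set` Interval (BLeft a) b] : set R) (EFin \o f).
Proof.
move=> a0; apply/measurable_EFinP; apply: measurable_funS mf => //.
move=> t /=; rewrite !in_itv /= andbT => /andP[h _]; exact: le_trans h.
Qed.

Lemma work_split a b c : 0 <= a -> a <= b -> b <= c -> (work a c = work a b + work b c)%E.
Proof.
move=> a0 ab bc; rewrite /work (@itv_bndbnd_setU _ _ (BLeft a) (BLeft b) (BLeft c)) ?bnd_simp //.
rewrite ge0_integral_setU //=.
- rewrite -itv_bndbnd_setU ?bnd_simp //; exact: work_meas.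
- move=> t; rewrite lee_fin /= !in_itv /= => -[] /andP[h _]; apply: f0; lra.
- rewrite disj_set2E; apply/eqP; rewrite -subset0 => t /=; rewrite !in_itv /=.
  by move=> [/andP[_ h] /andP[h' _]]; lra.
Qed.

Lemma work_ge0 a b : 0 <= a -> (0 <= work a b)%E.
Proof.
move=> a0; apply: integral_ge0 => t; rewrite /= in_itv /= lee_fin => /andP[h _].
by apply: f0; lra.
Qed.

Lemma work_cc t : 0 <= t ->
  (\int[lebesgue_measure]_(t in `[0%R, t]) (f t)%:E = work 0 t)%E.
Proof. by move=> t0; rewrite /work integral_itv_bndo_bndc //; exact: work_meas. Qed.

Lemma work_cst a b c : a <= b -> (forall t, a <= t -> t < b -> f t = c) ->
  work a b = (c * (b - a))%:E.
Proof.
move=> ab h; rewrite /work (eq_integral (cst c%:E)); last first.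
  by move=> t; rewrite inE /= in_itv /= => /andP[h1 h2]; rewrite h.
rewrite integral_cst //= lebesgue_measure_itv /= lte_fin.
by case: ltgtP ab => // -> _; rewrite subrr mulr0 mule0.
Qed.

Lemma work_le_bound a b M : 0 <= a -> a <= b -> (forall t : R, 0 <= t -> f t <= M) ->
  (work a b <= (M * (b - a))%:E)%E.
Proof.
move=> a0 ab h; have M0 : 0 <= M by apply: le_trans (f0 (lexx 0)) (h 0 (lexx 0)).
have <- : (\int[lebesgue_measure]_(t in `[a, b[) (cst M%:E) t = (M * (b - a))%:E)%E.
  rewrite integral_cst //= lebesgue_measure_itv /= lte_fin.
  by case: ltgtP ab => // -> _; rewrite subrr mulr0 mule0.
apply: ge0_le_integral => //=.
- by move=> t; rewrite in_itv /= lee_fin => /andP[h1 _]; apply: f0; lra.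
- exact: work_meas.
by move=> t; rewrite in_itv /= lee_fin => /andP[h1 _]; apply: h; lra.
Qed.

Lemma work_mono a b c : 0 <= a -> a <= b -> b <= c -> (work a b <= work a c)%E.
Proof. by move=> a0 ab bc; rewrite (work_split a0 ab bc) leeDl // work_ge0 //; lra. Qed.

End Work.

(** * Completion times *)

Section Finished.
Local Open Scope classical_set_scope.
Variables (R : realType) (I : psp) (y : R -> 'rV[R]_(njobs I)) (j : 'I_(njobs I)).
Hypothesis my : measurable_fun (`[0, +oo[ : set R) (fun t : R => y t 0 j).
Hypothesis y0 : forall t : R, 0 <= t -> 0 <= y t 0 j.

Let yj (t : R) : R := y t 0 j.

Lemma finishedP t : 0 <= t ->
  finished y j t <-> ((ratr (proc I 0 j))%:E <= work yj 0%R t)%E.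
Proof.
by move=> t0; rewrite /finished /= (work_cc my t0) t0; split=> // -[].
Qed.

Lemma finished_lb : has_lbound (finished y j).
Proof. by exists 0 => t [h _]. Qed.

Lemma completion_le t : finished y j t -> completion y j <= t.
Proof. by move=> h; apply: ge_inf => //; exact: finished_lb. Qed.

Lemma completion_ge0 t : finished y j t -> 0 <= completion y j.
Proof. by move=> h; apply: lb_le_inf; [exists t|move=> u []]. Qed.

(** Work at rate at most [M] cannot jump: if [p - F] were still missing at the infimum, no time
    within (p - F) / (M + 1) after it would suffice. The successor avoids a division by 0. *)
Lemma completion_attained M t : (forall t : R, 0 <= t -> y t 0 j <= M) ->
  finished y j t -> finished y j (completion y j).
Proof.
move=> hM ht; have c0 := completion_ge0 ht; set c := completion y j in c0 *.
have M0 : 0 <= M by apply: le_trans (y0 (lexx 0)) (hM 0 (lexx 0)).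
apply/finishedP => //; rewrite leNgt; apply/negP => hlt.
have fin : work yj 0 c \is a fin_num.
  rewrite fin_numElt (lt_le_trans _ (work_ge0 y0 _ (lexx 0))) //.
  by apply: lt_trans hlt _; rewrite ltry.
pose F := fine (work yj 0 c).
have FE : work yj 0 c = F%:E by rewrite fineK.
rewrite FE lte_fin in hlt; set p : R := ratr (proc I 0 j) in hlt.
have d0 : 0 < (p - F) / (M + 1) by rewrite divr_gt0 //; lra.
have [u hu uc] := @inf_adherent _ (finished y j) _ d0 (conj (ex_intro _ t ht) finished_lb).
have cu : c <= u := completion_le hu.
have u0 : 0 <= u := le_trans c0 cu.
move/(finishedP u0): (hu); rewrite (work_split my y0 (lexx 0) c0 cu) FE.
apply/negP; rewrite -ltNge.
apply: (@le_lt_trans _ _ (F%:E + (M * (u - c))%:E)%E).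
  by rewrite leeD2l // work_le_bound.
rewrite -EFinD lte_fin -/p.
have hu' : u - c < (p - F) / (M + 1) by rewrite ltrBlDl.
rewrite ltr_pdivlMr in hu'; last by lra.
have uc0 : 0 <= u - c by lra.
by nra.
Qed.

End Finished.

(** * Piecewise constant schedules *)

Section Steps.
Local Open Scope classical_set_scope.
Variables (R : realType) (I : psp) (e : nat -> rat) (v : nat -> 'rV[rat]_(njobs I)) (H : nat).
Hypothesis e0 : e 0%N = 0.
Hypothesis eS : forall k, e k <= e k.+1.

Definition steps a m : explicit_schedule (njobs I) := [seq (e k.+1, v k) | k <- iota a m].

Let q (x : rat) : R := ratr x.

Lemma e_mono j k : (j <= k)%N -> e j <= e k.
Proof.
move=> /subnK <-; elim: (k - j)%N => // n IH.
exact: le_trans IH (eS _).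
Qed.

Lemma e_ge0 k : 0 <= e k.
Proof. by rewrite -e0 e_mono. Qed.

Lemma rates_slot a m k (t : R) : (a <= k < a + m)%N -> q (e k) <= t -> t < q (e k.+1) ->
  rates (steps a m) t = map_mx ratr (v k) :> 'rV[R]_(njobs I).
Proof.
elim: m a => [|m IH] a; first by rewrite addn0; lia.
move=> hk h1 h2 /=; case: ifP => h; last first.
  apply: IH => //; move: hk; rewrite [(a <= k)%N]leq_eqVlt addSnnS => /andP[/orP[/eqP E|->->//]].
  by rewrite E h2 in h.
have ka : (k <= a)%N.
  rewrite leqNgt; apply/negP => ak; have : e a.+1 <= e k by apply: e_mono.
  by rewrite -(ler_rat R) => h3; have := le_lt_trans (le_trans h3 h1) h; rewrite ltxx.
by congr map_mx; congr v; lia.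
Qed.

Lemma rates_cases a m (t : R) : q (e a) <= t ->
  rates (steps a m) t = 0 :> 'rV[R]_(njobs I) \/
  exists k, [/\ (a <= k < a + m)%N, q (e k) <= t & rates (steps a m) t = map_mx ratr (v k) :> 'rV[R]_(njobs I)].
Proof.
elim: m a => [|m IH] a ht; first by left.
rewrite /=; case: ifP => h; first by right; exists a; split=> //; lia.
have [|->|[k [h1 h2 h3]]] := IH a.+1; [by rewrite leNgt h|by left|].
by right; exists k; split=> //; lia.
Qed.

Lemma rates_measurable (s : explicit_schedule (njobs I)) j :
  measurable_fun (`[0, +oo[ : set R) (fun t : R => (rates s t : 'rV[R]_(njobs I)) 0 j).
Proof.
apply: (@measurable_funS _ _ _ _ setT) => //.
elim: s => [|[d w] s IH] /=.
  by rewrite (_ : (fun _ => _) = cst 0) //; apply/funext => t; rewrite mxE.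
rewrite (_ : (fun _ => _) = (fun t : R => if t < q d then (map_mx ratr w : 'rV[R]_(njobs I)) 0 j
    else (rates s t : 'rV[R]_(njobs I)) 0 j)); last by apply/funext => t; case: ifP.
by apply: measurable_fun_ifT => //; apply: measurable_fun_ltr.
Qed.

Let s := steps 0 H.
Let y (t : R) : 'rV[R]_(njobs I) := rates s t.

Hypothesis v0 : forall k j, (k < H)%N -> 0 <= v k 0 j.
Hypothesis vP : forall k d, (k < H)%N -> \sum_j pack I d j * v k 0 j <= 1.
Hypothesis vR : forall k j, (k < H)%N -> v k 0 j != 0 -> release I 0 j <= e k.
Hypothesis vF : forall j, proc I 0 j <= \sum_(k < H) v k 0 j * (e k.+1 - e k).

Lemma y_cases (t : R) : 0 <= t -> y t = 0 \/
  exists k, [/\ (k < H)%N, q (e k) <= t & y t = map_mx ratr (v k)].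
Proof.
move=> t0; have [|h|[k [h1 h2 h3]]] := @rates_cases 0 H t; [by rewrite e0 /q rmorph0|by left|].
by right; exists k.
Qed.

Lemma y_ge0 (t : R) j : 0 <= t -> 0 <= y t 0 j.
Proof.
move/y_cases => [->|[k [h1 _ ->]]]; first by rewrite mxE.
by rewrite mxE ler0q v0.
Qed.

Let yj j (t : R) : R := y t 0 j.

Lemma work_steps j m : (m <= H)%N ->
  (q (\sum_(k < m) v k 0 j * (e k.+1 - e k))%R)%:E = work (yj j) 0%R (q (e m)).
Proof.
elim: m => [|m IH] hm.
  rewrite big_ord0 e0 /q rmorph0 (@work_cst _ _ _ _ 0) ?mul0r // => t h1 h2.
  by move: (le_lt_trans h1 h2); rewrite ltxx.
have q0 k : 0 <= q (e k) by rewrite ler0q e_ge0.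
have qm : q (e m) <= q (e m.+1) by rewrite ler_rat.
rewrite (@work_split R _ (rates_measurable s j) _ 0 (q (e m))) //; last by move=> t; exact: y_ge0.
rewrite -IH 1?ltnW // (@work_cst _ _ (q (e m)) _ (q (v m 0 j))) //.
  by rewrite -EFinD big_ord_recr /= /q rmorphD rmorphM rmorphB.
by move=> t h1 h2; rewrite /y (@rates_slot 0 H m) ?mxE.
Qed.

Lemma steps_finished j m : (m <= H)%N -> proc I 0 j <= \sum_(k < m) v k 0 j * (e k.+1 - e k) ->
  finished y j (q (e m)).
Proof.
move=> hm hp; apply/finishedP.
- exact: rates_measurable.
- by rewrite ler0q e_ge0.
by rewrite -work_steps // lee_fin ler_rat.
Qed.

Lemma steps_feasible : feasible y.
Proof.
split.
- by move=> j; exact: rates_measurable.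
- move=> t t0; split; first by move=> j; exact: y_ge0.
  move=> d; case: (y_cases t0) => [->|[k [h1 _ ->]]].
    by rewrite big1 ?ler01 // => j _; rewrite mxE mulr0.
  rewrite -(rmorph1 (ratr : rat -> R)) (eq_bigr (fun j => ratr (pack I d j * v k 0 j))).
    by rewrite -rmorph_sum ler_rat vP.
  by move=> j _; rewrite mxE rmorphM.
- move=> t j t0; case: (y_cases t0) => [->|[k [h1 h2 ->]]] ht; first by rewrite mxE.
  rewrite mxE; have [->|/(vR h1)] := eqVneq (v k 0 j) 0; first by rewrite rmorph0.
  rewrite -(ler_rat R) => h3; have := lt_le_trans ht (le_trans h3 h2).
  by rewrite ltxx.
move=> j; have hf := steps_finished (leqnn H) (vF j).
apply: (@completion_attained _ _ y j (rates_measurable s j) _ (\sum_(k < H) q (v k 0 j))) hf.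
  by move=> t; exact: y_ge0.
move=> t; case/y_cases => [->|[k [h1 _ ->]]].
  by rewrite mxE sumr_ge0 // => k _; rewrite ler0q v0.
rewrite mxE (bigD1 (Ordinal h1)) //= lerDl sumr_ge0 // => i _.
by rewrite ler0q v0.
Qed.

Lemma steps_completion j m : (m <= H)%N -> proc I 0 j <= \sum_(k < m) v k 0 j * (e k.+1 - e k) ->
  completion y j <= q (e m).
Proof. by move=> hm hp; apply: completion_le; exact: steps_finished. Qed.

End Steps.

(** * Encoding of instances and schedules *)

Definition qcode_of (a : rat) : qcode := (a < 0, (`|numq a|%N, `|denq a|%N)).

Lemma qcode_ofE a : enc_rat a = eqcode (qcode_of a).
Proof. by []. Qed.

Lemma eseq_map (A B : Type) (f : A -> B) (e : B -> tree) (e' : A -> tree) (l : seq A) :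
  (forall x, e' x = e (f x)) -> enc_seq e' l = eseq e (map f l).
Proof. by move=> h; elim: l => //= x l ->; rewrite h. Qed.

Definition raw_of (I : psp) : raw :=
  ([seq qcode_of (proc I 0 j) | j <- enum 'I_(njobs I)],
   ([seq qcode_of (release I 0 j) | j <- enum 'I_(njobs I)],
    ([seq [seq qcode_of (pack I d j) | j <- enum 'I_(njobs I)] | d <- enum 'I_(nrows I)],
     [seq ([seq j \in g.1 | j <- enum 'I_(njobs I)], qcode_of g.2) | g : {set 'I_(njobs I)} * rat <- groups I]))).

Lemma raw_ofE I : enc_psp I = eraw (raw_of I).
Proof.
rewrite /enc_psp /eraw /raw_of /eprod /=; congr Node.
  exact: eseq_map.
congr Node; first exact: eseq_map.
congr Node; apply: eseq_map => x.
  by apply: eseq_map => j; rewrite mxE.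
by rewrite /eprod /=; congr Node; exact: eseq_map.
Qed.

Lemma qcode_of_reduce a b : (0 < b)%N -> qcode_of (a%:R / b%:R) = reduce a b.
Proof.
move=> b0; set g := gcdn a b.
have g0 : (0 < g)%N by rewrite gcdn_gt0 b0 orbT.
have ga : (a = a %/ g * g)%N by rewrite divnK // dvdn_gcdl.
have gb : (b = b %/ g * g)%N by rewrite divnK // dvdn_gcdr.
have b'0 : (0 < b %/ g)%N by rewrite divn_gt0 // dvdn_leq // dvdn_gcdr.
have co : coprime (a %/ g) (b %/ g).
  rewrite /coprime -(eqn_pmul2r g0) muln_gcdl mul1n -ga -gb.
  by [].
have -> : (a%:R / b%:R : rat) = (a %/ g)%N%:R / (b %/ g)%N%:R.
  rewrite {1}ga {1}gb !natrM -mulf_div divff ?mulr1 // pnatr_eq0; lia.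
rewrite /qcode_of /reduce -/g.
have num : numq ((a %/ g)%N%:R / (b %/ g)%N%:R) = (a %/ g)%N.
  by rewrite !pmulrn coprimeq_num // gtr0_sg ?mul1r // ltz_nat.
have den : denq ((a %/ g)%N%:R / (b %/ g)%N%:R) = (b %/ g)%N.
  by rewrite !pmulrn coprimeq_den //; case: eqP => // E; move: b'0; rewrite -ltz_nat E ltxx.
rewrite num den; congr (_, (_, _)).
by apply/negbTE; rewrite -leNgt divr_ge0 ?ler0n.
Qed.

Lemma dvdn_dens l q : q \in l -> (q.2.2 %| dens l)%N.
Proof. by move=> h; rewrite /dens (big_rem q) //= dvdn_mulr. Qed.

Lemma qcode_den_gt0 a : (0 < (qcode_of a).2.2)%N.
Proof. by rewrite /= absz_gt0. Qed.

Lemma scaleE (D : nat) a : 0 <= a -> (0 < D)%N -> ((qcode_of a).2.2 %| D)%N ->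
  a = (scale D (qcode_of a))%:R / D%:R.
Proof.
move=> a0 D0 /dvdnP[c E]; rewrite /scale E mulnK ?qcode_den_gt0 //.
rewrite E muln_gt0 in D0; case/andP: D0 => c0 d0.
rewrite !natrM /= [_ * c%:R]mulrC -mulf_div divff ?mul1r; last by rewrite pnatr_eq0; lia.
by rewrite -{1}[a]divq_num_den !pmulrn !gez0_abs ?numq_ge0.
Qed.

Definition dflt_group (n : nat) : {set 'I_n} * rat := (finset.set0, 0).

Record represents (I : psp) (x : inst) : Prop := Represents {
  rep_J : nJ x = njobs I;
  rep_D : nD x = nrows I;
  rep_G : nG x = size (groups I);
  rep_den : (0 < Den x)%N;
  rep_p : forall j : 'I_(njobs I), proc I 0 j = (Pj x j)%:R / (Den x)%:R;
  rep_r : forall j : 'I_(njobs I), release I 0 j = (Rj x j)%:R / (Den x)%:R;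
  rep_b : forall (d : 'I_(nrows I)) (j : 'I_(njobs I)), pack I d j = (Bdj x d j)%:R / (Den x)%:R;
  rep_w : forall g, (g < size (groups I))%N ->
    (nth (dflt_group (njobs I)) (groups I) g).2 = (Wg x g)%:R / (Den x)%:R;
  rep_S : forall g (j : 'I_(njobs I)), (g < size (groups I))%N ->
    Sg x g j = (j \in (nth (dflt_group (njobs I)) (groups I) g).1)
}.

Lemma to_instP I : psp_wf I -> represents I (to_inst (raw_of I)).
Proof.
case=> p0 r0 b0 _ w0; set x := raw_of I; set D := common_den x.
have gt0 (l : seq qcode) : (forall q, q \in l -> 0 < q.2.2)%N -> (0 < dens l)%N.
  by move=> h; rewrite /dens big_seq prodn_cond_gt0.
have gtf (A : eqType) (f : A -> rat) (l : seq A) : (0 < dens [seq qcode_of (f j) | j <- l])%N.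
  by apply: gt0 => q /mapP[j _ ->]; exact: qcode_den_gt0.
have D0 : (0 < D)%N.
  rewrite !muln_gt0 !gtf /= big_map prodn_gt0 /=; last by move=> d; exact: gtf.
  by rewrite big_map prodn_gt0 // => g; exact: qcode_den_gt0.
have nthE (A : Type) (F : 'I_(njobs I) -> A) d (j : 'I_(njobs I)) :
    nth d [seq F j | j <- enum 'I_(njobs I)] j = F j.
  by rewrite (nth_map j) ?size_enum_ord ?ltn_ord // nth_ord_enum.
split.
- by rewrite -[RHS]size_enum_ord /nJ /= !size_map.
- by rewrite -[RHS]size_enum_ord /nD /= !size_map.
- by rewrite /nG /= !size_map.
- exact: D0.
- move=> j; rewrite /Pj /= -map_comp nthE /= -/x -/D; apply: scaleE => //.
  apply: dvdn_mulr; apply: dvdn_dens; apply: map_f; exact: mem_enum.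
- move=> j; rewrite /Rj /= -map_comp nthE /= -/x -/D; apply: scaleE => //.
  apply: dvdn_mull; apply: dvdn_mulr; apply: dvdn_dens; apply: map_f; exact: mem_enum.
- move=> d j; rewrite /Bdj /= -map_comp (nth_map d) ?size_enum_ord // nth_ord_enum /=.
  rewrite -map_comp nthE /= -/x -/D; apply: scaleE => //.
  apply: dvdn_mull; apply: dvdn_mull; apply: dvdn_mulr.
  rewrite /= big_map (bigD1_seq d) ?mem_enum ?enum_uniq //=.
  by apply: dvdn_mulr; apply: (@dvdn_dens _ (qcode_of (pack I d j))); apply: map_f; exact: mem_enum.
- move=> g hg; rewrite /Wg /= -map_comp (nth_map (dflt_group (njobs I))) //= -/x -/D.
  apply: scaleE => //; first by apply/ltW/w0; exact: mem_nth.
  do 3!apply: dvdn_mull; rewrite /= big_map (big_nth (dflt_group (njobs I))) big_mkord.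
  by rewrite (bigD1 (Ordinal hg)) //= dvdn_mulr.
- move=> g j hg; rewrite /Sg /= -map_comp (nth_map (dflt_group (njobs I))) //=.
  by rewrite (nth_map j) ?size_enum_ord ?ltn_ord // nth_ord_enum.
Qed.

(** * From fractions of jobs per slot to a schedule *)

Section Slots.
Variables (R : realType) (I : psp) (K Z H i : nat) (X : nat -> nat -> rat).
Hypotheses (K0 : (0 < K)%N) (Z0 : (0 < Z)%N) (i0 : (0 < i <= K.+1)%N).
Hypothesis p0 : forall j, 0 <= proc I 0 j.
Hypothesis X0 : forall k j, (k <= H)%N -> 0 <= X k j.
Hypothesis XP : forall k d, (k <= H)%N ->
  K%:R * Z%:R * \sum_j pack I d j * (proc I 0 j * X k j) <= (K + 5)%:R * (lg K k)%:R.
Hypothesis XR : forall k j, (k <= H)%N -> X k (val j) != 0 -> release I 0 j * Z%:R <= (tg K k)%:R.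
Hypothesis XH : forall j : 'I_(njobs I), X H j = 1.

(** Time is stretched by (K + 5) / K, with rates lowered accordingly to absorb the overload of the
    packing rows, and by (K + 1) / i with rates kept, so that each slot processes (K + 1) / i times
    its share. *)
Definition slot_end k : rat := ((K + 5) * (K + 1) * tg K k)%:R / (K * i * Z)%:R.
Definition slot_rate k : 'rV[rat]_(njobs I) :=
  \row_j (proc I 0 j * X k j * (Z * K)%:R / ((K + 5) * lg K k)%:R).

Lemma slot_end0 : slot_end 0 = 0.
Proof. by rewrite /slot_end /tg /= muln0 mul0r. Qed.

Lemma slot_endS k : slot_end k.+1 - slot_end k = ((K + 5) * (K + 1) * lg K k)%:R / (K * i * Z)%:R.
Proof.
rewrite /slot_end -mulrBl; congr (_ / _).
have -> : tg K k.+1 = (tg K k + lg K k)%N by [].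
by rewrite mulnDr natrD addrAC subrr add0r.
Qed.

Lemma slot_end_le k : slot_end k <= slot_end k.+1.
Proof. by rewrite -subr_ge0 slot_endS divr_ge0 ?ler0n. Qed.

Let KQ : 0 < K%:R :> rat. Proof. by rewrite ltr0n. Qed.
Let ZQ : 0 < Z%:R :> rat. Proof. by rewrite ltr0n. Qed.
Let iQ : 0 < i%:R :> rat. Proof. by rewrite ltr0n; case/andP: i0. Qed.
Let lQ k : 0 < (lg K k)%:R :> rat. Proof. by rewrite ltr0n. Qed.

Lemma slot_amount k j :
  slot_rate k 0 j * (slot_end k.+1 - slot_end k) = proc I 0 j * X k j * ((K + 1)%:R / i%:R).
Proof.
have K5 : 0 < K%:R + 5 :> rat by have := KQ; lra.
have [kq zq iq lq] := And4 KQ ZQ iQ (lQ k).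
by rewrite slot_endS mxE !natrM; field; rewrite !gt_eqF.
Qed.

Lemma slot_sum m j :
  \sum_(k < m) slot_rate k 0 j * (slot_end k.+1 - slot_end k) =
  proc I 0 j * ((K + 1)%:R / i%:R * \sum_(k < m) X k j).
Proof.
rewrite mulrA mulr_sumr; apply: eq_bigr => k _; rewrite slot_amount; ring.
Qed.

Lemma slot_done m j : proc I 0 j = 0 \/ i%:R <= (K + 1)%:R * \sum_(k < m) X k j ->
  proc I 0 j <= \sum_(k < m) slot_rate k 0 j * (slot_end k.+1 - slot_end k).
Proof.
rewrite slot_sum => -[->|h]; first by rewrite mul0r.
by rewrite ler_peMr // mulrAC ler_pdivlMr // mul1r.
Qed.

Definition slots : explicit_schedule (njobs I) := steps slot_end slot_rate 0 H.+1.
Let y : R -> 'rV[R]_(njobs I) := rates slots.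

Lemma slot_rate_ge0 k j : (k < H.+1)%N -> 0 <= slot_rate k 0 j.
Proof. by move=> hk; rewrite mxE divr_ge0 ?mulr_ge0 ?ler0n ?X0. Qed.

Lemma slots_props :
  feasible y /\ forall j m, (m <= H.+1)%N ->
    proc I 0 j = 0 \/ i%:R <= (K + 1)%:R * \sum_(k < m) X k j ->
    completion y j <= ratr (slot_end m).
Proof.
have hP k d : (k < H.+1)%N -> \sum_j pack I d j * slot_rate k 0 j <= 1.
  move=> hk; have := XP d hk => h.
  have -> : \sum_j pack I d j * slot_rate k 0 j =
      K%:R * Z%:R * (\sum_j pack I d j * (proc I 0 j * X k j)) / ((K + 5)%:R * (lg K k)%:R).
    rewrite mulr_sumr mulr_suml; apply: eq_bigr => j _; rewrite mxE !natrM; ring.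
  by rewrite ler_pdivrMr ?mul1r // mulr_gt0 // ltr0n addnC.
(* Since K i <= (K + 5)(K + 1), stretching only moves slots later and respects the release dates. *)
have hR k j : (k < H.+1)%N -> slot_rate k 0 j != 0 -> release I 0 j <= slot_end k.
  move=> hk; rewrite mxE => h; have Xn : X k j != 0.
    by apply: contraNneq h => ->; rewrite mulr0 !mul0r.
  have := XR hk Xn; rewrite -ler_pdivlMr // => /le_trans; apply.
  rewrite /slot_end !natrM -subr_ge0.
  have -> : (K + 5)%:R * (K + 1)%:R * (tg K k)%:R / (K%:R * i%:R * Z%:R) - (tg K k)%:R / Z%:R
    = (tg K k)%:R / Z%:R * (((K + 5)%:R * (K + 1)%:R - K%:R * i%:R) / (K%:R * i%:R)) :> rat.
    by have [kq zq iq] := And3 KQ ZQ iQ; field; rewrite !gt_eqF.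
  rewrite mulr_ge0 ?divr_ge0 ?ler0n // ?mulr_ge0 ?ler0n // subr_ge0 -!natrM ler_nat.
  by apply: leq_mul; [exact: leq_addr|case/andP: i0; rewrite addn1].
have hF j : proc I 0 j <= \sum_(k < H.+1) slot_rate k 0 j * (slot_end k.+1 - slot_end k).
  apply: slot_done; right; rewrite big_ord_recr /= XH.
  have : 0 <= \sum_(k < H) X k j by rewrite sumr_ge0 // => k _; rewrite X0 // ltnW.
  have : i%:R <= (K + 1)%:R :> rat by rewrite ler_nat addn1; case/andP: i0.
  move=> h1 h2; apply: le_trans h1 _; rewrite ler_peMr ?ler0n //; lra.
have h := steps_feasible R slot_end0 slot_end_le slot_rate_ge0 hP hR hF.
split; first exact: h.
move=> j m hm hd; apply: (steps_completion R slot_end0 slot_end_le slot_rate_ge0 hm).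
exact: slot_done.
Qed.

End Slots.

(** * Bounds on the objective and the optimum *)

Section Objective.
Variables (R : realType) (I : psp).
Hypothesis wf : psp_wf I.
Let g0 := dflt_group (njobs I).

Lemma objectiveE (y : R -> 'rV[R]_(njobs I)) :
  objective y = \sum_(g <- iota 0 (size (groups I)))
     ratr (nth g0 (groups I) g).2 * group_completion y (nth g0 (groups I) g).1.
Proof. by rewrite /objective (big_nth g0) /index_iota subn0. Qed.

Lemma group_completion_le (y : R -> 'rV[R]_(njobs I)) (S : {set 'I_(njobs I)}) c :
  0 <= c -> (forall j, j \in S -> completion y j <= c) -> group_completion y S <= c.
Proof.
move=> c0 h; rewrite /group_completion; elim/big_ind: _ => // a b ha hb.
by rewrite ge_max ha hb.
Qed.

Lemma completion_le_group (y : R -> 'rV[R]_(njobs I)) (S : {set 'I_(njobs I)}) j :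
  j \in S -> completion y j <= group_completion y S.
Proof. by move=> h; rewrite /group_completion (bigD1 j) //= le_max lexx. Qed.

Lemma group_completion_ge0 (y : R -> 'rV[R]_(njobs I)) (S : {set 'I_(njobs I)}) :
  0 <= group_completion y S.
Proof.
rewrite /group_completion; elim/big_rec: _ => // j c _ c0.
by rewrite le_max c0 orbT.
Qed.

Lemma weight_gt0 g : (g < size (groups I))%N -> 0 < (nth g0 (groups I) g).2.
Proof. by case: wf => _ _ _ _ h hg; apply/h/mem_nth. Qed.

Lemma objective_ge0 (y : R -> 'rV[R]_(njobs I)) : 0 <= objective y.
Proof.
rewrite objectiveE big_seq sumr_ge0 // => g; rewrite mem_iota add0n => hg.
by rewrite mulr_ge0 ?group_completion_ge0 // ler0q ltW // weight_gt0.
Qed.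

Lemma objective_le (y : R -> 'rV[R]_(njobs I)) (c : nat -> R) :
  (forall g, (g < size (groups I))%N -> 0 <= c g) ->
  (forall g j, (g < size (groups I))%N -> j \in (nth g0 (groups I) g).1 -> completion y j <= c g) ->
  objective y <= \sum_(g <- iota 0 (size (groups I))) ratr (nth g0 (groups I) g).2 * c g.
Proof.
move=> c0 h; rewrite objectiveE big_seq [leRHS]big_seq.
apply: ler_sum => g; rewrite mem_iota add0n => hg.
apply: ler_wpM2l; first by rewrite ler0q ltW // weight_gt0.
by apply: group_completion_le => [|j]; [exact: c0|exact: h].
Qed.

Lemma optimum_le (y : R -> 'rV[R]_(njobs I)) : feasible y -> optimum R I <= objective y.
Proof.
move=> fy; apply: ge_inf; last by exists y.
by exists 0 => _ [z _ <-]; exact: objective_ge0.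
Qed.

Lemma optimum_ge0 (y : R -> 'rV[R]_(njobs I)) : feasible y -> 0 <= optimum R I.
Proof.
move=> fy; apply: lb_le_inf; first by exists (objective y); exists y.
by move=> _ [z _ <-]; exact: objective_ge0.
Qed.

Lemma optimum_approx (y : R -> 'rV[R]_(njobs I)) d : feasible y -> 0 < d ->
  exists2 z : R -> 'rV[R]_(njobs I), feasible z & objective z < optimum R I + d.
Proof.
move=> fy d0.
have [|_ [z fz <-] hz] := @inf_adherent _ [set objective y | y in @feasible R I]%classic _ d0.
  split; first by exists (objective y); exists y.
  by exists 0 => _ [z _ <-]; exact: objective_ge0.
by exists z.
Qed.

End Objective.

(** * The geometric time grid *)

Section Grid.
Local Open Scope nat_scope.
Variable K : nat.
Hypothesis K0 : 0 < K.

Lemma tgS k : tg K k.+1 = tg K k + lg K k.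
Proof. by []. Qed.

Lemma tg_mono j k : j <= k -> tg K j <= tg K k.
Proof. by move=> /subnK <-; elim: (k - j) => // n IH; rewrite addSn tgS (leq_trans IH) // leq_addr. Qed.

Lemma lg_mono j k : j <= k -> lg K j <= lg K k.
Proof. by move=> h; rewrite /lg ltnS leq_div2r // tg_mono. Qed.

Lemma tg_add k n : tg K k + n * lg K k <= tg K (k + n).
Proof.
elim: n => [|n IH]; first by rewrite !addn0.
by rewrite addnS tgS mulSn addnCA addnC leq_add // lg_mono // leq_addr.
Qed.

(** Each of the [K] slots from [k] on is longer than [tg K k] divided by [K]. *)
Lemma tg_double k : (tg K k).*2 < tg K (k + K).
Proof.
apply: leq_trans (tg_add k K); rewrite -addnn -addnS leq_add2l /lg mulnC.
exact: ltn_ceil.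
Qed.

Lemma tg_large n : n <= tg K (K * bl n).
Proof.
suff h m : 2 ^ m <= (tg K (K * m)).+1 by have := h (bl n); have := bl_lt n; lia.
elim: m => [|m IH]; first by rewrite muln0.
by rewrite mulnS addnC expnS; have := tg_double (K * m); lia.
Qed.

Lemma sum_lg m : tg K m.+1 = 1 + \sum_(k <- iota 0 m) lg K k.+1.
Proof.
elim: m => [|m IH]; first by rewrite big_nil /tg /= div0n.
have -> : iota 0 m.+1 = iota 0 m ++ [:: m] by rewrite -(addn1 m) iotaD add0n.
by rewrite tgS IH big_cat big_seq1 addnA.
Qed.

Lemma lg_le_tg k : tg K k <= K * lg K k.
Proof. by rewrite /lg mulnC ltnW // ltn_ceil. Qed.

End Grid.

(** * Feasibility and cost of the schedule of a candidate *)

Section Sound.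
Variables (R : realType) (I : psp) (x : inst) (K : nat).
Hypotheses (wf : psp_wf I) (hx : represents I x) (hK : (4 <= K)%N).

Let K0 : (0 < K)%N. Proof. by lia. Qed.
Let n := njobs I.
Let H := Hor K x.
Let g0 := dflt_group n.

Lemma cols_true k j : (true, (k, j)) \in cols K x ->
  [/\ (k < H)%N, (j < n)%N & (Rj x j * Zt K x <= tg K k * Den x)%N].
Proof.
rewrite mem_cat => /orP[/flatten_mapP[k' hk' /mapP[j' + [-> ->]]]|].
  rewrite mem_filter !mem_iota !add0n (rep_J hx) => /andP[h hj].
  by rewrite mem_iota add0n in hk'.
by case/flatten_mapP => k' _ /mapP[].
Qed.

Lemma cols_false k g : (false, (k, g)) \in cols K x -> (k < H)%N /\ (g < nG x)%N.
Proof.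
rewrite mem_cat => /orP[/flatten_mapP[k' hk' /mapP[//]]|].
by case/flatten_mapP => k' hk /mapP[g' + [-> ->]]; rewrite !mem_iota in hk *.
Qed.

Lemma rowsP_mem k d : (k < H)%N -> (d < nD x)%N -> (true, (k, d)) \in rowsP K x.
Proof.
move=> hk hd; rewrite inE; apply/orP; right; apply/flatten_mapP.
exists k; first by rewrite mem_iota.
by apply/mapP; exists d => //; rewrite mem_iota.
Qed.

Lemma Lp_gt0 : (0 < Lp K x)%N.
Proof. by rewrite /Lp prodn_gt0. Qed.

Lemma lg_dvd k : (k < H)%N -> (Lp K x %/ lg K k * lg K k = Lp K x)%N.
Proof.
move=> hk; rewrite divnK // /Lp (bigD1_seq k) ?mem_iota ?iota_uniq //=.
exact: dvdn_mulr.
Qed.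

Lemma Uc_gt0 : (0 < Uc K x)%N.
Proof. by rewrite /Uc /rowsP /= !muln_gt0 addSn; lia. Qed.

Lemma Zt_gt0 : (0 < Zt K x)%N.
Proof. by rewrite /Zt !muln_gt0 !(rep_den hx) addn1; lia. Qed.

Lemma iota_ord (T : nmodType) (F : nat -> T) m : \sum_(j <- iota 0 m) F j = \sum_(j < m) F j.
Proof. by rewrite -(big_mkord predT) /index_iota subn0. Qed.

Lemma last_slot_pack Z m (d : 'I_(nrows I)) : (K * Z * Tot x <= tg K m)%N ->
  K%:R * Z%:R * \sum_j pack I d j * proc I 0 j <= (K + 5)%:R * (lg K m)%:R.
Proof.
move=> hm; apply: (@le_trans _ _ (lg K m * K)%:R); last by rewrite -natrM ler_nat mulnC leq_mul2r leq_addr orbT.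
apply: (@le_trans _ _ (K * Z * Tot x)%:R); last first.
  by rewrite ler_nat [(lg K m * K)%N]mulnC; exact: leq_trans hm (lg_le_tg K0 m).
rewrite [leRHS]natrM [(K * Z)%:R]natrM; apply: ler_wpM2l; first by rewrite mulr_ge0 ?ler0n.
rewrite /Tot natrD; apply: ler_wpDl; first exact: ler0n.
rewrite natr_sum iota_ord (rep_D hx) (bigD1 d) //=.
apply: ler_wpDr; first by rewrite sumr_ge0 // => *; exact: ler0n.
rewrite natr_sum iota_ord (rep_J hx); apply: ler_sum => j _.
rewrite (rep_b hx) (rep_p hx) mulf_div -!natrM ler_pdivrMr ?ltr0n ?muln_gt0 ?(rep_den hx) //.
by rewrite -natrM ler_nat leq_pmulr // muln_gt0 (rep_den hx).
Qed.

Lemma last_slot_release Z m (j : 'I_n) : (K * Z * Tot x <= tg K m)%N ->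
  release I 0 j * Z%:R <= (tg K m)%:R.
Proof.
move=> hm; have DQ : 0 < (Den x)%:R :> rat by rewrite ltr0n (rep_den hx).
rewrite (rep_r hx) mulrAC -natrM ler_pdivrMr // -natrM ler_nat.
apply: (@leq_trans (tg K m)); last by rewrite leq_pmulr // (rep_den hx).
apply: leq_trans hm; rewrite [(Rj x j * Z)%N]mulnC; apply: leq_mul; first by rewrite leq_pmull.
apply: leq_trans (leq_addr _ _); rewrite (rep_J hx).
by rewrite (bigD1_seq (val j)) ?mem_iota ?iota_uniq //= leq_addr.
Qed.

Section WithV.
Variable V : nat.
Hypothesis V0 : (0 < V)%N.

Lemma Rr_gt0 : (0 < Rr K x V)%N.
Proof. by rewrite /Rr !muln_gt0 (rep_den hx) V0 Lp_gt0. Qed.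

Lemma Mc_gt0 v : (0 < Mc K x V v)%N.
Proof. by rewrite /Mc leq_max Rr_gt0. Qed.

Lemma Dc_gt0 : (0 < Dc K x V)%N.
Proof. by rewrite /Dc prodn_gt0 // => v; exact: Mc_gt0. Qed.

Lemma scE v : v \in cols K x -> (sc K x V v * Mc K x V v = Dc K x V)%N.
Proof.
move=> hv; rewrite /sc divnK // /Dc (big_rem v) //=; exact: dvdn_mulr.
Qed.

Lemma scQ v : v \in cols K x -> (sc K x V v)%:R = (Dc K x V)%:R / (Mc K x V v)%:R :> rat.
Proof.
by move=> hv; rewrite -(scE hv) natrM mulfK // pnatr_eq0 -lt0n Mc_gt0.
Qed.

Lemma RrE : Rr K x V = (Den x * Den x * V * Lp K x)%N.
Proof. by []. Qed.

Variable h : seq label.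
Hypothesis hh : {subset h <= cols K x}.

Lemma cnt_eq0 k j : (true, (k, j)) \notin cols K x -> cnt h k j = 0%N.
Proof.
move=> hn; rewrite /cnt big_seq big1 // => -[b [k' j']] hv /=.
case: ifP => // /andP[hb /andP[/eqP Ek /eqP Ej]].
by move: (hh hv); rewrite hb Ek Ej (negPf hn).
Qed.

Lemma sum_label_row (G : nat -> nat) k :
  (\sum_(v <- h) (if v.1 && (k == v.2.1) then G v.2.2 else 0) =
   \sum_(j <- iota 0 n) cnt h k j * G j)%N.
Proof.
under [RHS]eq_bigr do rewrite /cnt big_distrl.
rewrite exchange_big /= big_seq [RHS]big_seq; apply: eq_bigr => -[[] [k' j']] /hh hv /=; last first.
  by rewrite big1.
have [_ hj _] := cols_true hv.
rewrite eq_sym; case: eqP => _ /=; last by rewrite big1.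
rewrite (bigD1_seq j') ?mem_iota ?iota_uniq //= eqxx mul1n big1 ?addn0 // => j.
by rewrite eq_sym => /negPf ->.
Qed.

Lemma sum_label_col (G : nat -> nat) k j :
  (\sum_(v <- h) (if v.1 && ((v.2.1 <= k) && (v.2.2 == j)) then G v.2.1 else 0) =
   \sum_(k' <- iota 0 k.+1) cnt h k' j * G k')%N.
Proof.
move: (mem_iota 0 k.+1) (iota_uniq 0 k.+1); move: (iota 0 k.+1) => l hl ul.
under [RHS]eq_bigr do rewrite /cnt big_distrl.
rewrite exchange_big /=; apply: eq_bigr => -[[] [k' j']] _ /=; last by rewrite big1.
case: (j' =P j) => _; last by rewrite big1 ?andbF // => k'' _; rewrite andbF.
rewrite !andbT; case: leqP => hk.
  rewrite (bigD1_seq k') ?hl ?add0n ?ltnS ?hk //= eqxx mul1n big1 ?addn0 // => k''.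
  by rewrite eq_sym => /negPf ->.
rewrite big_seq big1 // => k''; rewrite hl add0n => hk''.
by rewrite andbT; case: eqP => // E; lia.
Qed.

(** The load of column (k, j) divided by U D, so that a covering load of U D becomes 1. The last
    slot receives every job entirely, whatever the solution, which makes all candidates feasible. *)
Definition Xc k j : rat :=
  if k == H then 1 else (cnt h k j * Rr K x V)%:R / (Uc K x * Mc K x V (true, (k, j)))%:R.

Let UDQ : 0 < (Uc K x * Dc K x V)%:R :> rat.
Proof. by rewrite ltr0n muln_gt0 Uc_gt0 Dc_gt0. Qed.

Lemma XcE k j : (k < H)%N ->
  Xc k j = (cnt h k j * (Rr K x V * sc K x V (true, (k, j))))%:R / (Uc K x * Dc K x V)%:R.
Proof.
move=> hk; rewrite /Xc ltn_eqF //.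
have [hv|hv] := boolP ((true, (k, j)) \in cols K x); last by rewrite cnt_eq0 // !mul0n !mul0r.
move: (scQ hv) Uc_gt0 Dc_gt0 (Mc_gt0 (true, (k, j))).
move: (Uc K x) (Dc K x V) (Mc _ _ _ _) (sc _ _ _ _) (Rr K x V) => u d m s r hs u0 d0 m0.
by rewrite !natrM hs; field; rewrite !pnatr_eq0 -!lt0n u0 d0 m0.
Qed.

Lemma xld_sum k j : (k < H)%N ->
  (xld K x V h k j)%:R = (Uc K x * Dc K x V)%:R * \sum_(k' < k.+1) Xc k' j.
Proof.
move=> hk; rewrite /xld.
rewrite (_ : (\sum_(v <- h) _)%N = (\sum_(v <- h) (if v.1 && ((v.2.1 <= k) && (v.2.2 == j)) then
   Rr K x V * sc K x V (true, (v.2.1, j)) else 0))%N); last first.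
  apply: eq_bigr => -[[] [k' j']] _ //=.
  by case: (j' =P j) => [->|]; rewrite ?andbF.
rewrite (sum_label_col (fun k' => Rr K x V * sc K x V (true, (k', j)))%N) natr_sum.
rewrite mulr_sumr -(big_mkord predT (fun k' => _ * Xc k' j)) /index_iota subn0.
rewrite big_seq [RHS]big_seq; apply: eq_bigr => k'; rewrite mem_iota add0n => hk'.
rewrite XcE; last by lia.
by move: UDQ; move: (Uc K x * Dc K x V)%N => u u0; rewrite mulrC divfK // gt_eqF.
Qed.

Hypothesis hload : forall r, r \in rowsP K x ->
  (K * load (Pm K x V) h r <= (K + 5) * (Uc K x * Dc K x V))%N.

Lemma Xc_ge0 k j : 0 <= Xc k j.
Proof. by rewrite /Xc; case: eqP => // _; rewrite divr_ge0 ?ler0n. Qed.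

Lemma Xc_pack k (d : 'I_(nrows I)) : (k <= H)%N ->
  K%:R * (Zt K x)%:R * \sum_j pack I d j * (proc I 0 j * Xc k j) <= (K + 5)%:R * (lg K k)%:R.
Proof.
rewrite leq_eqVlt => /orP[/eqP ->|hk].
  rewrite /Xc eqxx; under eq_bigr do rewrite mulr1.
  exact: (last_slot_pack _ (tg_large K0 (Xb K x))).
have hr : (true, (k, val d)) \in rowsP K x 
  by apply: rowsP_mem; [exact: hk|rewrite (rep_D hx) ltn_ord].
have := hload hr; rewrite /load.
rewrite (_ : (\sum_(v <- h) _)%N = (\sum_(v <- h) (if v.1 && (k == v.2.1) then
    Zt K x * Bdj x d v.2.2 * Pj x v.2.2 * V * (Lp K x %/ lg K k) * sc K x V (true, (k, v.2.2)) else 0))%N); last first.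
  apply: eq_bigr => -[[] [k' j']] _ //=; rewrite /Pm /Pe /=.
  by case: (k =P k') => [->//|_]; rewrite mul0n.
rewrite (sum_label_row (fun j => Zt K x * Bdj x d j * Pj x j * V * (Lp K x %/ lg K k) * sc K x V (true, (k, j)))%N).
rewrite -(ler_nat rat) natrM natr_sum iota_ord [leRHS]natrM.
have := UDQ; move E : (Uc K x * Dc K x V)%N => UD UQ; set S := \sum_(j < n) _ => hl.
have -> : \sum_j pack I d j * (proc I 0 j * Xc k j) = (lg K k)%:R / UD%:R / (Zt K x)%:R * S.
  rewrite mulr_sumr; apply: eq_bigr => j _; rewrite XcE // (rep_b hx) (rep_p hx) RrE E.
  move: (esym (lg_dvd hk)); move: (Lp K x %/ lg K k)%N => q ->.
  have nz m : (0 < m)%N -> m%:R != 0 :> rat by rewrite pnatr_eq0 lt0n.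
  have {E hl} ud0 : UD%:R != 0 :> rat by rewrite gt_eqF.
  move: (nz _ Zt_gt0) (nz _ (rep_den hx)).
  move: (Zt K x) (Den x) (lg K k) (sc _ _ _ _) (cnt _ _ _).
  move=> z dd g s c z0 dd0; rewrite !natrM; field.
  by rewrite ud0 z0 dd0.
have ZQ : 0 < (Zt K x)%:R :> rat by rewrite ltr0n Zt_gt0.
have lQ : 0 < (lg K k)%:R :> rat by rewrite ltr0n.
move: UD%:R (Zt K x)%:R (lg K k)%:R hl ZQ lQ UQ => ud z l hl z0 l0 ud0.
have -> : K%:R * z * (l / ud / z * S) = K%:R * S / ud * l by field; rewrite !gt_eqF.
by rewrite ler_pM2r // ler_pdivrMr.
Qed.

Lemma Xc_release k (j : 'I_n) : (k <= H)%N -> Xc k (val j) != 0 ->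
  release I 0 j * (Zt K x)%:R <= (tg K k)%:R.
Proof.
rewrite leq_eqVlt => /orP[/eqP -> _|hk].
  exact: (last_slot_release _ (tg_large K0 (Xb K x))).
have DQ : 0 < (Den x)%:R :> rat by rewrite ltr0n (rep_den hx).
rewrite (rep_r hx) mulrAC -natrM ler_pdivrMr // -natrM ler_nat.
rewrite XcE //; have [hv _|hv] := boolP ((true, (k, val j)) \in cols K x).
  by case: (cols_true hv).
by rewrite cnt_eq0 // mul0n mul0r eqxx.
Qed.

Section WithI.
Variable i : nat.
Hypothesis hi : (0 < i <= K)%N.

Let hi' : (0 < i <= K.+1)%N. Proof. by move: hi; lia. Qed.

Definition sched := slots I K (Zt K x) H i Xc : explicit_schedule (njobs I).

Lemma sched_props :
  feasible (rates sched : R -> 'rV[R]_(njobs I)) /\ forall j m, (m <= H.+1)%N ->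
    proc I 0 j = 0 \/ i%:R <= (K + 1)%:R * \sum_(k < m) Xc k j ->
    completion (rates sched : R -> 'rV[R]_(njobs I)) j <= ratr (slot_end K (Zt K x) i m).
Proof.
apply: slots_props => //.
- exact: Zt_gt0.
- by case: wf.
- by move=> k j _; exact: Xc_ge0.
- by move=> k d; exact: Xc_pack.
- by move=> k j; exact: Xc_release.
- by move=> j; rewrite /Xc eqxx.
Qed.

Lemma cov_done g k (j : 'I_n) : (k < H)%N -> (g < size (groups I))%N ->
  cov K x V h i g k -> j \in (nth g0 (groups I) g).1 ->
  proc I 0 j = 0 \/ i%:R <= (K + 1)%:R * \sum_(k < k.+1) Xc k j.
Proof.
move=> hk hg /allP /(_ (val j)); rewrite mem_iota (rep_J hx) ltn_ord => /(_ isT).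
rewrite (rep_S hx) // => + hj; rewrite hj /=.
case/orP => [|hc].
  by rewrite -eqn0Ngt (rep_p hx) => /eqP ->; left; rewrite mul0r.
right; move: hc; rewrite -(ler_nat rat) natrM [X in _ <= X]natrM xld_sum //.
by rewrite mulrCA mulrC ler_pM2l.
Qed.

Lemma sched_objective :
  objective (rates sched : R -> 'rV[R]_(njobs I)) <=
  ratr (((K + 5) * (K + 1) * Ob K x V h i)%:R / (K * i * Zt K x * Den x)%:R).
Proof.
have [_ hc] := sched_props.
(* [find] returns [H] if the group is never covered, and then the last slot finishes it. *)
pose m g := find (cov K x V h i g) (iota 0 H).
have mH g : (m g <= H)%N by rewrite /m -{2}(size_iota 0 H) find_size.
apply: le_trans (objective_le wf (c := fun g => ratr (slot_end K (Zt K x) i (m g).+1)) _ _) _.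
- by move=> g _; rewrite ler0q /slot_end divr_ge0 ?ler0n.
- move=> g j hg hj; apply: hc; first by rewrite ltnS.
  case: (ltnP (m g) H) => hm; last first.
    right; have -> : m g = H by apply/eqP; rewrite eqn_leq mH.
    rewrite big_ord_recr /= {2}/Xc eqxx.
    have : 0 <= \sum_(k < H) Xc k j by rewrite sumr_ge0 // => *; exact: Xc_ge0.
    have : i%:R <= (K + 1)%:R :> rat by rewrite ler_nat addn1; case/andP: hi'.
    by move=> h1 h2; apply: le_trans h1 _; rewrite ler_peMr ?ler0n //; lra.
  apply: (cov_done hm hg _ hj).
  have hf : has (cov K x V h i g) (iota 0 H) by rewrite has_find size_iota.
  by have := nth_find 0%N hf; rewrite nth_iota.
rewrite (eq_bigr (fun g => ratr ((nth g0 (groups I) g).2 * slot_end K (Zt K x) i (m g).+1))); last first.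
  by move=> g _; exact: esym (rmorphM _ _ _).
rewrite -rmorph_sum ler_rat /Ob [X in X / _]natrM natr_sum (rep_G hx) mulr_sumr mulr_suml.
rewrite big_seq [leRHS]big_seq; apply: ler_sum => g; rewrite mem_iota add0n => hg.
rewrite (rep_w hx) // /slot_end.
have := Zt_gt0; have := rep_den hx; case/andP: hi => + _; have := K0.
set S := (1 + _)%N; move: (Zt K x) (Den x) => z dd k0 i1 dd0 z0.
have -> : (Wg x g)%:R / dd%:R * (((K + 5) * (K + 1) * tg K (m g).+1)%:R / (K * i * z)%:R) =
  ((K + 5) * (K + 1))%:R * (Wg x g * tg K (m g).+1)%:R / (K * i * z * dd)%:R :> rat.
  by rewrite !natrM; field; rewrite !pnatr_eq0 -!lt0n dd0 k0 i1 z0.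
rewrite ler_pM2r ?invr_gt0 ?ltr0n ?muln_gt0 ?k0 ?i1 ?z0 // ler_wpM2l ?ler0n //.
rewrite ler_nat leq_mul2l; apply/orP; right; rewrite /S.
rewrite sum_lg // leq_add2l.
have -> : iota 0 (Hor K x) = iota 0 (m g) ++ iota (m g) (H - m g) by rewrite -iotaD subnKC.
rewrite big_cat /=; apply: leq_trans (leq_addr _ _).
rewrite big_seq [leqRHS]big_seq; apply: leq_sum => k; rewrite mem_iota add0n => hk.
by have := @before_find _ 0%N (cov K x V h i g) (iota 0 H) k hk; rewrite nth_iota ?(leq_trans hk) // add0n => ->.
Qed.

Lemma sched_output : enc_schedule sched =
  eseq (eprod eqcode (eseq eqcode)) (output K x (V, (h, i))).
Proof.
rewrite /enc_schedule /output /sched /slots /steps -/H.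
rewrite -/(eseq _ _) /eseq; elim: (iota 0 H.+1) => //= k l ->; congr Node.
rewrite /eprod /=; congr Node.
  rewrite qcode_ofE; congr eqcode; apply: qcode_of_reduce.
  by rewrite muln_gt0 Zt_gt0 andbT muln_gt0 K0; case/andP: hi.
rewrite /enc_row (@eseq_map _ _ (fun j => reduce (rate_num K x (V, (h, i)) k (val j)) (rate_den K x (V, (h, i)) k (val j))) eqcode).
  by rewrite (rep_J hx) -val_enum_ord -map_comp.
move=> j; rewrite qcode_ofE; congr eqcode; rewrite -qcode_of_reduce; last first.
  rewrite /rate_den; case: ifP => _; first by rewrite !muln_gt0 (rep_den hx) addnC.
  move: Uc_gt0 (rep_den hx) (Mc_gt0 (true, (k, val j))).
  by move: (Uc K x) (Den x) (Mc K x _ _) => u d m u0 d0 m0; rewrite !muln_gt0 u0 d0 m0 addnC.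
congr qcode_of; rewrite mxE /rate_num /rate_den /Xc -/H (rep_p hx).
have := Uc_gt0; have := rep_den hx; have := Mc_gt0 (true, (k, val j)).
move: (Uc K x) (Den x) (Mc K x V _) (Zt K x) (Rr K x V) (lg K k) (ltn0Sn (tg K k %/ K) : (0 < lg K k)%N).
move=> u dd mm z rr ll ll0 m0 dd0 u0.
have nz a : (0 < a)%N -> a%:R != 0 :> rat by rewrite pnatr_eq0 lt0n.
have K5 : K%:R + 5 != 0 :> rat by rewrite -(natrD _ K 5) nz // addnC.
by case: ifP => _; rewrite !natrM ?natrD; field; rewrite ?K5 !nz.
Qed.

End WithI.
End WithV.
End Sound.

Lemma bigmax_attained (A : eqType) (l : seq A) (F : A -> nat) :
  (0 < \max_(i <- l) F i)%N -> exists2 i, i \in l & F i = \max_(i <- l) F i.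
Proof.
elim: l => [|a l IH]; first by rewrite big_nil.
rewrite big_cons; case: (leqP (F a) (\max_(i <- l) F i)) => h h0.
  by have [i hi E] := IH h0; exists i => //; rewrite inE hi orbT.
by exists a; rewrite ?mem_head.
Qed.

(** * The linear program as an input of multiplicative weights *)

Section MWInst.
Variables (R : realType) (I : psp) (x : inst) (K V : nat).
Hypotheses (hx : represents I x) (hK : (4 <= K)%N) (V0 : (0 < V)%N).

Let K0 : (0 < K)%N. Proof. by lia. Qed.

Lemma Pm_le i v : i \in rowsP K x -> v \in cols K x -> (Pm K x V i v <= Dc K x V)%N.
Proof.
move=> hi hv; rewrite /Pm -(scE V hv) mulnC leq_mul2l; apply/orP; right.
by rewrite /Mc leq_max; apply/orP; right; apply: (@leq_bigmax_seq _ _ xpredT (fun i => Pe K x V i v)).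
Qed.

Lemma Cm_le i v : i \in rowsC K x -> v \in cols K x -> (Cm K x V i v <= Dc K x V)%N.
Proof.
move=> hi hv; rewrite /Cm -(scE V hv) mulnC leq_mul2l; apply/orP; right.
by case: ifP => // _; rewrite /Mc leq_max leqnn.
Qed.

(** The maximum by which a column is normalized is attained in a packing row unless it is [Rr], the
    only nonzero value of a covering entry. *)
Lemma mw_width v : v \in cols K x ->
  (exists2 i, i \in rowsP K x & Pm K x V i v = Dc K x V) \/
  (forall i, i \in rowsC K x -> Cm K x V i v = 0%N \/ Cm K x V i v = Dc K x V).
Proof.
move=> hv; case: (leqP (\max_(i <- rowsP K x) Pe K x V i v) (Rr K x V)) => h.
  right=> i _; rewrite /Cm; case: ifP => _; last by left; rewrite mul0n.
  by right; rewrite -(scE V hv) mulnC /Mc (maxn_idPl h).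
left; have [i hi E] := bigmax_attained (leq_ltn_trans (leq0n _) h).
by exists i => //; rewrite /Pm E -(scE V hv) mulnC /Mc (maxn_idPr (ltnW h)).
Qed.

Lemma sol_load r : r \in rowsP K x ->
  (K * load (Pm K x V) (sol K x V) r <= (K + 5) * (Uc K x * Dc K x V))%N.
Proof.
move=> hr; apply: (@mw_load_le R _ _ _ (rowsP K x) (rowsC K x) (cols K x) (Pm K x V) (Cm K x V) K (Dc K x V)) => //.
- exact: (Dc_gt0 K hx V0).
- exact: Pm_le.
- exact: Cm_le.
Qed.

Variable z : label -> R.
Hypothesis z0 : forall v, v \in cols K x -> 0 <= z v.
Hypothesis hPz : forall i, i \in rowsP K x ->
  \sum_(v <- cols K x) (Pe K x V i v)%:R * z v <= (Rr K x V)%:R.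
Hypothesis hCz : forall i, i \in rowsC K x ->
  1 <= \sum_(v <- cols K x) (Cb i v)%:R * z v.

Lemma sol_cover r : r \in rowsC K x ->
  (Uc K x * Dc K x V <= load (Cm K x V) (sol K x V) r)%N.
Proof.
have s0 v : v \in cols K x -> (0:R) < (sc K x V v)%:R.
  move=> hv; rewrite ltr0n lt0n; apply/negP => /eqP E.
  by have := scE V hv; rewrite E mul0n => /eqP; rewrite ltn_eqF // (Dc_gt0 K hx V0).
apply: (@mw_complete R _ _ _ (rowsP K x) (rowsC K x) (cols K x) (Pm K x V) (Cm K x V) K (Dc K x V) hK
  (Dc_gt0 K hx V0) Pm_le Cm_le mw_width (fun v => z v / (sc K x V v)%:R) (Rr K x V)%:R) => //.
- by move=> v hv; rewrite divr_ge0 ?ler0n // z0.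
- by rewrite ltr0n (Rr_gt0 K hx V0).
- move=> i hi; apply: le_trans (hPz hi); rewrite big_seq [leRHS]big_seq ler_sum // => v hv.
  by rewrite /Pm natrM -mulrA (mulrCA (sc K x V v)%:R) divff ?mulr1 // gt_eqF // s0.
- move=> i hi; have := hCz hi; rewrite -(ler_pM2l (_ : 0 < (Rr K x V)%:R :> R)) ?ltr0n ?(Rr_gt0 K hx V0) // mulr1.
  move=> /le_trans; apply; rewrite mulr_sumr big_seq [leRHS]big_seq ler_sum // => v hv.
  rewrite /Cm [in leRHS]natrM -[in leRHS]mulrA (mulrCA (sc K x V v)%:R) divff ?mulr1; last by rewrite gt_eqF // s0.
  by case: (Cb i v); rewrite ?mul1r ?mul0r ?mulr0.
Qed.

End MWInst.

Section ColsSum.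
Variables (R : realType) (x : inst) (K : nat).

Lemma cols_sum (F : label -> R) :
  \sum_(v <- cols K x) F v =
  \sum_(k <- iota 0 (Hor K x)) \sum_(j <- iota 0 (nJ x) | (Rj x j * Zt K x <= tg K k * Den x)%N) F (true, (k, j))
  + \sum_(k <- iota 0 (Hor K x)) \sum_(g <- iota 0 (nG x)) F (false, (k, g)).
Proof.
rewrite /cols big_cat /=; congr (_ + _); rewrite big_flatten big_map; apply: eq_bigr => k _.
  by rewrite big_map big_filter.
by rewrite big_map.
Qed.

End ColsSum.

(** * The linear program is feasible *)

Section FromSchedule.
Variables (R : realType) (I : psp) (x : inst) (K : nat).
Hypotheses (wf : psp_wf I) (hx : represents I x) (hK : (4 <= K)%N).
Variable y : R -> 'rV[R]_(njobs I).
Hypothesis fy : feasible y.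

Let n := njobs I.
Let H := Hor K x.
Let g0 := dflt_group n.

Let K0 : (0 < K)%N. Proof. by lia. Qed.

Let yj (j : 'I_n) (t : R) : R := y t 0 j.
Definition tau k : R := (tg K k)%:R / (Zt K x)%:R.
Let q (a : rat) : R := ratr a.

Let ZR : 0 < (Zt K x)%:R :> R. Proof. by rewrite ltr0n (Zt_gt0 hx). Qed.

Lemma tau_ge0 k : 0 <= tau k.
Proof. by rewrite divr_ge0 ?ler0n. Qed.

Lemma tau0 : tau 0%N = 0.
Proof. by rewrite /tau mul0r. Qed.

Lemma tauS k : tau k.+1 = tau k + (lg K k)%:R / (Zt K x)%:R.
Proof. by rewrite /tau tgS natrD mulrDl. Qed.

Lemma tau_mono j k : (j <= k)%N -> tau j <= tau k.
Proof. by move=> h; rewrite /tau ler_pM2r ?invr_gt0 // ler_nat tg_mono. Qed.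

Let my j : measurable_fun (`[0, +oo[ : set R)%classic (yj j).
Proof. by case: fy => h _ _ _; exact: h. Qed.

Let y0 j t : 0 <= t -> 0 <= yj j t.
Proof. by move=> t0; case: fy => _ h _ _; case: (h t t0) => h1 _; exact: h1. Qed.

Definition wk k j := work (yj j) (tau k) (tau k.+1).

Lemma wk_ge0 k j : (0 <= wk k j)%E.
Proof. by apply: work_ge0; [exact: y0|exact: tau_ge0]. Qed.

Lemma work_sum k j : work (yj j) 0 (tau k) = (\sum_(i < k) wk i j)%E.
Proof.
elim: k => [|k IH].
  rewrite big_ord0 tau0 (@work_cst _ _ _ _ 0) ?mul0r // => t h1 h2.
  by move: (le_lt_trans h1 h2); rewrite ltxx.
by rewrite big_ord_recr /= -IH (work_split (my j) (@y0 j) (lexx 0) (tau_ge0 k)) // tau_mono.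
Qed.

Let p j : R := q (proc I 0 j).

Let p0 j : 0 <= p j.
Proof. by rewrite ler0q; case: wf. Qed.

(** Work of an interval is moved to the next one, where the slot constraint
    [r_j <= tau k] then holds. *)
Definition amount k j : R := if k is k'.+1 then fine (mine (wk k' j) (p j)%:E) else 0.

Lemma amountE k j : (amount k.+1 j)%:E = mine (wk k j) (p j)%:E.
Proof.
rewrite /amount fineK // fin_numElt; apply/andP; split.
  by rewrite lt_min (lt_le_trans _ (wk_ge0 k j)) // ltNyr.
by rewrite gt_min ltry orbT.
Qed.

Lemma amount_ge0 k j : 0 <= amount k j.
Proof.
by case: k => [//|k]; rewrite -lee_fin amountE le_min wk_ge0 lee_fin p0.
Qed.

Lemma amount_le_wk k j : ((amount k.+1 j)%:E <= wk k j)%E.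
Proof. by rewrite amountE ge_min lexx. Qed.

Lemma amount_release k j : tau k < q (release I 0 j) -> amount k j = 0.
Proof.
case: k => [//|k] h; apply: EFin_inj; rewrite amountE.
have -> : wk k j = 0%E.
  rewrite /wk (@work_cst _ _ _ _ 0) ?mul0r //; first exact: tau_mono.
  move=> t h1 h2; case: fy => _ _ hr _; apply: hr; first exact: le_trans (tau_ge0 k) h1.
  exact: lt_trans h2 h.
by apply/min_idPl; rewrite lee_fin.
Qed.

(** Truncation keeps the amounts finite and loses nothing: a slot whose work reaches [p j] supplies
    the whole job alone, and otherwise no slot is truncated. *)
Lemma amount_total k j : ((p j)%:E <= work (yj j) 0 (tau k))%E ->
  p j <= \sum_(i < k.+1) amount i j.
Proof.
have -> : \sum_(i < k.+1) amount i j = \sum_(i < k) amount i.+1 j.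
  by rewrite big_ord_recl add0r.
rewrite work_sum => h.
case: (pselect (exists i : 'I_k, (p j)%:E <= wk i j)%E) => [[i hi]|hn].
  rewrite (bigD1 i) //; apply: ler_wpDr; first by rewrite sumr_ge0 // => *; exact: amount_ge0.
  by rewrite -lee_fin amountE (min_idPr hi).
rewrite -lee_fin -sumEFin; apply: le_trans h _; apply: lee_sum => i _.
rewrite amountE le_min lexx /= leNgt; apply/negP => hi; apply: hn; exists i.
exact: ltW.
Qed.

Lemma pack_work d k : (\sum_(j < n) (q (pack I d j))%:E * wk k j <= ((lg K k)%:R / (Zt K x)%:R)%:E)%E.
Proof.
have b0 j : 0 <= q (pack I d j) by rewrite ler0q; case: wf.
have tk := tau_ge0 k.
have ym j : measurable_fun (`[tau k, tau k.+1[ : set R)%classic (EFin \o yj j).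
  exact: work_meas (my j) _ _ tk.
have h0 t : t \in `[tau k, tau k.+1[ -> 0 <= t.
  by rewrite in_itv /= => /andP[h _]; exact: le_trans tk h.
rewrite (eq_bigr (fun j => \int[lebesgue_measure]_(t in `[tau k, tau k.+1[%classic) ((q (pack I d j))%:E * (yj j t)%:E)%E))%E; last first.
  move=> j _; rewrite ge0_integralZl_EFin //=; last exact: ym.
  by move=> t /= ht; rewrite lee_fin y0 // h0.
rewrite -ge0_integral_sum //=; last 2 first.
- by move=> j; apply: emeasurable_funM; [exact: measurable_cst|exact: ym].
- by move=> j t /= ht; rewrite mule_ge0 ?lee_fin ?b0 // y0 // h0.
have <- : (\int[lebesgue_measure]_(t in `[tau k, tau k.+1[%classic) (cst 1%:E) t =
    ((lg K k)%:R / (Zt K x)%:R)%:E)%E.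
  rewrite integral_cst //= lebesgue_measure_itv /= lte_fin tauS.
  have h : 0 < (lg K k)%:R / (Zt K x)%:R :> R by rewrite divr_gt0 // ltr0n.
  rewrite ltrDl h mul1e -EFinB; congr EFin; ring.
apply: ge0_le_integral => //=.
- move=> t /= ht; apply: sume_ge0 => j _.
  by rewrite mule_ge0 ?lee_fin ?b0 // y0 // h0.
- apply: emeasurable_sum => j; apply: emeasurable_funM; [exact: measurable_cst|exact: ym].
move=> t /= ht; rewrite sumEFin lee_fin.
by case: fy => _ hP _ _; case: (hP t (h0 _ ht)) => _ /(_ d).
Qed.

(** Work is charged to the slot after the one in which it was done, and that slot is at least as
    long. *)
Lemma amount_pack d k : \sum_(j < n) q (pack I d j) * amount k j <= (lg K k)%:R / (Zt K x)%:R.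
Proof.
case: k => [|k].
  by rewrite big1 ?divr_ge0 ?ler0n // => j _; rewrite mulr0.
apply: (@le_trans _ _ ((lg K k)%:R / (Zt K x)%:R)); last first.
  by rewrite ler_pM2r ?invr_gt0 // ler_nat lg_mono.
rewrite -lee_fin -sumEFin; apply: le_trans (pack_work d k); apply: lee_sum => j _.
rewrite EFinM; apply: lee_wpmul2l; last exact: amount_le_wk.
by rewrite lee_fin ler0q; case: wf.
Qed.

(** Compared with the left end [tau k], because the delayed work of slots 0 to [k] is the work done
    before [tau k]. *)
Definition late k g : R :=
  if tau k < group_completion y (nth g0 (groups I) g).1 then 1 else 0.

Definition lp_val (v : label) : R :=
  if v.1 then (if insub v.2.2 is Some j then amount v.2.1 j / p j else 0) else late v.2.1 v.2.2.

Lemma lp_val_true k (j : 'I_n) : lp_val (true, (k, val j)) = amount k j / p j.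
Proof. by rewrite /lp_val /= valK. Qed.

Lemma lp_val_ge0 v : 0 <= lp_val v.
Proof.
rewrite /lp_val; case: ifP => _; last by rewrite /late; case: ifP.
by case: insubP => // j _ _; rewrite divr_ge0 ?p0 ?amount_ge0.
Qed.

Definition lp_cost : R := \sum_(g <- iota 0 (nG x)) (Wg x g)%:R *
  \sum_(k <- iota 0 H) (lg K k.+1)%:R * late k g.

Variable V : nat.
Hypotheses (V0 : (0 < V)%N) (hV : lp_cost <= V%:R).

Lemma lp_pack r : r \in rowsP K x ->
  \sum_(v <- cols K x) (Pe K x V r v)%:R * lp_val v <= (Rr K x V)%:R.
Proof.
rewrite cols_sum inE => /orP[/eqP ->|/flatten_mapP[k hk /mapP[d hd ->]]].
  rewrite big1 ?add0r; last by move=> k _; rewrite big1 // => j _; rewrite /Pe /= mul0r.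
  have -> : \sum_(k <- iota 0 H) \sum_(g <- iota 0 (nG x)) (Pe K x V (false, (0, 0))%N (false, (k, g)))%:R * lp_val (false, (k, g))
    = (Den x * Den x * Lp K x)%:R * lp_cost.
    rewrite exchange_big /= /lp_cost mulr_sumr; apply: eq_bigr => g _.
    rewrite !mulr_sumr; apply: eq_bigr => k _; rewrite /Pe /lp_val /=.
    by move: (Den x) (Lp K x) (lg K k.+1) => dd l m; rewrite !natrM; ring.
  have -> : (Rr K x V)%:R = (Den x * Den x * Lp K x)%:R * V%:R :> R.
    by rewrite -natrM /Rr; congr (_%:R); lia.
  by rewrite ler_wpM2l ?ler0n.
rewrite [X in _ + X]big1 ?addr0; last by move=> k' _; rewrite big1 // => g _; rewrite /Pe /= mul0r.
rewrite mem_iota add0n in hk; rewrite mem_iota add0n (rep_D hx) in hd.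
rewrite (bigD1_seq k) ?mem_iota ?iota_uniq //= [X in _ + X]big1 ?addr0; last first.
  by move=> k' hk'; rewrite big1 // => j _; rewrite /Pe /= eq_sym (negPf hk') mul0r.
apply: (@le_trans _ _ (\sum_(j < n) (Pe K x V (true, (k, d)) (true, (k, val j)))%:R * lp_val (true, (k, val j)))).
  rewrite big_mkcond iota_ord (rep_J hx); apply: ler_sum => j _.
  by case: ifP => // _; rewrite mulr_ge0 ?ler0n ?lp_val_ge0.
have DQ : 0 < (Den x)%:R :> R by rewrite ltr0n (rep_den hx).
apply: (@le_trans _ _ ((Zt K x)%:R * (Den x * Den x * V * (Lp K x %/ lg K k))%:R *
   \sum_(j < n) q (pack I (Ordinal hd) j) * amount k j)).
  rewrite mulr_sumr; apply: ler_sum => j _; rewrite lp_val_true /Pe /= eqxx.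
  (* If [p j] is 0, the fraction is 0 by the convention on division. *)
  have [pj0|pjn] := eqVneq (p j) 0.
    have q0 : 0 <= q (pack I (Ordinal hd) j) by rewrite ler0q; case: wf.
    rewrite pj0 invr0 !mulr0; apply: mulr_ge0; first by apply: mulr_ge0; exact: ler0n.
    exact: mulr_ge0 q0 (amount_ge0 _ _).
  have pE : p j = (Pj x j)%:R / (Den x)%:R by rewrite /p /q (rep_p hx) fmorph_div !rmorph_nat.
  have bE : q (pack I (Ordinal hd) j) = (Bdj x d j)%:R / (Den x)%:R.
    by rewrite /q (rep_b hx) fmorph_div !rmorph_nat.
  have P0 : (Pj x j)%:R != 0 :> R by apply: contraNneq pjn => E; rewrite pE E mul0r.
  rewrite pE bE le_eqVlt; apply/orP; left; apply/eqP.
  move: (Zt K x) (Lp K x %/ lg K k)%N (Den x) (Pj x j) (Bdj x d j) (amount k j) DQ P0.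
  by move=> z l dd pj b a d0 P0; rewrite !natrM; field; rewrite P0 gt_eqF.
have h := amount_pack (Ordinal hd) k.
have -> : (Rr K x V)%:R = (Zt K x)%:R * (Den x * Den x * V * (Lp K x %/ lg K k))%:R * ((lg K k)%:R / (Zt K x)%:R) :> R.
  have := lg_dvd hk; rewrite /Rr; move: (Lp K x %/ lg K k)%N => l <-.
  move: ZR; move: (Zt K x) (lg K k) => z m z1; rewrite !natrM; field.
  by rewrite gt_eqF.
by rewrite ler_wpM2l // mulr_ge0 ?ler0n.
Qed.

(** Either the group is late at [k], and its variable alone gives 1, or its jobs are complete by
    [tau k], and the delayed fractions up to slot [k] add up to at least 1. *)
Lemma lp_cover r : r \in rowsC K x ->
  1 <= \sum_(v <- cols K x) (Cb r v)%:R * lp_val v.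
Proof.
case/flatten_mapP => k hk /flatten_mapP[g hg /mapP[j' + ->]].
rewrite mem_filter !mem_iota !add0n (rep_J hx) in hk hg * => /andP[/andP[hS hp] hj'].
have [j Ej] : exists j : 'I_n, val j = j' by exists (Ordinal hj').
subst j'; have hg' : (g < size (groups I))%N by rewrite -(rep_G hx).
rewrite (rep_S hx) // in hS.
have nn v : 0 <= (Cb (k, (g, val j)) v)%:R * lp_val v by rewrite mulr_ge0 ?ler0n ?lp_val_ge0.
rewrite cols_sum; case: (ltP (tau k) (group_completion y (nth g0 (groups I) g).1)) => hC.
  apply: ler_wpDl; first by do 2!(rewrite sumr_ge0 // => ? _).
  rewrite (bigD1_seq k) ?mem_iota ?iota_uniq //=; apply: ler_wpDr.
    by do 2!(rewrite sumr_ge0 // => ? _).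
  rewrite (bigD1_seq g) ?mem_iota ?iota_uniq //=; apply: ler_wpDr.
    by rewrite sumr_ge0.
  by rewrite /Cb /= !eqxx mul1r /lp_val /= /late hC.
apply: ler_wpDr; first by do 2!(rewrite sumr_ge0 // => ? _).
have hcj : completion y j <= tau k := le_trans (completion_le_group y hS) hC.
have hf : finished y j (completion y j) by case: fy.
have c0 := completion_ge0 hf.
have hw : ((p j)%:E <= work (yj j) 0 (tau k))%E.
  apply: le_trans ((finishedP (my j) c0).1 hf) _.
  exact: (@work_mono R (yj j) (my j) (@y0 j) 0 (completion y j) (tau k)).
have pj0 : 0 < p j.
  rewrite lt_neqAle p0 andbT eq_sym /p /q (rep_p hx) fmorph_eq0 mulf_neq0 //.
    by rewrite pnatr_eq0 -lt0n.
  by rewrite invr_eq0 pnatr_eq0 -lt0n (rep_den hx).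
apply: (@le_trans _ _ (\sum_(i < k.+1) amount i j / p j)).
  by rewrite -mulr_suml ler_pdivlMr // mul1r amount_total.
rewrite -(iota_ord (fun i => amount i j / p j)).
have -> : iota 0 H = iota 0 k.+1 ++ iota k.+1 (H - k.+1) by rewrite -iotaD subnKC.
rewrite big_cat; apply: ler_wpDr; first by do 2!(rewrite sumr_ge0 // => ? _).
rewrite big_seq [leRHS]big_seq; apply: ler_sum => i; rewrite mem_iota add0n ltnS => /andP[_ hi].
have [ha|hna] := leqP (Rj x j * Zt K x)%N (tg K i * Den x)%N.
  rewrite big_mkcond (bigD1_seq (val j)) ?mem_iota ?iota_uniq ?(rep_J hx) ?ltn_ord //= ha.
  rewrite /Cb /= hi eqxx mul1r lp_val_true; apply: ler_wpDr; last by [].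
  by rewrite sumr_ge0 // => j' _; case: ifP => _ //; rewrite mulr_ge0 ?ler0n ?lp_val_ge0.
rewrite amount_release ?mul0r; first by rewrite sumr_ge0.
rewrite /q (rep_r hx) fmorph_div !rmorph_nat /tau ltr_pdivrMr // mulrAC ltr_pdivlMr ?ltr0n ?(rep_den hx) //.
by rewrite -!natrM ltr_nat.
Qed.

End FromSchedule.

(** * Averaging over the stretch factor *)

Section Averaging.
Local Open Scope nat_scope.

(** The number of counted indices is at most the largest of them, to which the hypothesis
    applies. *)
Lemma count_le (Q : nat -> bool) c b N :
  (forall m, 0 < m <= N -> ~~ Q m -> m * c <= b) ->
  (\sum_(1 <= m < N.+1) (if Q m then 0 else 1)) * c <= b.
Proof.
elim: N => [|N IH] h; first by rewrite big_nil.
rewrite big_nat_recr //=; case: ifPn => hQ.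
  by rewrite addn0; apply: IH => m hm; apply: h; lia.
apply: leq_trans (h N.+1 _ hQ); last by rewrite ltnSn.
rewrite leq_mul2r addn1 ltnS; apply/orP; right.
apply: (@leq_trans (\sum_(1 <= m < N.+1) 1)); last by rewrite sum_nat_const_nat; lia.
by apply: leq_sum => m _; case: ifP.
Qed.

Lemma gauss_sum N : 2 * \sum_(1 <= i < N.+1) i = N * N.+1.
Proof.
elim: N => [|N IH]; first by rewrite big_nil.
by rewrite big_nat_recr //= mulnDr IH; lia.
Qed.

Variables (I : psp) (x : inst) (K V : nat).
Hypotheses (hx : represents I x) (hK : 4 <= K) (V0 : 0 < V).
Variable h : seq label.
Hypothesis hh : {subset h <= cols K x}.
Hypothesis hload : K * load (Pm K x V) h (false, (0, 0)) <= (K + 5) * (Uc K x * Dc K x V).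
Hypothesis hcover : forall r, r \in rowsC K x -> Uc K x * Dc K x V <= load (Cm K x V) h r.

Let H := Hor K x.
Let UD := Uc K x * Dc K x V.
Let K0 : 0 < K. Proof. by lia. Qed.
Let UD0 : 0 < UD. Proof. by rewrite muln_gt0 (@Uc_gt0 I x K hK) (Dc_gt0 K hx V0). Qed.

Definition uld k g := \sum_(v <- h)
  (if ~~ v.1 && ((v.2.1 == k) && (v.2.2 == g)) then Rr K x V * sc K x V v else 0).

Lemma load_split k g j :
  load (Cm K x V) h (k, (g, j)) = xld K x V h k j + uld k g.
Proof.
rewrite /load /xld /uld -big_split; apply: eq_bigr => -[[] [k' a]] _ /=.
  by rewrite /Cm /Cb /= addn0; case: ifP.
by rewrite /Cm /Cb /= add0n; case: ifP.
Qed.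

(** The factor [V] completes the scaling Den ^ 2 Lp of the budget row to [Rr], in which [uld] is
    measured. *)
Lemma load_budget : V * load (Pm K x V) h (false, (0, 0)) =
  \sum_(g <- iota 0 (nG x)) Wg x g * \sum_(k <- iota 0 H) lg K k.+1 * uld k g.
Proof.
have -> : \sum_(g <- iota 0 (nG x)) Wg x g * \sum_(k <- iota 0 H) lg K k.+1 * uld k g =
  \sum_(g <- iota 0 (nG x)) \sum_(k <- iota 0 H) \sum_(v <- h)
    (if ~~ v.1 && ((v.2.1 == k) && (v.2.2 == g)) then Wg x g * lg K k.+1 * (Rr K x V * sc K x V v) else 0).
  apply: eq_bigr => g _; rewrite big_distrr; apply: eq_bigr => k _; rewrite /= !big_distrr.
  by apply: eq_bigr => v _ /=; case: ifP; rewrite ?muln0 // mulnA.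
under eq_bigr do rewrite exchange_big.
rewrite exchange_big /load big_distrr /= big_seq [RHS]big_seq; apply: eq_bigr => -[[] [k g]] /hh hv.
  by rewrite /Pm /Pe /= mul0n muln0 big1 // => g' _; rewrite big1.
have [hk hg] := cols_false hv.
rewrite (bigD1_seq g) ?mem_iota ?iota_uniq //= (bigD1_seq k) ?mem_iota ?iota_uniq //= !eqxx /=.
rewrite big1 => [|k' hk']; last by rewrite eq_sym (negPf hk').
rewrite big1 => [|g' hg']; last by rewrite big1 // => k' _; rewrite [g == _]eq_sym (negPf hg') andbF.
rewrite !addn0 /Pm /Pe /= /Rr; move: (sc _ _ _ _) (Lp K x) (lg K k.+1) (Wg x g) (Den x) => s l m w d.
by lia.
Qed.

(** If threshold [i] is missed because of job [j], the covering row of [j] leaves to [uld] more than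
    (K + 1 - i) / (K + 1) of U D. Reversing the order of summation turns K + 1 - i into an index
    starting at 1, as [count_le] requires. *)
Lemma count_uncovered g k : g < nG x -> k < H ->
  (\sum_(1 <= i < K.+1) (if cov K x V h i g k then 0 else 1)) * UD <= (K + 1) * uld k g.
Proof.
move=> hg hk; rewrite big_nat_rev /=; apply: (@count_le (fun m => cov K x V h (1 + K.+1 - m.+1) g k)).
move=> m hm /allPn[j]; rewrite mem_iota add0n => hj.
rewrite negb_or negbK => /andP[hSP]; rewrite -ltnNge => hlt.
have hr : (k, (g, j)) \in rowsC K x.
  apply/flatten_mapP; exists k; first by rewrite mem_iota.
  apply/flatten_mapP; exists g; first by rewrite mem_iota.
  by apply/mapP; exists j => //; rewrite mem_filter hSP mem_iota.
have := hcover hr; rewrite load_split -/UD => hc; rewrite -/UD in hlt.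
have -> : m = K + 1 - (1 + K.+1 - m.+1) by lia.
set i := 1 + K.+1 - m.+1 in hlt *.
rewrite mulnBl leq_subLR; apply: (@leq_trans ((K + 1) * (xld K x V h k j + uld k g))).
  by rewrite leq_mul2l hc orbT.
by rewrite mulnDr leq_add2r ltnW.
Qed.

(** After exchanging sums, the number of thresholds missed at each slot is controlled by [uld], and
    the budget row limits the weighted sum of these loads. *)
Lemma sum_Ob : K * \sum_(1 <= i < K.+1) Ob K x V h i <= K * K * sumW x + (K + 1) * (K + 5) * V.
Proof.
rewrite -(leq_pmul2r UD0).
have E : \sum_(1 <= i < K.+1) Ob K x V h i = \sum_(g <- iota 0 (nG x)) Wg x g *
    (K + \sum_(k <- iota 0 H) lg K k.+1 * \sum_(1 <= i < K.+1) (if cov K x V h i g k then 0 else 1)).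
  rewrite /Ob exchange_big; apply: eq_bigr => g _; rewrite -big_distrr; congr (_ * _).
  rewrite big_split /= sum_nat_const_nat; congr (_ + _); first by lia.
  rewrite exchange_big; apply: eq_bigr => k _; rewrite big_distrr; apply: eq_bigr => i _ /=.
  by case: ifP => _; rewrite ?muln0 ?muln1.
have h1 : (\sum_(1 <= i < K.+1) Ob K x V h i) * UD <=
    K * sumW x * UD + (K + 1) * (V * load (Pm K x V) h (false, (0, 0))).
  rewrite E load_budget /sumW !big_distrr !big_distrl /= -big_split big_seq [leqRHS]big_seq /=.
  apply: leq_sum => g; rewrite mem_iota add0n => hg.
  rewrite -mulnA mulnDl mulnDr; apply: leq_add; first by move: (Wg x g) UD => w u; lia.
  rewrite [leqRHS]mulnCA leq_mul2l; apply/orP; right; rewrite big_distrl big_distrr /= big_seq [leqRHS]big_seq.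
  apply: leq_sum => k; rewrite mem_iota add0n => hk.
  by rewrite -mulnA [leqRHS]mulnCA leq_mul2l count_uncovered ?orbT.
rewrite -mulnA; apply: (@leq_trans (K * (K * sumW x * UD + (K + 1) * (V * load (Pm K x V) h (false, (0, 0)))))).
  by rewrite leq_mul2l h1 orbT.
apply: (@leq_trans (K * (K * sumW x * UD) + (K + 1) * V * (K * load (Pm K x V) h (false, (0, 0))))).
  by move: (load _ _ _) (sumW x) UD => l w u; lia.
rewrite [leqRHS]mulnDl; apply: leq_add; first by rewrite !mulnA.
apply: (@leq_trans ((K + 1) * V * ((K + 5) * UD))); first by rewrite leq_mul2l hload orbT.
by move: UD => u; lia.
Qed.

(** The discrete form of the density 2 theta: the weights 2 i add up to K (K + 1), so failure of the
    test for all [i] would contradict [sum_Ob] after summation. *)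
Lemma exists_okc : exists2 i, 0 < i <= K & okc K x (V, (h, i)).
Proof.
set Q := K * K * sumW x + (K + 1) * (K + 5) * V.
have [hh'|hn] := boolP (has (fun i => okc K x (V, (h, i))) (index_iota 1 K.+1)).
  by case/hasP: hh' => i; rewrite mem_index_iota ltnS => hi ho; exists i.
have h1 : \sum_(1 <= i < K.+1) (2 * i * Q).+1 <= \sum_(1 <= i < K.+1) K * K * (K + 1) * Ob K x V h i.
  rewrite big_seq [leqRHS]big_seq; apply: leq_sum => i hi.
  by move/hasPn: hn => /(_ i hi); rewrite /okc -ltnNge.
move: h1; rewrite -big_distrr /= (eq_bigr (fun i => 2 * i * Q + 1)); last by move=> i _; rewrite addn1.
rewrite big_split /= -big_distrl -big_distrr /= gauss_sum sum_nat_const_nat.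
have := sum_Ob; rewrite -/Q => h2 h3.
have : K * K * (K + 1) * \sum_(1 <= i < K.+1) Ob K x V h i <= K * (K + 1) * Q.
  have -> : K * K * (K + 1) * \sum_(1 <= i < K.+1) Ob K x V h i =
     K * (K + 1) * (K * \sum_(1 <= i < K.+1) Ob K x V h i) by lia.
  by rewrite leq_mul2l h2 orbT.
by move: h3; rewrite addn1; lia.
Qed.

End Averaging.

(** * The approximation guarantee *)

Section Best.
Local Open Scope nat_scope.
Variables (K : nat) (x : inst).

Lemma first_candidate (Vs : seq nat) (G : nat -> seq cand) (P : pred cand) d c :
  sorted leq Vs -> (forall V a, a \in G V -> a.1 = V) ->
  c \in flatten [seq G V | V <- Vs] -> P c ->
  let b := if [seq a <- flatten [seq G V | V <- Vs] | P a] is a :: _ then a else d in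
  P b /\ b.1 <= c.1.
Proof.
move=> hs hG; elim: Vs hs => [//|V Vs IH] hs /=; rewrite mem_cat filter_cat.
have hV : forall a, a \in flatten [seq G V | V <- V :: Vs] -> V <= a.1.
  move=> a /flatten_mapP[V' hV' /hG ->]; move: hV'; rewrite inE => /predU1P[->//|].
  by move: V'; apply/allP; exact: order_path_min leq_trans hs.
case E : [seq a <- G V | P a] => [|a s] /=.
  case/orP => [hc hP|]; last by apply: IH; exact: path_sorted hs.
  by have := mem_filter P c (G V); rewrite E hP hc.
move=> hc hP; have : a \in [seq a <- G V | P a] by rewrite E mem_head.
rewrite mem_filter => /andP[Pa /hG ->]; split=> //.
by apply: hV; rewrite /= mem_cat.
Qed.

Lemma candsP c : c \in cands K x ->
  exists2 k, k < Hv K x & exists2 i, 0 < i <= K & c = (tg K k.+1, (sol K x (tg K k.+1), i)).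
Proof.
case/flatten_mapP => V /mapP[k hk ->] /mapP[i hi ->].
by rewrite !mem_iota in hk hi; exists k => //; exists i.
Qed.

Lemma cands_mem k i : k < Hv K x -> 0 < i <= K ->
  (tg K k.+1, (sol K x (tg K k.+1), i)) \in cands K x.
Proof.
move=> hk hi; apply/flatten_mapP; exists (tg K k.+1).
  by apply/mapP; exists k; rewrite ?mem_iota.
by apply/mapP; exists i; rewrite ?mem_iota.
Qed.

Lemma best_le k i : 0 < K -> k < Hv K x -> 0 < i <= K ->
  okc K x (tg K k.+1, (sol K x (tg K k.+1), i)) ->
  okc K x (best K x) /\ (best K x).1 <= tg K k.+1.
Proof.
move=> K0 hk hi ho.
have hs : sorted leq [seq tg K k.+1 | k <- iota 0 (Hv K x)].
  apply: (homo_sorted (e := leq)); last exact: iota_sorted.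
  by move=> a b ab; exact: tg_mono.
apply: (@first_candidate _ (fun V => [seq (V, (sol K x V, i)) | i <- iota 1 K]) _ (1, ([::], 1)) _ hs _ (cands_mem hk hi) ho).
by move=> V a /mapP[i' _ ->].
Qed.

End Best.

(** * Collecting the error factors *)

Section Ratio.
Variable R : realType.

(** To be read with e = 1 / K and costs in units of 1 / (Zt Den): [O] is the cost produced, [sW] the
    sum of weight numerators, [V] the accepted guess, [L] the cost of the program, [P] that of a
    near-optimal schedule and [T] the optimum. The constants are crude; 3322 is twice 1661. *)
Lemma ratio_bound (e O sW V L P T : R) : 0 < e -> e <= 1 / 4 -> 0 <= sW -> 0 <= V -> 0 <= L ->
  O <= 2 * (1 + 5 * e) * (sW + (1 + e) * (1 + 5 * e) * V) ->
  V <= (1 + e) * L + 1 -> L <= (1 + 3 * e) * P + 3 * sW -> P <= (1 + e) * T ->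
  sW + 1 <= e * T -> O <= (2 + 3322 * e) * T.
Proof.
move=> e0 e4 s0 v0 l0 hO hV hL hP hs.
have T0 : 0 <= T by rewrite -(pmulr_rge0 _ e0); lra.
have mulT a b : a <= b -> a * T <= b * T by move=> h; exact: ler_wpM2r.
have h1 : L <= (1 + 10 * e) * T.
  have : (1 + 3 * e) * P <= (1 + 3 * e) * ((1 + e) * T) by apply: ler_wpM2l => //; lra.
  have : (1 + 3 * e) * (1 + e) + 3 * e <= 1 + 10 * e by nra.
  by move=> /mulT; lra.
have h2 : V <= (1 + 22 * e) * T.
  have : (1 + e) * L <= (1 + e) * ((1 + 10 * e) * T) by apply: ler_wpM2l => //; lra.
  have : (1 + e) * (1 + 10 * e) + e <= 1 + 22 * e by nra.
  by move=> /mulT; lra.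
have h3 : sW + (1 + e) * (1 + 5 * e) * V <= (1 + 276 * e) * T.
  have : (1 + e) * (1 + 5 * e) * V <= (1 + e) * (1 + 5 * e) * ((1 + 22 * e) * T).
    by apply: ler_wpM2l => //; apply: mulr_ge0; lra.
  have : (1 + e) * (1 + 5 * e) * (1 + 22 * e) + e <= 1 + 276 * e.
    have : (1 + e) * (1 + 5 * e) <= 1 + 11 * e by nra.
    by move=> h; nra.
  by move=> /mulT; lra.
apply: le_trans hO _.
have : (1 + 5 * e) * (sW + (1 + e) * (1 + 5 * e) * V) <= (1 + 5 * e) * ((1 + 276 * e) * T).
  by apply: ler_wpM2l => //; lra.
have : (1 + 5 * e) * (1 + 276 * e) <= 1 + 1661 * e by nra.
by move=> /mulT; lra.
Qed.

End Ratio.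

Section LateSum.
Variables (R : realType) (K : nat).
Hypothesis K0 : (0 < K)%N.

Let KR : 0 < K%:R :> R. Proof. by rewrite ltr0n. Qed.

Lemma tg_two k : (tg K k.+2)%:R <= (1 + 3 / K%:R) * (tg K k)%:R + 3 :> R.
Proof.
have h : (K * (K * tg K k.+2) <= K * ((K + 3) * tg K k + 3 * K))%N.
  have hl m : (K * lg K m <= tg K m + K)%N.
    by rewrite /lg mulnS addnC leq_add2r mulnC leq_trunc_div.
  have := hl k; have := hl k.+1; rewrite !tgS; move: (tg K k) (lg K k) (lg K k.+1) => t l l'.
  move=> h1 h2; have h3 : (K * (K * l') <= K * (t + l + K))%N by rewrite leq_mul2l h1 orbT.
  have h4 : (K * (K * l) <= K * (t + K))%N by rewrite leq_mul2l h2 orbT.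
  have h5 : (t + K <= K * (t + K))%N by rewrite leq_pmull.
  by move: h1 h2 h3 h4 h5; rewrite !mulnDr !mulnDl !mulnDr; lia.
rewrite leq_mul2l (gtn_eqF K0) /= in h.
rewrite -(ler_pM2l KR) -natrM; apply: (@le_trans _ _ ((K + 3) * tg K k + 3 * K)%:R).
  by rewrite ler_nat.
rewrite natrD !natrM natrD le_eqVlt; apply/orP; left; apply/eqP.
by field; rewrite gt_eqF.
Qed.

(** If [m] is the last late slot, the lengths telescope to less than [tg K m.+2], and two grid steps
    cost a factor 1 + 3 / K and a summand 3. *)
Lemma late_sum m (c : R) : 0 <= c ->
  \sum_(k <- iota 0 m) (lg K k.+1)%:R * (if (tg K k)%:R < c then 1 else 0)
    <= (1 + 3 / K%:R) * c + 3.
Proof.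
move=> c0; have e0 : 0 < 3 / K%:R :> R by rewrite divr_gt0.
elim: m => [|m IH]; first by rewrite big_nil addr_ge0 // mulr_ge0 // ltW // ltr_wpDl.
have -> : iota 0 m.+1 = iota 0 m ++ [:: m] by rewrite -(addn1 m) iotaD add0n.
case: (ltP (tg K m)%:R c) => h; last first.
  by rewrite big_cat big_seq1 /= ltNge h /= mulr0 addr0.
apply: (@le_trans _ _ (tg K m.+2)%:R).
  rewrite (sum_lg K m.+1) natrD natr_sum -(addn1 m) iotaD add0n; apply: ler_wpDl; first exact: ler0n.
  by apply: ler_sum => k _; apply: ler_piMr; [exact: ler0n|case: ifP].
by apply: le_trans (tg_two m) _; rewrite lerD2r ler_wpM2l // ltW // ltr_wpDl.
Qed.

Lemma guess (L : R) N : 0 <= L -> L <= (tg K N.+1)%:R ->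
  exists k, [/\ (k <= N)%N, L <= (tg K k.+1)%:R & (tg K k.+1)%:R <= (1 + K%:R^-1) * L + 1].
Proof.
move=> L0 hN; have e0 : 0 < K%:R^-1 :> R by rewrite invr_gt0.
have [k hk hm] := ex_minnP (ex_intro (fun k => L <= (tg K k.+1)%:R) N hN).
exists k; split=> //; first exact: hm.
case: k hk hm => [|k] hk hm.
  by rewrite tgS /lg /= div0n ler_wpDl // mulr_ge0 // ltW // ltr_wpDl.
have h : (tg K k.+1)%:R < L by rewrite ltNge; apply/negP => /hm; rewrite ltnn.
rewrite tgS natrD mulrDl mul1r -addrA; apply: lerD; first exact: ltW.
rewrite /lg -natr1 lerD2r mulrC ler_pdivlMr // -natrM; apply: le_trans (ltW h).
by rewrite ler_nat leq_trunc_div.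
Qed.

End LateSum.

(** * Quality of the accepted candidate *)

Section Quality.
Variables (R : realType) (I : psp) (x : inst) (K : nat).
Hypotheses (wf : psp_wf I) (hx : represents I x) (hK : (4 <= K)%N).

Let K0 : (0 < K)%N. Proof. by lia. Qed.
Let g0 := dflt_group (njobs I).
Let ZR : 0 < (Zt K x)%:R :> R. Proof. by rewrite ltr0n (Zt_gt0 hx). Qed.
Let DR : 0 < (Den x)%:R :> R. Proof. by rewrite ltr0n (rep_den hx). Qed.

Section Bounds.
Variable y : R -> 'rV[R]_(njobs I).

Lemma lp_cost_ge0 : 0 <= lp_cost x K y.
Proof.
apply: sumr_ge0 => g _; rewrite mulr_ge0 // sumr_ge0 // => k _.
by rewrite mulr_ge0 // /late; case: ifP.
Qed.

(** This bound does not depend on the schedule; [Hv] is chosen so that the guesses reach it. *)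
Lemma lp_cost_trivial : lp_cost x K y <= (sumW x * tg K (Hor K x).+1)%:R.
Proof.
rewrite natrM /sumW natr_sum mulr_suml; apply: ler_sum => g _.
rewrite ler_wpM2l // sum_lg // natrD natr_sum; apply: ler_wpDl => //.
apply: ler_sum => k _; apply: ler_piMr => //.
by rewrite /late; case: ifP.
Qed.

Lemma lp_cost_objective :
  lp_cost x K y <= (1 + 3 / K%:R) * (objective y * ((Zt K x)%:R * (Den x)%:R)) + 3 * (sumW x)%:R.
Proof.
rewrite objectiveE /sumW natr_sum mulr_suml !mulr_sumr -(rep_G hx) -big_split /=.
rewrite /lp_cost big_seq [leRHS]big_seq; apply: ler_sum => g; rewrite mem_iota add0n => hg.
rewrite (rep_w hx) // -?(rep_G hx) // fmorph_div !rmorph_nat.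
have C0 := group_completion_ge0 y (nth g0 (groups I) g).1; set C := group_completion _ _ in C0 *.
have -> : (1 + 3 / K%:R) * ((Wg x g)%:R / (Den x)%:R * C * ((Zt K x)%:R * (Den x)%:R)) + 3 * (Wg x g)%:R
  = (Wg x g)%:R * ((1 + 3 / K%:R) * (C * (Zt K x)%:R) + 3).
  have kR : 0 < K%:R :> R by rewrite ltr0n.
  move: kR DR; move: (Zt K x) (Den x) (Wg x g) => z d w k0 d0.
  by field; rewrite !gt_eqF.
rewrite ler_wpM2l //.
have := @late_sum R K K0 (Hor K x) (C * (Zt K x)%:R) (mulr_ge0 C0 (ltW ZR)).
apply: le_trans; rewrite le_eqVlt; apply/orP; left; apply/eqP; apply: eq_bigr => k _.
by congr (_ * _); rewrite /late /tau ltr_pdivrMr.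
Qed.

Lemma best_quality : feasible y ->
  okc K x (best K x) /\ (best K x).1%:R <= (1 + K%:R^-1) * lp_cost x K y + 1.
Proof.
move=> fy; have hN : lp_cost x K y <= (tg K (Hv K x))%:R.
  apply: le_trans lp_cost_trivial _; rewrite ler_nat /Hv.
  exact: leq_trans (tg_large K0 _) (tg_mono K (leqnSn _)).
have [k [hk h1 h2]] := guess K0 lp_cost_ge0 hN.
have V0 : (0 < tg K k.+1)%N by rewrite tgS addnC.
have hcov := @sol_cover R I x K _ hx hK V0 (lp_val x K y) (fun v _ => lp_val_ge0 x K wf fy v)
  (lp_pack wf hx hK fy V0 h1) (lp_cover wf hx hK fy).
have [i hi ho] := exists_okc hx hK V0 (fun v => @mw_sub _ _ _ _ _ _ _ _ _ _ _ _ v) (sol_load R hx hK V0 (mem_head _ _)) hcov.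
have [ho' hb] := best_le K0 hk hi ho; split=> //.
by apply: le_trans h2; rewrite ler_nat.
Qed.

End Bounds.

Lemma best_valid :
  exists V h i, [/\ best K x = (V, (h, i)), (0 < V)%N, {subset h <= cols K x}, (0 < i <= K)%N &
  forall r, r \in rowsP K x -> (K * load (Pm K x V) h r <= (K + 5) * (Uc K x * Dc K x V))%N].
Proof.
rewrite /best; case E : [seq c <- cands K x | okc K x c] => [|c s].
  exists 1%N, [::], 1%N; split=> // r _; by rewrite /load big_nil muln0.
have : c \in [seq c <- cands K x | okc K x c] by rewrite E mem_head.
rewrite mem_filter => /andP[_ /candsP[k _ [i hi ->]]].
have V0 : (0 < tg K k.+1)%N by rewrite tgS addnC.
exists (tg K k.+1), (sol K x (tg K k.+1)), i; split=> //.
  by move=> v; exact: mw_sub.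
by move=> r hr; exact: (sol_load R hx hK V0).
Qed.

End Quality.

(** * Optimum zero or bounded away from zero *)

Section Degenerate.
Variables (R : realType) (I : psp) (x : inst).
Hypotheses (wf : psp_wf I) (hx : represents I x).

Let n := njobs I.
Let g0 := dflt_group n.
Let DR : 0 < (Den x)%:R :> R. Proof. by rewrite ltr0n (rep_den hx). Qed.
Let rat_nat a b : ratr (a%:R / b%:R) = a%:R / b%:R :> R.
Proof. by rewrite fmorph_div !rmorph_nat. Qed.

(** Job [j] cannot be completed arbitrarily early. *)
Definition constrained j := (0 < Pj x j)%N &&
  ((0 < Rj x j)%N || has (fun d => 0 < Bdj x d j)%N (iota 0 (nD x))).

(** Either the release date is at least 1 / Den, or a packing row keeps the rate below Den while the
    requirement is at least 1 / Den. *)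
Lemma completion_lb (y : R -> 'rV[R]_n) (j : 'I_n) : feasible y -> constrained (val j) ->
  1 <= completion y j * ((Den x)%:R * (Den x)%:R).
Proof.
move=> fy /andP[hp h]; have [my hP hr hf] := fy.
have c0 := completion_ge0 (hf j); set c := completion y j in c0 *.
pose yj (t : R) : R := y t 0 j.
have y0 (t : R) : 0 <= t -> 0 <= yj t by move=> t0; case: (hP t t0) => h1 _; exact: h1.
have hw : ((ratr (proc I 0 j))%:E <= work yj 0%R c)%E by apply/(finishedP (my j) c0).1/hf.
rewrite (rep_p hx) rat_nat in hw.
have D1 : 1 <= (Den x)%:R :> R by rewrite ler1n (rep_den hx).
have P1 : 1 <= (Pj x j)%:R :> R by rewrite ler1n.
have PD : 0 < (Pj x j)%:R / (Den x)%:R :> R by rewrite divr_gt0 // ltr0n.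
case/orP: h => [h|/hasP[d]].
  have hc : (Rj x j)%:R / (Den x)%:R <= c.
    rewrite leNgt; apply/negP => hlt; move: hw.
    rewrite (@work_cst _ _ _ _ 0) // => [|t h1 h2].
      by rewrite mul0r lee_fin leNgt PD.
    by apply: hr => //; rewrite (rep_r hx) rat_nat; exact: lt_trans h2 hlt.
  rewrite ler_pdivrMr // in hc.
  have R1 : 1 <= (Rj x j)%:R :> R by rewrite ler1n.
  rewrite mulrA; apply: le_trans (ler_peMr _ D1); first exact: le_trans hc.
  by rewrite mulr_ge0 // ltW.
rewrite mem_iota add0n (rep_D hx) => hd hb.
have B1 : 1 <= (Bdj x d j)%:R :> R by rewrite ler1n.
have hbE : ratr (pack I (Ordinal hd) j) = (Bdj x d j)%:R / (Den x)%:R :> R by rewrite (rep_b hx) rat_nat.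
have hM (t : R) : 0 <= t -> yj t <= (Den x)%:R.
  move=> t0; have [h1 /(_ (Ordinal hd))] := hP t t0; rewrite (bigD1 j) //= => hs.
  have h2 : ratr (pack I (Ordinal hd) j) * yj t <= 1.
    apply: le_trans hs; apply: ler_wpDr => //; apply: sumr_ge0 => i _.
    by rewrite mulr_ge0 // ler0q; case: wf.
  rewrite hbE mulrAC ler_pdivrMr // mul1r in h2.
  by apply: le_trans h2; rewrite ler_peMl // y0.
have := le_trans hw (work_le_bound (my j) y0 (lexx 0) c0 hM).
rewrite subr0 lee_fin ler_pdivrMr // => h3; lra.
Qed.

Lemma objective_lb (y : R -> 'rV[R]_n) g (j : 'I_n) : feasible y ->
  (g < nG x)%N -> Sg x g j -> constrained (val j) ->
  1 <= objective y * ((Den x)%:R * (Den x)%:R * (Den x)%:R).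
Proof.
move=> fy hg hS hc; rewrite (rep_G hx) in hg; rewrite (rep_S hx) // in hS.
have hC := le_trans (completion_lb fy hc) (ler_wpM2r _ (completion_le_group y hS)).
have W1 : 1 <= ratr (nth g0 (groups I) g).2 * (Den x)%:R :> R.
  have := weight_gt0 wf hg; rewrite (rep_w hx) // rat_nat divfK ?gt_eqF // ler1n.
  by rewrite pmulr_lgt0 ?invr_gt0 ?ltr0n // (rep_den hx).
have D2 : 0 <= (Den x)%:R * (Den x)%:R :> R by rewrite mulr_ge0.
have hO : ratr (nth g0 (groups I) g).2 * group_completion y (nth g0 (groups I) g).1 <= objective y.
  rewrite objectiveE (bigD1_seq g) ?iota_uniq ?mem_iota //=; apply: ler_wpDr => //.
  rewrite big_seq_cond; apply: sumr_ge0 => g' /andP[+ _]; rewrite mem_iota add0n => hg'.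
  by rewrite mulr_ge0 ?group_completion_ge0 // ler0q ltW // weight_gt0.
apply: (@le_trans _ _ (ratr (nth g0 (groups I) g).2 * group_completion y (nth g0 (groups I) g).1 * ((Den x)%:R * (Den x)%:R * (Den x)%:R))); last first.
  by rewrite ler_wpM2r // mulr_ge0.
have := ler_pM ler01 ler01 W1 (hC D2); rewrite mulr1.
by move=> h; apply: le_trans h _; rewrite le_eqVlt; apply/orP; left; apply/eqP; ring.
Qed.

Variable K : nat.
Hypothesis hK : (4 <= K)%N.
Let K0 : (0 < K)%N. Proof. by lia. Qed.

(** Unconstrained jobs are run entirely in the first slot, all others in the last. *)
Lemma optimum_degenerate Z : (0 < Z)%N ->
  (forall g (j : 'I_n), (g < nG x)%N -> Sg x g j -> ~~ constrained (val j)) ->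
  optimum R I <= (\sum_(g <- iota 0 (size (groups I))) ratr (nth g0 (groups I) g).2)
     * (((K + 5) * (K + 1))%:R / K%:R) / Z%:R.
Proof.
move=> Z0 hdeg; pose H := (K * bl (K * Z * Tot x))%N.
pose free j := (Rj x j == 0%N) && all (fun d => Bdj x d j == 0%N) (iota 0 (nD x)).
pose X k j : rat := if k == H then 1 else if (k == 0%N) && free j then 1 else 0.
have hT : (K * Z * Tot x <= tg K H)%N by exact: tg_large.
have [] := @slots_props R I K Z H 1 X K0 Z0.
- by rewrite /= ltnS.
- by case: wf.
- by move=> k j _; rewrite /X; do 2!case: ifP => //.
- move=> k d hk; have [->|hkH] := eqVneq k H.
    rewrite /X eqxx; under eq_bigr do rewrite mulr1.
    exact: (last_slot_pack hx hK _ hT).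
  rewrite big1 ?mulr0 ?mulr_ge0 // => j _; rewrite /X (negPf hkH).
  case: ifP => [/andP[_ /andP[_ /allP /(_ (val d))]]|]; last by rewrite !mulr0.
  rewrite mem_iota (rep_D hx) ltn_ord => /(_ isT) /eqP hb.
  by rewrite (rep_b hx) hb mul0r mul0r.
- move=> k j hk; have [-> _|hkH] := eqVneq k H; first exact: (last_slot_release hx hK _ hT).
  rewrite /X (negPf hkH); case: ifP => [/andP[_ /andP[/eqP hr _]] _|]; last by rewrite eqxx.
  by rewrite (rep_r hx) hr !mul0r.
- by move=> j; rewrite /X eqxx.
move=> fz hz; apply: le_trans (optimum_le wf fz) _.
apply: le_trans (objective_le wf (c := fun=> ratr (slot_end K Z 1 1)) _ _) _.
- by move=> g _; rewrite ler0q /slot_end divr_ge0.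
- move=> g j hg hj; apply: hz => //; rewrite -(rep_S hx) // in hj.
  have := hdeg g j; rewrite (rep_G hx) => /(_ hg hj); rewrite negb_and => /orP[|hn].
    by rewrite -eqn0Ngt (rep_p hx) => /eqP ->; left; rewrite mul0r.
  right; rewrite big_ord1 /X.
  have -> : free (val j).
    move: hn; rewrite negb_or -eqn0Ngt => /andP[hr hb]; rewrite /free hr /=.
    by apply/allP => d hd; move/hasPn: hb => /(_ d hd); rewrite -eqn0Ngt.
  have -> : (if 0%N == H then 1 else if (0%N == 0%N) && true then 1 else 0) = 1 :> rat by case: ifP.
  by rewrite mulr1 ler1n addn1.
rewrite -mulr_suml -mulrA le_eqVlt; apply/orP; left; apply/eqP; congr (_ * _).
rewrite /slot_end tgS /lg /tg /= div0n add0n !muln1 rat_nat [(K * Z)%:R]natrM.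
by field; rewrite !gt_eqF // ltr0n.
Qed.

(** The time unit 1 / Z of [optimum_degenerate] is arbitrary, so its bound tends to 0. *)
Lemma optimum_degenerate0 :
  (forall g (j : 'I_n), (g < nG x)%N -> Sg x g j -> ~~ constrained (val j)) ->
  optimum R I <= 0.
Proof.
move=> hdeg; rewrite leNgt; apply/negP => h0.
have := fun Z hZ => @optimum_degenerate Z hZ hdeg.
set A := _ * (_ / _) => hA.
have hN := archi_boundP (normr_ge0 (A / optimum R I)); set N := Num.bound _ in hN.
have := hA N.+1 isT; rewrite ler_pdivlMr // mulrC -ler_pdivlMr // leNgt.
apply/negP; rewrite negbK; apply: le_lt_trans (ler_norm _) _.
by apply: lt_le_trans hN _; rewrite ler_nat.
Qed.

End Degenerate.

(** Weights are positive, so all members of groups complete at time 0, when no work has been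
    done. *)
Lemma objective_eq0 (R : realType) (I : psp) (y : R -> 'rV[R]_(njobs I)) g j :
  psp_wf I -> feasible y -> objective y = 0 ->
  (g < size (groups I))%N -> j \in (nth (dflt_group (njobs I)) (groups I) g).1 ->
  proc I 0 j = 0.
Proof.
move=> wf fy h0 hg hj; have [my hP _ hf] := fy.
have y0 (t : R) : 0 <= t -> 0 <= y t 0 j by move=> t0; case: (hP t t0) => h1 _; exact: h1.
have w0 g' : (g' < size (groups I))%N ->
    0 <= ratr (nth (dflt_group (njobs I)) (groups I) g').2 *
      group_completion y (nth (dflt_group (njobs I)) (groups I) g').1.
  by move=> hg'; rewrite mulr_ge0 ?group_completion_ge0 // ler0q ltW // weight_gt0.
have hc : completion y j = 0.
  apply/eqP; rewrite eq_le (completion_ge0 (hf j)) andbT.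
  apply: le_trans (completion_le_group y hj) _; rewrite leNgt; apply/negP => hlt.
  move: h0; rewrite objectiveE (bigD1_seq g) ?iota_uniq ?mem_iota //=.
  apply/eqP; rewrite gt_eqF // ltr_wpDr //.
    by rewrite big_seq_cond; apply: sumr_ge0 => g' /andP[+ _]; rewrite mem_iota => /w0.
  by rewrite mulr_gt0 // ltr0q weight_gt0.
have := hf j; rewrite hc => /(finishedP (my j) (lexx 0)).1.
rewrite (@work_cst _ _ _ _ 0) // => [|t h1 h2]; last by move: (le_lt_trans h1 h2); rewrite ltxx.
rewrite mul0r lee_fin lerq0 => h.
by apply/eqP; rewrite eq_le h; case: wf => ->.
Qed.

(** * The schedule of the accepted candidate against the optimum *)

Section Main.
Variables (R : realType) (I : psp) (x : inst) (K : nat).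
Hypotheses (wf : psp_wf I) (hx : represents I x) (hK : (4 <= K)%N).

Let K0 : (0 < K)%N. Proof. by lia. Qed.
Let g0 := dflt_group (njobs I).

Lemma best_schedule : exists s : explicit_schedule (njobs I),
  [/\ enc_schedule s = eseq (eprod eqcode (eseq eqcode)) (output K x (best K x)),
      feasible (rates s : R -> 'rV[R]_(njobs I))
    & (optimum R I = 0 -> exists2 y : R -> 'rV[R]_(njobs I), feasible y & objective y = 0) ->
      objective (rates s : R -> 'rV[R]_(njobs I)) <= (2 + 3322 / K%:R) * optimum R I].
Proof.
have [V [h [i [E V0 hh hi hload]]]] := best_valid R hx hK.
have [fs hs] := sched_props R wf hx hK V0 hh hload hi.
exists (sched I x K V h i); split=> //.
  by rewrite E; exact: (sched_output hx hK V0 h hi).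
have O0 := optimum_ge0 wf fs; move=> hatt.
(* Without a constrained group member the optimum is 0. As it is then attained by assumption, all
   group members have requirement 0 and are finished at the left end of the first slot. *)
case: (pselect (exists g (j : 'I_(njobs I)), [/\ (g < nG x)%N, Sg x g j & constrained x (val j)])); last first.
  move=> hdeg; have OE : optimum R I = 0.
    apply/eqP; rewrite eq_le O0 andbT; apply: (optimum_degenerate0 R wf hx hK).
    by move=> g j hg hS; apply/negP => hc; apply: hdeg; exists g, j.
  have [y fy hy] := hatt OE; rewrite OE mulr0.
  apply: le_trans (objective_le wf (c := fun=> 0) _ _) _ => // [g j hg hj|].
    rewrite -(rmorph0 (ratr : rat -> R)) -(slot_end0 K (Zt K x) i).
    by apply: hs => //; left; exact: objective_eq0 wf fy hy hg hj.
  by under eq_bigr do rewrite mulr0; rewrite big1.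
move=> [g [j [hg hS hc]]].
have ZR : 0 < (Zt K x)%:R :> R by rewrite ltr0n (Zt_gt0 hx hK).
have DR : 0 < (Den x)%:R :> R by rewrite ltr0n (rep_den hx).
have KR : 0 < K%:R :> R by rewrite ltr0n.
have iR : 0 < i%:R :> R by rewrite ltr0n; case/andP: hi.
have OPT : 1 <= optimum R I * ((Den x)%:R * (Den x)%:R * (Den x)%:R).
  rewrite -ler_pdivrMr ?mulr_gt0 //; apply: lb_le_inf; first by exists (objective (rates (sched I x K V h i) : R -> 'rV[R]_(njobs I))); exists (rates (sched I x K V h i)).
  by move=> _ [y fy <-]; rewrite ler_pdivrMr ?mulr_gt0 //; exact: (objective_lb wf hx fy hg hS hc).
have Opos : 0 < optimum R I.
  by move: OPT; case: ltgtP O0 => // -[<-] _; rewrite mul0r ler10.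
(* The infimum need not be attained; a schedule within a factor 1 + 1 / K of it takes the place of
   an optimal one. *)
have [y fy hy] := optimum_approx wf fs (divr_gt0 Opos KR).
have [hok hV] := best_quality wf hx hK fy.
have hL := lp_cost_objective hx hK y.
have L0 := lp_cost_ge0 x K y.
have hO := sched_objective R wf hx hK V0 hh hload hi.
rewrite E /= in hok hV.
pose ZD : R := (Zt K x)%:R * (Den x)%:R.
have ZD0 : 0 < ZD by rewrite mulr_gt0.
rewrite -(ler_pM2r ZD0) -mulrA.
apply: (@ratio_bound R K%:R^-1 _ (sumW x)%:R V%:R (lp_cost x K y) (objective y * ZD)) => //.
- by rewrite invr_gt0.
- by rewrite mul1r lef_pV2 ?posrE // ler_nat.
- apply: (@le_trans _ _ (((K + 5) * (K + 1) * Ob K x V h i)%:R / (K%:R * i%:R))).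
    move: hO; rewrite fmorph_div !rmorph_nat => /(ler_wpM2r (ltW ZD0)) /le_trans; apply.
    rewrite le_eqVlt; apply/orP; left; apply/eqP; rewrite /ZD.
    move: ZR DR KR iR; move: (Zt K x) (Den x) (Ob _ _ _ _ _) => z d o z0 d0 k0 i0.
    by rewrite !natrM; field; rewrite !gt_eqF.
  move: hok; rewrite /okc -(ler_nat R).
  move: (Ob _ _ _ _ _) (sumW x) => o w hok.
  have hc' : 0 <= (K + 5)%:R / (K%:R * i%:R * (K * K)%:R) :> R by rewrite divr_ge0 // !mulr_ge0.
  apply: (@le_trans _ _ ((K * K * (K + 1) * o)%:R * ((K + 5)%:R / (K%:R * i%:R * (K * K)%:R)))).
    rewrite le_eqVlt; apply/orP; left; apply/eqP.
    by rewrite !natrM; field; rewrite !gt_eqF.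
  apply: le_trans (ler_wpM2r hc' hok) _; rewrite le_eqVlt; apply/orP; left; apply/eqP.
  by rewrite !(natrM, natrD); field; rewrite !gt_eqF.
- have -> : (1 + K%:R^-1) * (optimum R I * ZD) = (optimum R I + optimum R I / K%:R) * ZD by ring.
  by rewrite ler_pM2r // ltW.
(* The choice of [Zt] pays off here: the optimum times Den ^ 3 is at least 1, so [sumW] plus 1 is at
   most a [K]-th of the scaled optimum. *)
rewrite /ZD.
have -> : (Zt K x)%:R = K%:R * ((Den x)%:R * (Den x)%:R * (Den x)%:R) * ((sumW x)%:R + 1) :> R.
  rewrite /Zt; move: (Den x) (sumW x) => d w; rewrite !natrM natrD; ring.
have D1 : 1 <= (Den x)%:R :> R by rewrite ler1n (rep_den hx).
have W0 : 0 <= (sumW x)%:R + 1 :> R by rewrite addr_ge0.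
have -> : K%:R^-1 * (optimum R I * (K%:R * ((Den x)%:R * (Den x)%:R * (Den x)%:R) * ((sumW x)%:R + 1) * (Den x)%:R))
  = (optimum R I * ((Den x)%:R * (Den x)%:R * (Den x)%:R)) * (Den x)%:R * ((sumW x)%:R + 1).
  by field; rewrite gt_eqF.
by rewrite ler_peMl // mulr_ege1.
Qed.

End Main.

Lemma poly_of_pow k : exists q : {poly nat}, forall n, ((n + 2) ^ k <= q.[n])%N.
Proof.
elim: k => [|k [q hq]]; first by exists 1 => n; rewrite hornerE.
exists (q * 'X + q + q) => n; rewrite !hornerE expnS.
rewrite /GRing.add /GRing.mul /=; have := hq n; move: ((n + 2) ^ k)%N q.[n] => a b.
by nia.
Qed.

Lemma exists_precision (R : realType) (eps C : R) : 0 < eps -> 0 <= C ->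
  exists2 K, (4 <= K)%N & C / K%:R <= eps.
Proof.
move=> e0 C0; exists (Num.bound (C / eps)).+4; first by [].
rewrite ler_pdivrMr ?ltr0n // mulrC -ler_pdivrMr //.
by apply: le_trans (ltW (archi_boundP (divr_ge0 C0 (ltW e0)))) _; rewrite ler_nat -addn4 leq_addr.
Qed.

Theorem theorem5 (R : realType) (eps : R) (heps : 0 < eps) :
  exists c : cmd, approximation_algorithm (2 + eps) c.
Proof.
have [K hK hKe] := exists_precision heps (ler0n R 3322).
have [c [m [g [[k hk] hc]]]] := pf_algo K.
have [q hq] := poly_of_pow k.
exists c, q => I wf; have hx := to_instP wf.
have [s [hs fs ho]] := best_schedule R wf hx hK.
have [t ht htg] : exists2 t, exec c (update (fun=> Leaf) 0 (enc_psp I))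
    (update (update (fun=> Leaf) 0 (enc_psp I)) 0 (enc_schedule s)) t & (t <= g (raw_of I))%N.
  rewrite raw_ofE hs; apply: hc => // i /andP[i0 _].
  by rewrite /update gtn_eqF.
exists s, t; split=> //.
- by eexists; split; first exact: ht.
- by apply: leq_trans htg _; rewrite raw_ofE; apply: leq_trans (hk _) (hq _).
move=> /ho /le_trans; apply; apply: ler_wpM2r; last by rewrite lerD2l.
exact: (optimum_ge0 wf fs).
Qed.
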